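(* Let $\alpha\in(0,1)$, let $A\in\mathbb{R}^{d\times d}$, and let $f:\mathbb{R}^d\to\mathbb{R}^d$ be continuous on $\mathbb{R}^d$ and Lipschitz continuous in a neighborhood of the origin, with $$ f(0)=0\quad\text{and}\quad \lim_{r\to 0}\ell_f(r)=0,\qquad \ell_f(r):=\sup_{x,y\in B_{\mathbb{R}^d}(0,r),\,x\ne y}\frac{\|f(x)-f(y)\|}{\|x-y\|}. $$ Assume that every eigenvalue $\lambda$ of $A$ satisfies $\lambda\in\mathbb{C}\setminus\{0\}$ and $|\arg(\lambda)|>\frac{\alpha\pi}{2}$. Then the trivial solution of the fractional differential equation $$ {}^{C}D^{\alpha}_{0+}x(t)=Ax(t)+f(x(t)),\quad t>0, $$ is Mittag-Leffler stable.
   Context: $\|\cdot\|$ is the Euclidean norm, $B_{\mathbb{R}^d}(0,r)$ is the closed ball of radius $r$ centered at $0$, and $\arg$ takes values in $(-\pi,\pi]$. For $\alpha\in(0,1)$ the Riemann--Liouville integral is $I^{\alpha}_{0+}x(t)=\frac{1}{\Gamma(\alpha)}\int_0^t(t-\tau)^{\alpha-1}x(\tau)\,d\tau$, the Riemann--Liouville derivative is ${}^{R}D^{\alpha}_{0+}x(t)=\frac{d}{dt}(I^{1-\alpha}_{0+}x)(t)$, and the Caputo derivative is ${}^{C}D^{\alpha}_{0+}x(t)={}^{R}D^{\alpha}_{0+}(x(t)-x(0))$, taken componentwise. Solutions are continuous functions; equivalently, for an equation ${}^{C}D^{\alpha}_{0+}x=F(x)$ with $F$ continuous, $x$ is a solution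 with $x(0)=x_0$ iff $x(t)=x_0+\frac1{\Gamma(\alpha)}\int_0^t(t-\tau)^{\alpha-1}F(x(\tau))\,d\tau$ on its interval of definition. For $x_0$ near $0$, $\Phi(\cdot,x_0)$ denotes the solution with $\Phi(0,x_0)=x_0$ on its maximal interval of existence (solutions are unique as long as they stay in the neighborhood of the origin where the right-hand side is Lipschitz). Definition (Mittag-Leffler stability): the trivial solution (equilibrium point $x^*=0$) is Mittag-Leffler stable if there exist positive constants $\beta,m,\delta$ such that for all $\|x_0\|\le\delta$ the solution $\Phi(\cdot,x_0)$ exists on $[0,\infty)$ and $\sup_{t\ge0}t^{\beta}\|\Phi(t,x_0)\|\le m$. *)

(* Defs.v *)
From mathcomp Require Export all_boot all_order all_algebra complex.
From mathcomp Require Export all_classical all_reals all_analysis.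
Export numFieldNormedType.Exports.

Set Implicit Arguments.
Unset Strict Implicit.
Unset Printing Implicit Defensive.

Import Order.TTheory GRing.Theory Num.Theory.
Local Open Scope classical_set_scope.
Local Open Scope ring_scope.

(** The library norm on ['cV[R]_d] is the sup norm, hence this definition. *)
Definition enorm (R : realType) (d : nat) (x : 'cV[R]_d) : R :=
  Num.sqrt (\sum_(i < d) x i ord0 ^+ 2).

Definition eball (R : realType) (d : nat) (r : R) : set 'cV[R]_d :=
  [set x | enorm x <= r].

Definition lipschitz_near0 (R : realType) (d : nat)
    (f : 'cV[R]_d -> 'cV[R]_d) : Prop :=
  exists r L : R, 0 < r /\
    forall x y, eball r x -> eball r y ->
      enorm (f x - f y) <= L * enorm (x - y).

(** Taken in the extended reals, so that it is [+oo] when [f] is not Lipschitz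
    on the ball of radius [r]. *)
Definition lip_modulus (R : realType) (d : nat)
    (f : 'cV[R]_d -> 'cV[R]_d) (r : R) : \bar R :=
  ereal_sup [set q | exists x y : 'cV[R]_d,
    [/\ eball r x, eball r y, x != y &
        q = (enorm (f x - f y) / enorm (x - y))%:E]].

(** Principal argument, in ]-pi, pi]; meaningful for [z != 0] only. *)
Definition carg (R : realType) (z : R[i]) : R :=
  let theta := acos (complex.Re z / Num.sqrt (complex.Re z ^+ 2
                                              + complex.Im z ^+ 2)) in
  if 0 <= complex.Im z then theta else - theta.

Definition Gamma (R : realType) (a : R) : R :=
  \int[lebesgue_measure]_(t in `]0, +oo[) (t `^ (a - 1) * expR (- t)).

Definition RL_integral (R : realType) (alpha : R) (g : R -> R) (t : R) : R :=
  (Gamma alpha)^-1 *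
  \int[lebesgue_measure]_(tau in `[0, t]) ((t - tau) `^ (alpha - 1) * g tau).

(** The fractional derivatives are relations "exists at [t] and equals [v]",
    since [derive1] is a total function. *)
Definition is_RL_derivative (R : realType) (alpha : R) (g : R -> R)
    (t v : R) : Prop :=
  is_derive t 1 (RL_integral (1 - alpha) g) v.

Definition is_Caputo_derivative (R : realType) (alpha : R) (g : R -> R)
    (t v : R) : Prop :=
  is_RL_derivative alpha (fun s => g s - g 0) t v.

Definition is_vCaputo_derivative (R : realType) (d : nat) (alpha : R)
    (x : R -> 'cV[R]_d) (t : R) (v : 'cV[R]_d) : Prop :=
  forall i, is_Caputo_derivative alpha (fun s => x s i ord0) t (v i ord0).

(** Solutions live on [[0, T[] with [T] possibly infinite; the values of [x]
    outside this interval are irrelevant. *)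
Definition time_domain (R : realType) (T : \bar R) : set R :=
  [set t | 0 <= t /\ (t%:E < T)%E].

Definition is_solution (R : realType) (d : nat) (alpha : R)
    (F : 'cV[R]_d -> 'cV[R]_d) (x0 : 'cV[R]_d) (T : \bar R)
    (x : R -> 'cV[R]_d) : Prop :=
  [/\ (0 < T)%E,
      {within time_domain T, continuous x},
      x 0 = x0 &
      forall t, 0 < t -> (t%:E < T)%E ->
        is_vCaputo_derivative alpha x t (F (x t))].

(** [x] on [[0, T[] is the solution with its maximal interval of existence:
    every solution with the same initial value is a restriction of it. *)
Definition is_maximal_solution (R : realType) (d : nat) (alpha : R)
    (F : 'cV[R]_d -> 'cV[R]_d) (x0 : 'cV[R]_d) (T : \bar R)
    (x : R -> 'cV[R]_d) : Prop :=
  is_solution alpha F x0 T x /\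
  forall S y, is_solution alpha F x0 S y ->
    (S <= T)%E /\ {in time_domain S, y =1 x}.

Definition mittag_leffler_stable (R : realType) (d : nat) (alpha : R)
    (F : 'cV[R]_d -> 'cV[R]_d) : Prop :=
  exists beta m delta : R, [/\ 0 < beta, 0 < m, 0 < delta &
    forall x0 : 'cV[R]_d, enorm x0 <= delta ->
      exists Phi : R -> 'cV[R]_d,
        is_maximal_solution alpha F x0 +oo%E Phi /\
        (ereal_sup [set (t `^ beta * enorm (Phi t))%:E
                   | t in [set t : R | (0 <= t)%R]] <= m%:E)%E].

(* Main.v *)
Require Import Defs.
From HB Require Import structures.
From mathcomp Require Import ring lra measurable_realfun.

Set Implicit Arguments.
Unset Strict Implicit.
Unset Printing Implicit Defensive.
Import Order.TTheory GRing.Theory Num.Theory.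
Local Open Scope classical_set_scope.
Local Open Scope ring_scope.

(** The initial value problem is equivalent to the Volterra equation x = x0 + kap I(A x + f(x)),
    where I is the Riemann-Liouville integral without its Gamma factor ([RLk], [RLv]) and kap is
    [kapC]. Decay is obtained from L2 energy estimates for this equation, not from a resolvent
    formula.

    Positivity. The kernel t^(al-1) is a positive superposition of the damped oscillations exp(-(1 +
    i sg) r t), up to a constant phase that can be any psi with |psi| < (1-al) pi/2. Each of these
    gives a nonnegative quadratic form, so the real part of exp(-i psi) times the integral of (I v)
    conj(v) is nonnegative ([sector_positivity]). If |arg lam| > al pi/2, some such psi turns lam
    into the open left half-plane ([sector_angle]), and testing u = g + kap I(lam u + h) against
    this form bounds the L2 norm of u on [0, T] by those of g and h, uniformly in T
    ([scalar_energy_psi]). An induction along a product of factors A - lam that vanishes by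
    Cayley-Hamilton carries the bound over to systems ([vector_energy]).

    The constant x0 does not decay, so it is compensated by a multiple of (1+t)^(-al) A^-1 x0: the
    integral I of (1+t)^(-al) tends to a positive constant at an algebraic rate ([corrector_bound]).
    What remains is controlled by the weight (1+t)^(-al(1-al)), and a perturbation with small
    Lipschitz constant is absorbed ([perturbed_energy]). Hence the integral of |x|^2 over [0, T] is
    at most C |x0|^2 times the integral of the weight.

    From the mean to a point. For c > 1 the difference x(c t) - x(t) solves an equation of the same
    type with data of size c - 1, because the kernel is homogeneous. Its energy is O((c-1)^2), which
    bounds the difference quotient of T -> integral of |x|^2 over [0, T], and letting c tend to 1
    bounds T |x(T)|^2 ([dilation_decay]). This yields |x(t)|^2 <= C |x0|^2 t^(-al(1-al))
    ([solution_decay]), hence the exponent al(1-al)/2 for the norm.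

    The nonlinearity. [f] is composed with a coordinatewise truncation that makes it globally
    Lipschitz with a small constant; Picard iteration gives a global solution ([picard_exists]), and
    the decay estimate keeps it where the truncation is invisible. A continuity argument shows that
    every other solution of the original equation stays there too, so uniqueness for the truncated
    equation applies ([solution_unique]). *)

(** * Affine changes of variable in Lebesgue integrals *)

Section affine.
Context {R : realType}.
Notation mu := (@lebesgue_measure R).

Lemma measurable_affine (c b : R) :
  measurable_fun [set: measurableTypeR R] (fun x => c * x + b : measurableTypeR R).
Proof. by apply: measurable_funD => //; exact: measurable_funM. Qed.

(** As a function of [A] the left side is a measure that agrees with Lebesgue measure on the
    intervals []u, v]], and these determine it. For negative [c] the preimage is half-open on the
    other side, hence the two cases. *)
Lemma lebesgue_measure_affine (c b : R) (A : set R) : c != 0 ->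
  measurable A -> (`|c|%:E * mu ((fun x => c * x + b)%R @^-1` A))%E = mu A.
Proof.
move=> c0 mA; have c0' := normr_ge0 c.
have mphi := measurable_affine c b.
pose nu : {measure set (measurableTypeR R) -> \bar R} :=
  mscale (NngNum c0') (measure_function_pushforward__canonical__measure_function_Measure mu mphi : {measure set (measurableTypeR R) -> \bar R}).
suff /(_ A mA) -> : forall A, measurable A -> mu A = nu A by [].
apply: lebesgue_measure_unique => X [[u v] /= _ <-].
rewrite /nu /mscale/= /mscale/= /pushforward lebesgue_measure_itv/= lte_fin.
move: c0; rewrite neq_lt => /orP[] c0.
  have -> : (fun x : R => c * x + b) @^-1` `]u, v] = `[(v - b) / c, (u - b) / c[%classic.
    by apply/seteqP; split=> x /=; rewrite !in_itv/= ltr_ndivlMr// ler_ndivrMr// ltrBlDr lerBrDr mulrC andbC.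
  rewrite lebesgue_measure_itv/= lte_fin ltr_nM2r ?invr_lt0// ltrD2r.
  case: ifPn => _; last by rewrite mule0.
  rewrite ltr0_norm// -!EFinB -EFinM; congr EFin; field.
  by rewrite lt_eqF.
have -> : (fun x : R => c * x + b) @^-1` `]u, v] = `](u - b) / c, (v - b) / c]%classic.
  by apply/seteqP; split=> x /=; rewrite !in_itv/= ltr_pdivrMr// ler_pdivlMr// ltrBlDr lerBrDr mulrC.
rewrite lebesgue_measure_itv/= lte_fin ltr_pM2r ?invr_gt0// ltrD2r.
case: ifPn => _; last by rewrite mule0.
rewrite gtr0_norm// -!EFinB -EFinM; congr EFin; field.
by rewrite gt_eqF.
Qed.

Lemma ge0_integral_affine (c b : R) (D : set R) (f : R -> \bar R) : c != 0 ->
  measurable D -> measurable_fun D f -> (forall x, D x -> 0 <= f x)%E ->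
  (\int[mu]_(x in D) f x =
   `|c|%:E * \int[mu]_(x in (fun x => c * x + b)%R @^-1` D) f (c * x + b)%R)%E.
Proof.
move=> c0 mD mf f0; have c0' := normr_ge0 c.
have mphi := measurable_affine c b.
have e := @ge0_integral_pushforward _ _ _ _ R _ mphi mu D f mD mf.
rewrite -[X in (_ * X)%E]e//; last by move=> x; rewrite inE; exact: f0.
rewrite -[`|c|]/((NngNum c0')%:num) -ge0_integral_mscale//.
apply: eq_measure_integral => A mA _ /=.
by rewrite -(lebesgue_measure_affine b c0 mA).
Qed.

(** Positive and negative parts are transformed separately; integrability is not assumed, so the
    infinite values of the two integrals are checked case by case. *)
Lemma integral_affine (c b : R) (D : set R) (f : R -> R) : c != 0 ->
  measurable D -> measurable_fun D f ->
  (\int[mu]_(x in D) (f x)%:E =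
   `|c|%:E * \int[mu]_(x in (fun x => c * x + b)%R @^-1` D) (f (c * x + b))%:E)%E.
Proof.
move=> c0 mD mf.
have mf' : measurable_fun D (EFin \o f) by exact/measurable_EFinP.
rewrite integralE [in RHS]integralE.
rewrite (ge0_integral_affine b c0 mD (measurable_funepos mf'))//.
rewrite (ge0_integral_affine b c0 mD (measurable_funeneg mf'))//.
set D' := (fun x => c * x + b) @^-1` D.
pose P := (\int[mu]_(x in D') ((EFin \o f)^\+ (c * x + b)%R))%E.
pose N := (\int[mu]_(x in D') ((EFin \o f)^\- (c * x + b)%R))%E.
have -> : (fun x : R => (f (c * x + b))%:E)^\+%E = (fun x => (EFin \o f)^\+ (c * x + b)%R)%E.
  by apply/funext => x; rewrite !funeposE.
have -> : (fun x : R => (f (c * x + b))%:E)^\-%E = (fun x => (EFin \o f)^\- (c * x + b)%R)%E.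
  by apply/funext => x; rewrite !funenegE.
rewrite -/P -/N.
case: P N => [x||] [y||] /=.
all: rewrite ?gt0_muley ?gt0_muleNy ?lte_fin ?normr_gt0//=.
by rewrite -EFinM -EFinB -!EFinM mulrBr.
Qed.

Lemma Rintegral_affine (c b : R) (D : set R) (f : R -> R) : c != 0 ->
  measurable D -> measurable_fun D f ->
  \int[mu]_(x in D) f x =
   `|c| * \int[mu]_(x in (fun x => c * x + b) @^-1` D) f (c * x + b).
Proof.
move=> c0 mD mf; rewrite /Rintegral (integral_affine b c0 mD mf).
case: (integral _ _ _) => [x||] //=.
- by rewrite gt0_muley ?lte_fin ?normr_gt0//= mulr0.
- by rewrite gt0_muleNy ?lte_fin ?normr_gt0//= mulr0.
Qed.

Lemma integrable_affine (c b : R) (D : set R) (f : R -> R) : c != 0 ->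
  measurable D -> measurable_fun D f ->
  mu.-integrable ((fun x => c * x + b) @^-1` D) (fun x => (f (c * x + b))%:E) ->
  mu.-integrable D (EFin \o f).
Proof.
move=> c0 mD mf /integrableP[_ fin]; apply/integrableP; split.
  exact/measurable_EFinP.
rewrite (ge0_integral_affine b c0 mD)//.
  by apply: lte_mul_pinfty => //; rewrite lee_fin normr_ge0.
by apply: measurableT_comp => //; exact/measurable_EFinP.
Qed.
End affine.

(** * Fubini's theorem for real-valued integrals over rectangles *)

Section Rfubini.
Local Open Scope ereal_scope.
Context d1 d2 (T1 : measurableType d1) (T2 : measurableType d2) (R : realType).
Variable m1 : {sigma_finite_measure set T1 -> \bar R}.
Variable m2 : {sigma_finite_measure set T2 -> \bar R}.
Variables (D1 : set T1) (D2 : set T2) (f : T1 * T2 -> R) (g : T2 -> R).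
Hypotheses (mD1 : measurable D1) (mD2 : measurable D2).
Hypothesis mf : measurable_fun setT f.
Hypothesis f1 : forall x, D1 x -> m2.-integrable D2 (fun y => (f (x, y))%:E).
Hypothesis f2 : forall y, D2 y -> m1.-integrable D1 (fun x => (f (x, y))%:E).
Hypothesis ig : m2.-integrable D2 (EFin \o g).
Hypothesis fg : forall y, D2 y -> (\int[m1]_(x in D1) `|f (x, y)| <= g y)%R.

(** Extension by zero reduces the statements over [D1] and [D2] to Fubini's theorem on the whole
    product space. *)
Let F := (EFin \o f) \_ (D1 `*` D2).

Let F1 x : D1 x -> (fun y => F (x, y)) = ((fun y => (f (x, y))%:E) \_ D2).
Proof.
move=> Dx; apply/funext => y; rewrite /F !patchE.
congr (if _ then _ else _); apply/idP/idP; rewrite !inE/=; first by case.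
by move=> ?; split.
Qed.

Let F1' x : ~ D1 x -> (fun y => F (x, y)) = cst 0.
Proof.
move=> Dx; apply/funext => y; rewrite /F !patchE.
by rewrite memNset//= => -[].
Qed.

Let F2 y : D2 y -> (fun x => F (x, y)) = ((fun x => (f (x, y))%:E) \_ D1).
Proof.
move=> Dx; apply/funext => x; rewrite /F !patchE.
congr (if _ then _ else _); apply/idP/idP; rewrite !inE/=; first by case.
by move=> ?; split.
Qed.

Let F2' y : ~ D2 y -> (fun x => F (x, y)) = cst 0.
Proof.
move=> Dx; apply/funext => x; rewrite /F !patchE.
by rewrite memNset//= => -[].
Qed.

Let mF : measurable_fun setT F.
Proof.
apply/(measurable_restrictT _ _).1; first exact: measurableX.
by apply/measurable_EFinP; apply: measurable_funTS.
Qed.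

Let int1 x : \int[m2]_y F (x, y) =
  ((EFin \o (fun x => \int[m2]_(y in D2) f (x, y))%R) \_ D1) x.
Proof.
rewrite patchE; case: ifPn; rewrite ?inE ?notin_setE => Dx.
  by rewrite F1// -integral_mkcond /= /Rintegral fineK// integrable_fin_num//; exact: f1.
by rewrite F1'// integral0.
Qed.

Let int2 y : \int[m1]_x F (x, y) =
  ((EFin \o (fun y => \int[m1]_(x in D1) f (x, y))%R) \_ D2) y.
Proof.
rewrite patchE; case: ifPn; rewrite ?inE ?notin_setE => Dx.
  by rewrite F2// -integral_mkcond /= /Rintegral fineK// integrable_fin_num//; exact: f2.
by rewrite F2'// integral0.
Qed.

(** By Tonelli it is enough that one iterated integral of the absolute value is finite; integrating
    over the first variable first, [g] dominates the result. *)
Let iF : (m1 \x m2).-integrable setT F.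
Proof.
apply/integrable21ltyP => //.
move: (ig) => /integrableP[mg]; apply: le_lt_trans.
rewrite [leRHS]integral_mkcond; apply: ge0_le_integral => //.
- by move=> y _; exact: integral_ge0.
- apply: (measurable_fun_fubini_tonelli_G (abse \o F)) => //=.
  exact: measurableT_comp.
- apply/(measurable_restrictT _ _).1 => //.
  exact: measurableT_comp.
move=> y _; rewrite patchE; case: ifPn; rewrite ?inE ?notin_setE => Dy.
  have -> : \int[m1]_x `|F (x, y)| = \int[m1]_(x in D1) `|(f (x, y))%:E|.
    rewrite -[fun x => _]/(abse \o (fun x => F (x, y))) F2//=.
    rewrite [RHS]integral_mkcond; apply: eq_integral => x _.
    by rewrite !patchE; case: ifP; rewrite ?abse0.
  apply: (@le_trans _ _ (g y)%:E); last by rewrite /= lee_fin ler_norm.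
  have := fg Dy; rewrite -lee_fin /Rintegral fineK//.
  by rewrite integrable_fin_num//; exact/(integrable_norm (f2 Dy)).
rewrite -[fun x => _]/(abse \o (fun x => F (x, y))) F2'//=.
by rewrite integral0_eq// => x _; rewrite abse0.
Qed.

Lemma Rfubini : (\int[m1]_(x in D1) \int[m2]_(y in D2) f (x, y) =
  \int[m2]_(y in D2) \int[m1]_(x in D1) f (x, y))%R.
Proof.
have := Fubini iF.
under eq_integral do rewrite int1.
rewrite -integral_mkcond.
under [in RHS]eq_integral do rewrite int2.
by rewrite -integral_mkcond /Rintegral => ->.
Qed.

Lemma Rfubini_prod : (\int[m1 \x m2]_(z in D1 `*` D2) f z =
  \int[m1]_(x in D1) \int[m2]_(y in D2) f (x, y))%R.
Proof.
have := integral12_prod_meas1 iF; rewrite /fubini_F.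
under eq_integral do rewrite int1.
by rewrite -!integral_mkcond /Rintegral => ->.
Qed.

Lemma Rfubini_integrable_prod : (m1 \x m2).-integrable (D1 `*` D2) (EFin \o f).
Proof. by apply/(integrable_mkcond _ _).2 => //; exact: measurableX. Qed.

Lemma Rfubini_integrable :
  m1.-integrable D1 (fun x => (\int[m2]_(y in D2) f (x, y))%:E)%R.
Proof.
apply/(integrable_mkcond _ mD1).2.
have := integrable_fubini_F iF; rewrite /fubini_F; congr (integrable _ _ _).
by apply/funext => x; rewrite int1.
Qed.

End Rfubini.

(** * Derivatives, continuity and improper integrals on the open half-line *)

Section calculus.
Context {R : realType}.
Notation mu := (@lebesgue_measure R).
Local Notation Rpos := (`](0 : R), +oo[%classic).
Implicit Types (F f g : R -> R) (a b c x v M : R).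

Lemma derivable_is_derive F x v : is_derive x 1 F v -> derivable F x 1 /\ derive1 F x = v.
Proof. by move=> [dF Fv]; split=> //; rewrite derive1E. Qed.

Lemma is_derive_continuous F x v : is_derive x 1 F v -> {for x, continuous F}.
Proof. by move=> [dF _]; apply/differentiable_continuous/derivable1_diffP. Qed.

Lemma is_derive_mul f g x a b : is_derive x 1 f a -> is_derive x 1 g b ->
  is_derive x 1 (fun y => f y * g y) (a * g x + f x * b).
Proof.
move=> df dg; have := is_deriveM df dg.
by move/is_derive_eq; apply; rewrite /GRing.scale/=; ring.
Qed.

Lemma is_derive_add f g x a b : is_derive x 1 f a -> is_derive x 1 g b ->
  is_derive x 1 (fun y => f y + g y) (a + b).
Proof. by move=> df dg; exact: is_deriveD. Qed.

Lemma is_derive_sub f g x a b : is_derive x 1 f a -> is_derive x 1 g b ->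
  is_derive x 1 (fun y => f y - g y) (a - b).
Proof. by move=> df dg; exact: is_deriveB. Qed.

Lemma is_derive_comp f g x a b : is_derive (g x) 1 f a -> is_derive x 1 g b ->
  is_derive x 1 (fun y => f (g y)) (a * b).
Proof. exact: is_derive1_comp. Qed.

Lemma is_derive_const a x : is_derive x 1 (fun=> a) 0.
Proof. exact: is_derive_cst. Qed.

Lemma is_derive_id1 x : is_derive x 1 (fun y : R => y) 1.
Proof. exact: is_derive_id. Qed.

Lemma is_derive_opp x : is_derive x 1 (fun y : R => - y) (- 1).
Proof. exact: (is_deriveN (is_derive_id1 x)). Qed.

Lemma is_derive_scale c f x a : is_derive x 1 f a ->
  is_derive x 1 (fun y => c * f y) (c * a).
Proof.
move=> df; have := is_derive_mul (is_derive_const c x) df.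
by move/is_derive_eq; apply; rewrite mul0r add0r.
Qed.

Lemma is_derive_inv f x a : f x != 0 -> is_derive x 1 f a ->
  is_derive x 1 (fun y => (f y)^-1) (- (f x) ^- 2 * a).
Proof. by move=> f0 df; exact: is_deriveV. Qed.

Lemma continuous_for_comp f g x : {for x, continuous g} ->
  {for g x, continuous f} -> {for x, continuous (fun y => f (g y))}.
Proof. by move=> cg cf; exact: (continuous_comp cg cf). Qed.

Lemma continuous_for_compl g f x : continuous g -> {for x, continuous f} ->
  {for x, continuous (fun y => g (f y))}.
Proof. by move=> cg cf; apply: (continuous_for_comp cf); exact: cg. Qed.

Lemma continuous_for_mul f g x : {for x, continuous f} ->
  {for x, continuous g} -> {for x, continuous (fun y => f y * g y)}.
Proof. by move=> cf cg; exact: (cvgM cf cg). Qed.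

Lemma continuous_for_add f g x : {for x, continuous f} ->
  {for x, continuous g} -> {for x, continuous (fun y => f y + g y)}.
Proof. by move=> cf cg; exact: (cvgD cf cg). Qed.

Lemma continuous_for_sub f g x : {for x, continuous f} ->
  {for x, continuous g} -> {for x, continuous (fun y => f y - g y)}.
Proof. by move=> cf cg; exact: (cvgB cf cg). Qed.

Lemma continuous_for_opp f x : {for x, continuous f} ->
  {for x, continuous (fun y => - f y)}.
Proof. by move=> cf; exact: (cvgN cf). Qed.

Lemma continuous_for_expR f x : {for x, continuous f} ->
  {for x, continuous (fun y => expR (f y))}.
Proof. by move=> cf; apply: continuous_for_comp cf _; exact: continuous_expR. Qed.

Lemma continuous_for_cos f x : {for x, continuous f} ->
  {for x, continuous (fun y => cos (f y))}.
Proof. by move=> cf; apply: continuous_for_comp cf _; exact: continuous_cos. Qed.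

Lemma continuous_for_sin f x : {for x, continuous f} ->
  {for x, continuous (fun y => sin (f y))}.
Proof. by move=> cf; apply: continuous_for_comp cf _; exact: continuous_sin. Qed.

Lemma continuous_for_exprn f n x : {for x, continuous f} ->
  {for x, continuous (fun y => f y ^+ n)}.
Proof.
move=> cf; elim: n => [|n IH]; first exact: cvg_cst.
have -> : (fun y => f y ^+ n.+1) = (fun y => f y * f y ^+ n).
  by apply/funext => y; rewrite exprS.
exact: continuous_for_mul.
Qed.

Lemma continuous_for_cst c x : {for x, continuous (fun=> c : R)}.
Proof. exact: cvg_cst. Qed.

Lemma continuous_for_id x : {for x, continuous (fun y : R => y)}.
Proof. exact: cvg_id. Qed.

Lemma continuous_for_inv f x : f x != 0 -> {for x, continuous f} ->
  {for x, continuous (fun y => (f y)^-1)}.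
Proof. by move=> f0 cf; exact: (cvgV f0 cf). Qed.

Lemma continuous_integrable f a b :
  (forall x, a <= x <= b -> {for x, continuous f}) -> mu.-integrable `[a, b] (EFin \o f).
Proof.
move=> cf; apply: continuous_compact_integrable; first exact: segment_compact.
apply: continuous_in_subspaceT => x; rewrite inE/= in_itv/=; exact: cf.
Qed.

Lemma FTC2_cc F f a b : a <= b ->
  (forall x, a <= x <= b -> is_derive x 1 F (f x)) ->
  (forall x, a <= x <= b -> {for x, continuous f}) ->
  (\int[mu]_(x in `[a, b]) (f x)%:E = (F b - F a)%:E)%E.
Proof.
rewrite le_eqVlt => /predU1P[->|ab] dF cf.
  by rewrite set_itv1 integral_set1 subrr.
have dxF x : a <= x <= b -> {for x, continuous F}.
  by move=> xab; apply: is_derive_continuous; exact: dF.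
rewrite (@continuous_FTC2 _ f F)//.
- by apply: continuous_in_subspaceT => x; rewrite inE/= in_itv/=; exact: cf.
- split.
  + move=> x; rewrite in_itv/= => /andP[ax xb].
    by case: (dF x _) => //; rewrite !ltW.
  + by apply: cvg_at_right_filter; apply: dxF; rewrite lexx ltW.
  + by apply: cvg_at_left_filter; apply: dxF; rewrite lexx ltW.
- move=> x; rewrite in_itv/= => /andP[ax xb].
  by case: (derivable_is_derive (dF x _)) => //; rewrite !ltW.
Qed.

(** Exhaustion of the open half-line by compact intervals, on which the fundamental theorem of
    calculus applies; the shift [n.+2] makes all of them nondegenerate. *)
Let D_ n : set R := `[n.+2%:R^-1, n.+2%:R].

Let D_bigcup : \bigcup_n D_ n = Rpos.
Proof.
apply/seteqP; split=> [x [n _]|x] /=; rewrite /D_/= !in_itv/= ?andbT.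
  by move=> /andP[+ _]; apply: lt_le_trans; rewrite invr_gt0.
move=> x0.
have [N hN] : exists N : nat, x^-1 <= N%:R /\ x <= N%:R.
  have h1 := archi_boundP (ltW x0); have h2 : x^-1 < (Num.bound x^-1)%:R.
    by apply: archi_boundP; rewrite invr_ge0 ltW.
  exists (maxn (Num.bound x) (Num.bound x^-1)); split; apply: ltW.
    by rewrite (lt_le_trans h2)// ler_nat leq_maxr.
  by rewrite (lt_le_trans h1)// ler_nat leq_maxl.
exists N => //=; rewrite in_itv/=; apply/andP; split.
  rewrite -[x]invrK lef_pV2 ?posrE ?invr_gt0//.
  by rewrite (le_trans hN.1)// ler_nat ltnW.
by rewrite (le_trans hN.2)// ler_nat ltnW.
Qed.

Let D_nd : nondecreasing_seq D_.
Proof.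
move=> m n mn; apply/subsetPset => x; rewrite /D_/= !in_itv/= => /andP[h1 h2].
rewrite (le_trans h2) ?ler_nat ?ltnS// andbT (le_trans _ h1)//.
by rewrite lef_pV2 ?posrE// ler_nat !ltnS.
Qed.

Let D_gt0 n x : n.+2%:R^-1 <= x <= n.+2%:R -> 0 < x.
Proof. by move=> /andP[+ _]; apply: lt_le_trans; rewrite invr_gt0. Qed.

Let D_int F f n :
  (forall x, 0 < x -> is_derive x 1 F (f x)) ->
  (forall x, 0 < x -> {for x, continuous f}) ->
  (\int[mu]_(x in D_ n) (f x)%:E = (F n.+2%:R - F n.+2%:R^-1)%:E)%E.
Proof.
move=> dF cf; apply: FTC2_cc.
- rewrite (@le_trans _ _ 1)// ?invf_le1 ?ler1n//.
- by move=> x /D_gt0; exact: dF.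
- by move=> x /D_gt0; exact: cf.
Qed.

Lemma continuous_measurable_gt0 f :
  (forall x, 0 < x -> {for x, continuous f}) -> measurable_fun Rpos f.
Proof.
move=> cf; apply: open_continuous_measurable_fun => //.
by move=> x; rewrite inE/= in_itv/= andbT; exact: cf.
Qed.

(** Monotone convergence along the exhaustion [D_]: on each interval the integral is an increment of
    [F], hence at most [M]. *)
Lemma ge0_integrable_gt0 F f M :
  (forall x, 0 < x -> is_derive x 1 F (f x)) ->
  (forall x, 0 < x -> {for x, continuous f}) ->
  (forall x, 0 < x -> 0 <= f x) ->
  (forall x y, 0 < x -> x <= y -> F y - F x <= M) ->
  mu.-integrable Rpos (EFin \o f).
Proof.
move=> dF cf f0 FM; apply/integrableP; split.
  by apply/measurable_EFinP; exact: continuous_measurable_gt0.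
have mDf n : measurable_fun (D_ n) f.
  apply: measurable_funS (continuous_measurable_gt0 cf) => //.
  by move=> x /= /D_gt0; rewrite in_itv/= andbT.
apply: (@le_lt_trans _ _ M%:E); last by rewrite ltry.
rewrite -D_bigcup.
under eq_integral => x.
  rewrite inE D_bigcup/= in_itv/= andbT => x0.
  rewrite ger0_norm ?f0//.
  over.
have : (\int[mu]_(x in D_ i) (EFin \o f) x @[i --> \oo] --> \int[mu]_(x in \bigcup_i D_ i) (EFin \o f) x)%E.
  apply: ge0_nondecreasing_set_cvg_integral => //.
  - by move=> i; exact: measurable_itv.
  - by move=> i; apply/measurable_EFinP; exact: mDf.
  - by move=> i x /D_gt0 x0; rewrite lee_fin f0.
move=> /cvg_lim <-//; apply: lime_le.
  apply: ereal_nondecreasing_is_cvgn.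
  apply: ge0_nondecreasing_set_nondecreasing_integral => //.
  - by move=> i; exact: measurable_itv.
  - by move=> i; apply/measurable_EFinP; exact: mDf.
  - by move=> i x /D_gt0 x0; rewrite lee_fin f0.
near=> n; rewrite (@D_int F)// lee_fin FM ?invr_gt0//.
by rewrite (@le_trans _ _ 1)// ?invf_le1 ?ler1n.
Unshelve. all: end_near. Qed.

(** Dominated convergence along [D_] makes the integral the limit of F(n+2) - F(1/(n+2)). This is
    the vanishing of boundary terms in the integrations by parts below. *)
Lemma integral_gt0_eq0 F f :
  (forall x, 0 < x -> is_derive x 1 F (f x)) ->
  (forall x, 0 < x -> {for x, continuous f}) ->
  mu.-integrable Rpos (EFin \o f) ->
  F x @[x --> 0^'+] --> 0 -> F x @[x --> +oo] --> 0 ->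
  \int[mu]_(x in Rpos) f x = 0.
Proof.
move=> dF cf fi F0 Fy.
have mf := continuous_measurable_gt0 cf.
have mDf n : measurable_fun (D_ n) f.
  by apply: measurable_funS mf => // x /= /D_gt0; rewrite in_itv/= andbT.
have DR n : D_ n `&` Rpos = D_ n.
  by apply/setIidPl => x /D_gt0 /=; rewrite in_itv/= andbT.
have -> : \int[mu]_(x in Rpos) f x = fine (limn (fun n => \int[mu]_(x in D_ n) (f x)%:E))%E.
  congr fine; apply/esym/cvg_lim => //.
  have := @dominated_cvg _ _ _ mu Rpos (measurable_itv _)
    (fun n => (EFin \o f) \_ (D_ n)) (EFin \o f) (abse \o (EFin \o f)).
  under [in X in _ -> X]eq_fun => n do rewrite -DR setIC integral_mkcondr.
  apply.
  - move=> n; apply/measurable_restrict => //.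
      exact: measurable_itv.
    by rewrite setIC DR; apply/measurable_EFinP; exact: mDf.
  - move=> x Rx; apply: cvg_near_cst.
    move: (Rx); rewrite -D_bigcup => -[N _ DN]; exists N => //= n /= Nn.
    rewrite patchE mem_set//.
    by have /subsetPset := D_nd Nn; exact.
  - by [].
  - exact: integrable_abse.
  - move=> n x Rx; rewrite patchE; case: ifPn => //= _.
    by rewrite ?normr0 ?abse0 lee_fin.
under eq_fun do rewrite (@D_int F)//.
have -> : limn (fun n : nat => (F n.+2%:R - F n.+2%:R^-1)%:E) = 0%E; last by [].
apply/cvg_lim => //; apply: cvg_EFin; first by near=> n.
have -> : nbhs (0 : R) = nbhs ((0 : R) - 0) by rewrite subrr.
apply: (@cvgB _ _ _ _ _ (fun n => F n.+2%:R) (fun n => F n.+2%:R^-1)).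
  apply: (@cvg_comp _ _ _ (fun n => n.+2%:R : R) F _ +oo%R) => //.
  have -> : (fun n => n.+2%:R : R) = (fun n => (n + 2)%:R) by apply/funext => n; rewrite addn2.
  by rewrite (cvg_shiftn 2 (fun n => n%:R : R)); exact: cvgr_idn.
move: F0 => /cvg_at_rightP; apply; split; first by move=> n; rewrite invr_gt0.
have -> : (fun n => n.+2%:R^-1 : R) = (fun n => harmonic (n + 1)%N) by apply/funext => n; rewrite addn1.
by rewrite (cvg_shiftn 1 (@harmonic R)); exact: cvg_harmonic.
Unshelve. all: end_near. Qed.

End calculus.

(** Brings the various spellings of continuity at a point to the form [continuous_at], on which
    [cont] can match. *)
Ltac cont_norm :=
  try match goal with
  | |- prop_for ?x (inPhantom (continuous ?f)) => change (continuous_at x f)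
  | |- continuous _ => intro
  end; cbv beta.

(** Proves continuity of real functions by following the syntax of the body and using [continuous]
    hypotheses of the context at the leaves; leaves that it cannot treat, and nonvanishing of
    inverted terms, are returned as goals. *)
Ltac cont :=
  cont_norm;
  lazymatch goal with
  | |- continuous_at ?x (fun y => y) => exact: continuous_for_id
  | |- continuous_at ?x id => exact: continuous_for_id
  | |- continuous_at ?x (fun _ => ?c) => exact: continuous_for_cst
  | |- continuous_at ?x (fun y => @GRing.mul _ (@?f y) (@?g y)) =>
      refine (@continuous_for_mul _ f g x _ _); cont
  | |- continuous_at ?x (fun y => @GRing.add _ (@?f y) (- @?g y)) =>
      refine (@continuous_for_sub _ f g x _ _); cont
  | |- continuous_at ?x (fun y => @GRing.add _ (@?f y) (@?g y)) =>
      refine (@continuous_for_add _ f g x _ _); cont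
  | |- continuous_at ?x (fun y => - @?f y) =>
      refine (@continuous_for_opp _ f x _); cont
  | |- continuous_at ?x (fun y => expR (@?f y)) =>
      refine (@continuous_for_expR _ f x _); cont
  | |- continuous_at ?x (fun y => cos (@?f y)) =>
      refine (@continuous_for_cos _ f x _); cont
  | |- continuous_at ?x (fun y => sin (@?f y)) =>
      refine (@continuous_for_sin _ f x _); cont
  | |- continuous_at ?x (fun y => @?f y ^+ ?n) =>
      refine (@continuous_for_exprn _ f n x _); cont
  | |- continuous_at ?x (fun y => (@?f y)^-1) =>
      refine (@continuous_for_inv _ f x _ _); [|cont]
  | cg : continuous ?g |- continuous_at ?x ?g => exact: cg
  | cg : continuous ?g |- continuous_at ?x (fun y => ?g (@?f y)) =>
      refine (@continuous_for_compl _ g f x cg _); cont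
  | |- _ => idtac
  end.

(** * Integrability of the Gamma integrand *)

Section gamma.
Context {R : realType}.
Notation mu := (@lebesgue_measure R).
Local Notation Rpos := (`](0 : R), +oo[%classic).
Implicit Types (F f g : R -> R) (a b c m x v M : R).

Lemma continuous_powR a x : 0 < x -> {for x, continuous (fun y => y `^ a)}.
Proof. by move=> x0; apply: is_derive_continuous; exact: is_derive1_powR. Qed.

Lemma dominated_integrable (D : set R) f g : measurable D ->
  measurable_fun D f -> mu.-integrable D (EFin \o g) ->
  (forall x, D x -> `|f x| <= g x) -> mu.-integrable D (EFin \o f).
Proof.
move=> mD mf ig fg; apply: le_integrable ig => //.
  exact/measurable_EFinP.
by move=> x Dx /=; rewrite lee_fin (le_trans (fg x Dx))// ler_norm.
Qed.

Lemma Rintegral_gt0 (D : set R) f (u v c : R) : measurable D ->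
  mu.-integrable D (EFin \o f) -> (forall x, D x -> 0 <= f x) ->
  u < v -> `[u, v] `<=` D -> 0 < c -> (forall x, u <= x <= v -> c <= f x) ->
  0 < \int[mu]_(x in D) f x.
Proof.
move=> mD fi f0 uv sD c0 cf.
have fin : (\int[mu]_(x in D) (f x)%:E)%E \is a fin_num by exact: integrable_fin_num.
rewrite -lte_fin /Rintegral fineK//.
apply: (@lt_le_trans _ _ (c * (v - u))%:E).
  by rewrite lte_fin mulr_gt0// subr_gt0.
have mf : measurable_fun D (EFin \o f) by case/integrableP : fi.
apply: (@le_trans _ _ (\int[mu]_(x in `[u, v]) (f x)%:E)%E); last first.
  by apply: ge0_subset_integral.
have <- : (\int[mu]_(x in `[u, v]) (cst c%:E x) = (c * (v - u))%:E)%E.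
  by rewrite integral_cst//= lebesgue_measure_itv/= lte_fin uv -EFinB -EFinM.
apply: ge0_le_integral => //.
- by move=> x _; rewrite lee_fin ltW.
exact: measurable_funS mf.
Qed.

Lemma integrable_itv_cc f a b : measurable_fun `[a, b] f ->
  mu.-integrable `]a, b[ (EFin \o f) -> mu.-integrable `[a, b] (EFin \o f).
Proof.
move=> mf /integrableP[mf' h]; apply/integrableP; split; first exact/measurable_EFinP.
rewrite integral_itv_bndoo//.
by apply: measurableT_comp => //; apply: measurable_funS mf' => //.
Qed.

(** Cube of 1 + x <= 3 exp(x/3), which follows from exp(y) >= 1 + y. *)
Lemma cube_le_expR x : 0 <= x -> (1 + x) ^+ 3 <= 27%:R * expR x.
Proof.
move=> x0.
have -> : expR x = expR (x / 3%:R) ^+ 3.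
  by rewrite -expRM_natl; congr expR; field.
have h : 1 + x <= 3%:R * expR (x / 3%:R).
  have := expR_ge1Dx (x / 3%:R); lra.
apply: (@le_trans _ _ ((3%:R * expR (x / 3%:R)) ^+ 3)).
  by rewrite lerXn2r// nnegrE ?mulr_ge0 ?expR_ge0//; lra.
by rewrite exprMn ler_wpM2r ?exprn_ge0 ?expR_ge0//; lra.
Qed.

(** The integrand is the derivative of (r/(1+r))^m / m, which stays between 0 and 1/m. It serves as
    an algebraic majorant with the singularity r^(m-1) at 0. *)
Lemma integrable_powR_div m : 0 < m ->
  mu.-integrable Rpos (EFin \o (fun r : R => (r / (1 + r)) `^ (m - 1) * (1 + r) ^- 2)).
Proof.
move=> m0.
have r1 (r : R) : 0 < r -> 1 + r != 0 by move=> r0; rewrite gt_eqF// ltr_wpDl.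
have q0 (r : R) : 0 < r -> 0 < r / (1 + r) by move=> r0; rewrite divr_gt0// addr_gt0.
have d1 (r : R) : is_derive r 1 (fun r => 1 + r) 1.
  have := is_derive_add (is_derive_const 1 r) (is_derive_id1 r).
  by rewrite add0r.
have dq (r : R) : 0 < r -> is_derive r 1 (fun r => r / (1 + r)) ((1 + r) ^- 2).
  move=> r0; apply: is_derive_eq.
    by apply: (is_derive_mul (is_derive_id1 _)); apply: is_derive_inv (d1 r); exact: r1.
  by rewrite /=; field; exact: r1.
apply: (@ge0_integrable_gt0 _ (fun r => m^-1 * (r / (1 + r)) `^ m) _ m^-1).
- move=> r r0; apply: is_derive_eq.
    apply: is_derive_scale; apply: (@is_derive_comp _ (fun y => y `^ m)); last exact: dq.
    by apply: is_derive1_powR; exact: q0.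
  by rewrite /=; field; rewrite r1// gt_eqF.
- move=> r r0; apply: continuous_for_mul.
    apply: (@continuous_for_comp _ (fun y => y `^ (m - 1)) (fun r => r / (1 + r))).
      by apply: is_derive_continuous; exact: dq.
    by apply: continuous_powR; exact: q0.
  apply: continuous_for_inv; first by rewrite expf_eq0/= r1.
  by apply: continuous_for_mul; apply: is_derive_continuous; exact: d1.
- by move=> r r0; rewrite mulr_ge0 ?powR_ge0// invr_ge0 exprn_ge0// addr_ge0// ltW.
- move=> x y x0 xy; rewrite lerBlDr -[leLHS]mulr1 -mulrA.
  rewrite (@le_trans _ _ (m^-1 * 1))//.
    rewrite mulr1 ler_pM2l ?invr_gt0//.
    apply: (@le_trans _ _ (1 `^ m)); last by rewrite powR1.
    apply: (ge0_ler_powR (ltW m0)); rewrite ?nnegrE//.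
      by rewrite ltW// q0// (lt_le_trans x0).
    by rewrite ler_pdivrMr ?mul1r ?lerDr// addr_gt0// (lt_le_trans x0).
  by rewrite mulr1 lerDl mulr_ge0 ?powR_ge0// invr_ge0 ltW.
Qed.

(** Comparison with the previous integrand: what has to be dominated is (1+r)^(m+1) <= (1+r)^3 <= 27
    exp(r), and the first inequality is where m <= 2 enters. *)
Lemma integrable_gamma m : 0 < m <= 2 ->
  mu.-integrable Rpos (EFin \o (fun r : R => r `^ (m - 1) * expR (- r))).
Proof.
move=> /andP[m0 m2].
have ig : mu.-integrable Rpos
    (EFin \o (fun r : R => 27%:R * ((r / (1 + r)) `^ (m - 1) * (1 + r) ^- 2))).
  by have := @integrableZl _ _ R mu Rpos (measurable_itv _) 27%:R _ (integrable_powR_div m0).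
apply: dominated_integrable ig _ => //.
  apply: continuous_measurable_gt0 => x x0; apply: continuous_for_mul.
    exact: continuous_powR.
  by apply: continuous_for_expR; apply: continuous_for_opp; exact: continuous_for_id.
move=> r; rewrite /= in_itv/= andbT => r0.
have r1 : 0 < 1 + r by rewrite addr_gt0.
rewrite ger0_norm ?mulr_ge0 ?powR_ge0 ?expR_ge0// expRN.
rewrite ler_pdivrMr ?expR_gt0//.
have -> : r `^ (m - 1) = (r / (1 + r)) `^ (m - 1) * (1 + r) `^ (m - 1).
  by rewrite -powRM ?divr_ge0 ?ltW// divfK// gt_eqF.
rewrite -!mulrA (mulrCA 27%:R) ler_wpM2l ?powR_ge0// mulrA.
rewrite [leRHS]mulrAC ler_pdivlMr ?exprn_gt0//.
apply: le_trans (cube_le_expR (ltW r0)).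
rewrite -!powR_mulrn ?(ltW r1)// -powRD; last by rewrite (gt_eqF r1) implybT.
by apply: ler_powR; lra.
Qed.

End gamma.

(** * The Riemann-Liouville integral as an operator on continuous functions *)

Section kernel_integrals.
Context {R : realType}.
Notation mu := (@lebesgue_measure R).
Local Notation Rpos := (`](0 : R), +oo[%classic).
Local Notation I01 := (`[(0 : R), (1 : R)]%classic).
Implicit Types (F f g h : R -> R) (a b c m x v M t s : R).

Lemma measurable_powR_comp d (T : measurableType d) (D : set T) (g : T -> R) (p : R) :
  measurable_fun D g -> measurable_fun D (fun y => g y `^ p).
Proof. by move=> mg; exact: (measurableT_comp (@measurable_powR R p) mg). Qed.

Lemma integrable_powR01 a : 0 < a <= 1 ->
  mu.-integrable I01 (EFin \o (fun s => s `^ (a - 1))).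
Proof.
move=> /andP[a0 a1].
have mf (D : set R) : measurable_fun D (fun s : R => s `^ (a - 1)).
  exact: measurable_powR_comp.
apply: integrable_itv_cc => //.
have ig : mu.-integrable `](0:R), (1:R)[%classic
    (EFin \o (fun r : R => expR 1 * (r `^ (a - 1) * expR (- r)))).
  have := @integrable_gamma R a; rewrite a0 (le_trans a1) ?ler1n//= => /(_ isT) ig.
  have := @integrableZl _ _ R mu Rpos (measurable_itv _) (expR 1) _ ig.
  apply: integrableS => //.
  by apply: subset_itvl.
apply: dominated_integrable ig _ => // s; rewrite /= in_itv/= => /andP[s0 s1].
rewrite ger0_norm ?powR_ge0// mulrCA -expRD ler_peMr ?powR_ge0//.
by rewrite -[leLHS]expR0 ler_expR subr_ge0 ltW.
Qed.

Lemma preimage_onem_I01 : (fun x => -1 * x + 1) @^-1` I01 = I01.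
Proof. by apply/seteqP; split=> x /=; rewrite !in_itv/= => /andP[h1 h2]; apply/andP; split; lra. Qed.

Lemma integrable_kernel a : 0 < a <= 1 ->
  mu.-integrable I01 (EFin \o (fun s => (1 - s) `^ (a - 1))).
Proof.
move=> a01.
apply: (@integrable_affine _ (-1) 1) => //.
by apply: measurable_powR_comp; apply: measurable_funB.
rewrite preimage_onem_I01; apply: eq_integrable (integrable_powR01 a01) => //.
by move=> x _ /=; congr (_ `^ _)%:E; ring.
Qed.

Lemma powR_half a x : 0 < a <= 1 -> 1/2 <= x -> x `^ (a - 1) <= 2.
Proof.
move=> /andP[a0 a1] x2.
have -> : a - 1 = - (1 - a) by ring.
rewrite powRN -[leRHS]invrK lef_pV2 ?posrE ?invr_gt0 ?powR_gt0//; last lra.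
apply: (@le_trans _ _ ((1/2) `^ (1 - a))); last first.
  by apply: ge0_ler_powR => //; rewrite ?nnegrE; lra.
apply: (@le_trans _ _ (2^-1 `^ 1)); first by rewrite powRr1// invr_ge0.
rewrite div1r; apply: ger_powR; last lra.
by rewrite invr_gt0 ltr0n invf_le1// ler1n.
Qed.

Lemma measurable_beta a b (D : set R) :
  measurable_fun D (fun s => (1 - s) `^ (a - 1) * s `^ (b - 1)).
Proof.
apply: measurable_funM; apply: measurable_powR_comp => //.
exact: measurable_funB.
Qed.

(** On each half of [0, 1] one of the two factors is at most 2, so the product is at most twice the
    sum of the factors. *)
Lemma integrable_beta a b : 0 < a <= 1 -> 0 < b <= 1 ->
  mu.-integrable I01 (EFin \o (fun s => (1 - s) `^ (a - 1) * s `^ (b - 1))).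
Proof.
move=> a01 b01.
have ig : mu.-integrable I01
    (EFin \o (fun s => 2 * ((1 - s) `^ (a - 1) + s `^ (b - 1)))).
  have := @integrableD _ _ R mu I01 (measurable_itv _) _ _
    (integrable_kernel a01) (integrable_powR01 b01).
  by move=> /(@integrableZl _ _ R mu I01 (measurable_itv _) 2).
apply: dominated_integrable ig _ => //; first exact: measurable_beta.
move=> s; rewrite /= in_itv/= => /andP[s0 s1].
rewrite ger0_norm ?mulr_ge0 ?powR_ge0// mulrDr.
have [s2|s2] := leP (1/2) s.
  rewrite mulrC ler_wpDr ?mulr_ge0 ?powR_ge0//.
  by rewrite ler_wpM2r ?powR_ge0// powR_half.
rewrite ler_wpDl ?mulr_ge0 ?powR_ge0//.
by rewrite ler_wpM2r ?powR_ge0// powR_half//; lra.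
Qed.

Lemma Gamma_gt0 a : 0 < a <= 2 -> 0 < Gamma a.
Proof.
move=> /andP[a0 a2].
apply: (@Rintegral_gt0 _ _ _ 1 2 (2^-1 * expR (- 2))) => //.
- by apply: integrable_gamma; rewrite a0.
- by move=> x _; rewrite mulr_ge0 ?powR_ge0 ?expR_ge0.
- by rewrite ltr1n.
- by move=> x; rewrite /= !in_itv/= andbT => /andP[+ _]; exact: lt_le_trans.
- move=> x /andP[x1 x2]; have x0 : 0 < x by exact: lt_le_trans x1.
  rewrite ler_pM ?invr_ge0 ?expR_ge0//; last by rewrite ler_expR lerN2.
  rewrite powRB; last by rewrite (gt_eqF x0) implybT.
  rewrite powRr1 ?(ltW x0)// ler_pdivlMr//.
  apply: (@le_trans _ _ 1); first by rewrite ler_pdivrMl// mulr1.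
  by rewrite -[leLHS](powRr0 x) ler_powR// ltW.
Qed.

(** The fractional integral over [0, t] after the substitution tau = t s: the domain is fixed and
    the variable t survives only inside [h]. *)
Definition Wint a h : R := \int[mu]_(s in I01) ((1 - s) `^ (a - 1) * h s).

Definition bounded01 h M := forall s, 0 <= s <= 1 -> `|h s| <= M.

Lemma integrable_Wint a h M : 0 < a <= 1 -> measurable_fun I01 h ->
  bounded01 h M -> mu.-integrable I01 (EFin \o (fun s => (1 - s) `^ (a - 1) * h s)).
Proof.
move=> a01 mh hM.
have ig := @integrableZl _ _ R mu I01 (measurable_itv _) M _ (integrable_kernel a01).
apply: dominated_integrable ig _ => //.
  apply: measurable_funM => //; apply: measurable_powR_comp.
  exact: measurable_funB.
move=> s; rewrite /= in_itv/= => s01.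
by rewrite normrM ger0_norm ?powR_ge0// mulrC ler_wpM2r ?powR_ge0// hM.
Qed.

Lemma continuous_bounded01 h : continuous h -> exists M, bounded01 h M.
Proof.
move=> ch.
have : compact (h @` I01).
  apply: continuous_compact; last exact: segment_compact.
  exact: continuous_subspaceT.
move=> /compact_bounded[M [_ hM]]; exists (M + 1) => s s01.
by apply: (hM (M + 1)); rewrite ?ltrDl//; exists s => //=; rewrite in_itv.
Qed.

Lemma continuous_scaler g t : continuous g -> continuous (fun s => g (t * s)).
Proof.
by move=> cg; cont.
Qed.

Lemma integrable_Wint_cont a h : 0 < a <= 1 -> continuous h ->
  mu.-integrable I01 (EFin \o (fun s => (1 - s) `^ (a - 1) * h s)).
Proof.
move=> a01 ch; have [M hM] := continuous_bounded01 ch.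
apply: integrable_Wint a01 _ hM.
by apply: measurable_funTS; exact: continuous_measurable_fun.
Qed.

Lemma Wint1_gt0 a : 0 < a <= 1 -> 0 < Wint a (fun=> 1).
Proof.
move=> a01; rewrite /Wint.
apply: (@Rintegral_gt0 _ _ _ 0 (1/2) 1) => //.
- by apply: integrable_Wint_cont => // x; exact: continuous_for_cst.
- by move=> x _; rewrite mulr1 powR_ge0.
- by apply: subset_itvl; rewrite bnd_simp; lra.
- move=> x /andP[x0 x1]; rewrite mulr1 -[leLHS](powRr0 (1 - x)).
  by apply: ger_powR; lra.
Qed.

Lemma ler_Wint a h1 h2 : 0 < a <= 1 -> continuous h1 -> continuous h2 ->
  (forall s, 0 <= s <= 1 -> h1 s <= h2 s) -> Wint a h1 <= Wint a h2.
Proof.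
move=> a01 c1 c2 h12; apply: le_Rintegral => //.
- exact: integrable_Wint_cont.
- exact: integrable_Wint_cont.
- by move=> s; rewrite /= in_itv/= => s01; rewrite ler_wpM2l ?powR_ge0// h12.
Qed.

Lemma Wint_lin a h1 h2 b c : 0 < a <= 1 -> continuous h1 -> continuous h2 ->
  Wint a (fun s => b * h1 s + c * h2 s) = b * Wint a h1 + c * Wint a h2.
Proof.
move=> a01 c1 c2; rewrite /Wint.
have i1 := integrable_Wint_cont a01 c1; have i2 := integrable_Wint_cont a01 c2.
rewrite -(@RintegralZl _ _ R mu I01)// -(@RintegralZl _ _ R mu I01)//.
rewrite -(@RintegralD _ _ R mu I01)//.
- by apply: eq_Rintegral => s _; ring.
- exact: (@integrableZl _ _ R mu I01 (measurable_itv _) b _ i1).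
- exact: (@integrableZl _ _ R mu I01 (measurable_itv _) c _ i2).
Qed.

Lemma Wint_cst a c : 0 < a <= 1 -> Wint a (fun=> c) = c * Wint a (fun=> 1).
Proof.
move=> a01; have c1 : continuous ((fun=> 1) : R -> R) by exact: cst_continuous.
have := @Wint_lin a (fun=> 1) (fun=> 1) c 0 a01 c1 c1.
by rewrite mulr1 mul0r addr0 => ->; rewrite mul0r addr0.
Qed.

Lemma Wint_bound a h M : 0 < a <= 1 -> continuous h -> bounded01 h M ->
  `|Wint a h| <= M * Wint a (fun=> 1).
Proof.
move=> a01 ch hM; rewrite ler_norml -mulNr -!(Wint_cst _ a01).
apply/andP; split; apply: ler_Wint => //.
all: try by move=> x; exact: continuous_for_cst.
all: by move=> s /hM; rewrite ler_norml => /andP[].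
Qed.

(** Continuity under the integral sign, with a multiple of the kernel as majorant near [t0]. *)
Lemma continuous_Wint_scale a g : 0 < a <= 1 -> continuous g ->
  continuous (fun t => Wint a (fun s => g (t * s))).
Proof.
move=> a01 cg t0.
have [M hM] : exists M, forall x, `|x| <= `|t0| + 1 -> `|g x| <= M.
  (* The map s -> (|t0|+1)(2s-1) sends [0, 1] onto [-(|t0|+1), |t0|+1], so the bound for continuous
     functions on [0, 1] applies. *)
  have ch : continuous (fun s => g ((`|t0| + 1) * (2 * s - 1))). by cont.
  have K0 : 0 < `|t0| + 1 by rewrite ltr_wpDl.
  have [M hM] := continuous_bounded01 ch; exists M => x xK.
  have := hM ((x / (`|t0| + 1) + 1) / 2).
  have -> : (`|t0| + 1) * (2 * ((x / (`|t0| + 1) + 1) / 2) - 1) = x.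
    by field; rewrite gt_eqF.
  apply; move: xK; rewrite ler_norml => /andP[x1 x2].
  have : -1 <= x / (`|t0| + 1) by rewrite ler_pdivlMr// mulN1r.
  move=> y1; have y2 : x / (`|t0| + 1) <= 1 by rewrite ler_pdivrMr// mul1r.
  by move: (x / _) y1 y2 => y y1 y2; apply/andP; split; lra.
have := @continuity_under_integral R _ _ mu
  (fun t s => (1 - s) `^ (a - 1) * g (t * s)) I01 (measurable_itv _) (t0 - 1) (t0 + 1).
move=> /(_ _ _ (fun s => M * (1 - s) `^ (a - 1)) _ _ t0); apply.
- by move=> t _; apply: integrable_Wint_cont => //; exact: continuous_scaler.
- apply: aeW => s _ t _; cont.
- exact: (@integrableZl _ _ R mu I01 (measurable_itv _) M _ (integrable_kernel a01)).
- move=> t; rewrite /= in_itv/= => /andP[t1 t2]; apply: aeW => s.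
  rewrite /= in_itv/= => /andP[s0 s1].
  rewrite normrM ger0_norm ?powR_ge0// mulrC ler_wpM2r ?powR_ge0// hM//.
  rewrite normrM (ger0_norm s0).
  apply: (@le_trans _ _ (`|t| * 1)); first by rewrite ler_wpM2l.
  rewrite mulr1 -[t](subrK t0) addrC (le_trans (ler_normD _ _))// lerD2l.
  by rewrite ler_norml; lra.
- by rewrite inE/= in_itv/=; lra.
Qed.

(** Power of the positive part. For a nonzero exponent, negative ones included, it vanishes on t <=
    0 because of the convention for powers of 0, so it can also serve as a one-sided kernel. *)
Definition ppow a t : R := Num.max 0 t `^ a.

Lemma ppowE a t : 0 <= t -> ppow a t = t `^ a.
Proof. by move=> t0; rewrite /ppow max_r. Qed.

Lemma continuous_ppow a : 0 < a -> continuous (ppow a).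
Proof.
move=> a0 t; have [t0|t0|<-] := ltgtP 0 t.
- have h : {near t, (fun t => t `^ a) =1 ppow a}.
    by near=> u; rewrite ppowE// ltW//; near: u; exact: lt_nbhsr.
  rewrite /continuous_at ppowE ?(ltW t0)//.
  apply: cvg_trans (near_eq_cvg h) _.
  exact: continuous_powR.
- have h : {near t, cst 0 =1 ppow a}.
    near=> u; rewrite /ppow max_l ?powR0 ?gt_eqF// ltW//; near: u; exact: lt_nbhsl.
  rewrite /continuous_at (_ : ppow a t = 0); last first.
    by rewrite /ppow max_l ?powR0 ?gt_eqF// ltW.
  by apply: cvg_trans (near_eq_cvg h) _; exact: cvg_cst.
- apply/cvgrPdist_lt => e e0; rewrite ppowE// powR0 ?gt_eqF//.
  near=> u; rewrite sub0r normrN ger0_norm ?powR_ge0//.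
  have [u0|u0] := leP u 0.
    by rewrite /ppow max_l// powR0 ?gt_eqF.
  rewrite ppowE ?(ltW u0)//.
  rewrite [ltRHS](_ : e = (e `^ a^-1) `^ a); last first.
    by rewrite -powRrM mulVf ?gt_eqF// powRr1// ltW.
  apply: gt0_ltr_powR; rewrite ?nnegrE ?powR_ge0 ?(ltW u0)//.
  by near: u; apply: lt_nbhsl; rewrite powR_gt0.
Unshelve. all: end_near. Qed.

(** The Riemann-Liouville integral of order [a] without the factor 1/Gamma(a), see [RLkE]; for
    positive [a] it is extended by 0 to negative times. It is thereby continuous on the whole line,
    which avoids carrying a domain around. *)
Definition RLk a g t : R := ppow a t * Wint a (fun s => g (t * s)).

Lemma continuous_RLk a g : 0 < a <= 1 -> continuous g -> continuous (RLk a g).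
Proof.
move=> a01 cg t; have /andP[a0 _] := a01.
have c1 := continuous_ppow a0; have c2 := continuous_Wint_scale a01 cg.
by apply: continuous_for_mul; [exact: c1|exact: c2].
Qed.

Lemma RLk_lin a g h b c t : 0 < a <= 1 -> continuous g -> continuous h ->
  RLk a (fun s => b * g s + c * h s) t = b * RLk a g t + c * RLk a h t.
Proof.
move=> a01 cg ch; rewrite /RLk Wint_lin//; last 2 first.
- exact: continuous_scaler.
- exact: continuous_scaler.
ring.
Qed.

Lemma RLk_le0 a g t : 0 < a -> t <= 0 -> RLk a g t = 0.
Proof. by move=> a0 t0; rewrite /RLk /ppow max_l// powR0 ?mul0r// gt_eqF. Qed.

Lemma ler_RLk a g h t : 0 < a <= 1 -> continuous g -> continuous h ->
  (forall s, 0 <= s <= t -> g s <= h s) -> RLk a g t <= RLk a h t.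
Proof.
move=> a01 cg ch gh; have /andP[a0 _] := a01.
have [t0|t0] := leP t 0; first by rewrite !RLk_le0.
rewrite ler_wpM2l ?powR_ge0//; apply: ler_Wint => //; try exact: continuous_scaler.
move=> s /andP[s0 s1]; apply: gh; rewrite mulr_ge0 ?(ltW t0)//=.
by rewrite ler_piMr// ltW.
Qed.

Lemma RLk_norm a g t : 0 < a <= 1 -> continuous g ->
  `|RLk a g t| <= RLk a (fun s => `|g s|) t.
Proof.
move=> a01 cg.
have cn : continuous (fun s => `|g s|) by move=> s; apply: cvg_norm; exact: cg.
have cN : continuous (fun s => - g s) by cont.
rewrite ler_norml; apply/andP; split.
  rewrite lerNl.
  have -> : - RLk a g t = RLk a (fun s => (-1) * g s + 0 * g s) t.
    by rewrite RLk_lin//; ring.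
  apply: ler_RLk => //; first by cont.
  by move=> s _; rewrite mul0r addr0 mulN1r -normrN ler_norm.
by apply: ler_RLk => // s _; rewrite ler_norm.
Qed.

(** Homogeneity of the kernel. This scaling law is what makes time dilations of a solution
    comparable with the solution itself. *)
Lemma RLk_scale a g c t : 0 < c ->
  RLk a (fun s => g (c * s)) t = c `^ (- a) * RLk a g (c * t).
Proof.
move=> c0; rewrite /RLk mulrA; congr (_ * _); last first.
  by apply: eq_Rintegral => s _; rewrite mulrA.
have -> : ppow a (c * t) = c `^ a * ppow a t.
  by rewrite /ppow -powRM ?(ltW c0) ?le_max ?lexx// maxr_pMr ?(ltW c0)// mulr0.
by rewrite mulrA -powRD ?addNr ?powRr0 ?mul1r// (gt_eqF c0) implybT.
Qed.

Lemma RLkE a g t : 0 < a <= 1 -> 0 <= t -> continuous g ->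
  \int[mu]_(tau in `[0, t]) ((t - tau) `^ (a - 1) * g tau) = RLk a g t.
Proof.
move=> a01; have /andP[a0 _] := a01; rewrite le_eqVlt => /predU1P[<- _|t0 cg].
  by rewrite set_itv1 Rintegral_set1 RLk_le0.
rewrite (@Rintegral_affine _ t 0) ?gt_eqF//; last first.
  apply: measurable_funM; last first.
    by apply: measurable_funTS; exact: continuous_measurable_fun.
  by apply: measurable_powR_comp; apply: measurable_funB.
rewrite gtr0_norm//.
have -> : (fun x => t * x + 0) @^-1` `[0, t] = I01.
  apply/seteqP; split=> x /=; rewrite !in_itv/= addr0.
    by rewrite pmulr_rge0// -[X in _ * _ <= X](mulr1 t) ler_pM2l.
  by rewrite pmulr_rge0// -[X in _ * _ <= X](mulr1 t) ler_pM2l.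
rewrite /RLk ppowE ?(ltW t0)// /Wint.
have -> : t `^ a = t * t `^ (a - 1) by rewrite mulr_powRB1// ltW.
rewrite -mulrA; congr (_ * _).
rewrite -(@RintegralZl _ _ R mu I01)//; last first.
  by apply: integrable_Wint_cont => //; exact: continuous_scaler.
apply: eq_Rintegral => s; rewrite inE/= in_itv/= => /andP[s0 s1].
rewrite addr0 mulrA -powRM ?(ltW t0) ?subr_ge0//.
by rewrite mulrBr mulr1.
Qed.
End kernel_integrals.

(** * Composition of the fractional integrals of orders [a] and [1 - a] *)

Section semigroup.
Context {R : realType}.
Notation mu := (@lebesgue_measure R).
Local Notation I01 := (`[(0 : R), (1 : R)]%classic).
Implicit Types (F f g h : R -> R) (a b c m x v M t s : R).

Lemma integrable_vanish (D E : set R) f : measurable D -> measurable E ->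
  E `<=` D -> (forall x, D x -> ~ E x -> f x = 0) ->
  mu.-integrable E (EFin \o f) -> mu.-integrable D (EFin \o f).
Proof.
move=> mD mE ED f0 fi.
have : mu.-integrable D ((EFin \o f) \_ E).
  by apply/(@integrable_restrict _ _ R mu E mE D mD); rewrite ((setIidPr _ _).2 ED).
apply: eq_integrable => // x; rewrite inE => Dx; rewrite patchE.
by case: ifPn => //; rewrite notin_setE => /(f0 _ Dx) /= ->.
Qed.

Lemma Rintegral_vanish (D E : set R) f : E `<=` D ->
  (forall x, D x -> ~ E x -> f x = 0) ->
  \int[mu]_(x in E) f x = \int[mu]_(x in D) f x.
Proof.
move=> ED f0; rewrite -{1}((setIidPr _ _).2 ED) Rintegral_mkcondr.
apply: eq_Rintegral => x; rewrite inE => Dx; rewrite patchE.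
by case: ifPn => //; rewrite notin_setE => /(f0 _ Dx) ->.
Qed.

Lemma ppow_le0 a t : a != 0 -> t <= 0 -> ppow a t = 0.
Proof. by move=> a0 t0; rewrite /ppow max_l// powR0. Qed.

Lemma ppowM a c t : 0 <= c -> ppow a (c * t) = c `^ a * ppow a t.
Proof.
move=> c0; rewrite /ppow -powRM ?le_max ?lexx// maxr_pMr ?mulr0//.
Qed.

Lemma measurable_ppow_comp d (T : measurableType d) (D : set T) (g : T -> R) (p : R) :
  measurable_fun D g -> measurable_fun D (fun y => ppow p (g y)).
Proof.
move=> mg; apply: measurable_powR_comp.
by apply: measurable_maxr => //.
Qed.

Lemma integrable_ppow a M : 0 < a < 1 -> 0 < M ->
  mu.-integrable `[- M, M] (EFin \o ppow (a - 1)).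
Proof.
move=> /andP[a0 a1] M0.
have a10 : a - 1 != 0 by rewrite lt_eqF// subr_lt0.
apply: (@integrable_vanish _ `[0, M]) => //.
- by apply: subset_itvr; rewrite bnd_simp oppr_le0 ltW.
- move=> x; rewrite /= !in_itv/= => /andP[x1 x2]; rewrite x2 andbT => /negP.
  by rewrite -ltNge => x0; apply: ppow_le0 => //; exact: ltW.
apply: (@integrable_affine _ M 0); rewrite ?gt_eqF//.
  by apply: measurable_ppow_comp.
have -> : (fun x => M * x + 0) @^-1` `[0, M] = I01.
  apply/seteqP; split=> x /=; rewrite !in_itv/= addr0.
    by rewrite pmulr_rge0// -[X in _ * _ <= X](mulr1 M) ler_pM2l.
  by rewrite pmulr_rge0// -[X in _ * _ <= X](mulr1 M) ler_pM2l.
have ig := @integrable_powR01 R a _.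
have := @integrableZl _ _ R mu I01 (measurable_itv _) (M `^ (a - 1)) _ (ig _).
rewrite a0 (ltW a1) => /(_ isT).
apply: eq_integrable => // x; rewrite inE/= in_itv/= => /andP[x0 x1].
by rewrite addr0 ppowM ?(ltW M0)// ppowE.
Qed.

(** The Beta integrand extended by zero to negative [x]: up to a factor, it is the composed kernel
    after the affine change of variable that sends [s] to 0 and [t] to 1. *)
Definition bfun a x : R := (1 - x) `^ ((1 - a) - 1) * ppow (a - 1) x.

(** The Euler Beta value B(1-a, a), kept as an integral: the arguments below rely on its positivity
    and on its appearance in [RLk_semigroup]. *)
Definition betaB a : R := \int[mu]_(s in I01) ((1 - s) `^ ((1 - a) - 1) * s `^ (a - 1)).

Lemma integrable_bfun01 a : 0 < a < 1 -> mu.-integrable I01 (EFin \o bfun a).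
Proof.
move=> /andP[a0 a1].
have := @integrable_beta R (1 - a) a _ _.
rewrite subr_gt0 a0 a1 (ltW a1) gerBl (ltW a0) => /(_ isT isT).
apply: eq_integrable => // x; rewrite inE/= in_itv/= => /andP[x0 x1].
by rewrite /bfun ppowE.
Qed.

Lemma bfun0 a u x : 0 < a < 1 -> `[-u, 1]%classic x -> ~ I01 x -> bfun a x = 0.
Proof.
move=> /andP[a0 a1]; rewrite /= !in_itv/= => /andP[x1 x2]; rewrite x2 andbT => /negP.
rewrite -ltNge => x0; rewrite /bfun ppow_le0 ?mulr0//; last exact: ltW.
by rewrite lt_eqF// subr_lt0.
Qed.

Lemma integrable_bfun a u : 0 < a < 1 -> 0 <= u ->
  mu.-integrable `[- u, 1] (EFin \o bfun a).
Proof.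
move=> a01 u0; apply: integrable_vanish (integrable_bfun01 a01) => //.
- by apply: subset_itvr; rewrite bnd_simp oppr_le0.
- by move=> x; exact: bfun0.
Qed.

Lemma Rintegral_bfun a u : 0 < a < 1 -> 0 <= u ->
  \int[mu]_(x in `[- u, 1]) bfun a x = betaB a.
Proof.
move=> a01 u0; rewrite -(@Rintegral_vanish _ I01)//.
- apply: eq_Rintegral => x; rewrite inE/= in_itv/= => /andP[x0 x1].
  by rewrite /bfun ppowE.
- by apply: subset_itvr; rewrite bnd_simp oppr_le0.
- by move=> x; exact: bfun0.
Qed.

Lemma betaB_gt0 a : 0 < a < 1 -> 0 < betaB a.
Proof.
move=> /andP[a0 a1].
have a10 : 0 < 1 - a <= 1 by rewrite subr_gt0 a1 gerBl ltW.
have a01 : 0 < a <= 1 by rewrite a0 ltW.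
apply: (@Rintegral_gt0 _ _ _ (1/4) (1/2) 1) => //.
- exact: integrable_beta.
- by move=> x _; rewrite mulr_ge0 ?powR_ge0.
- lra.
- by apply: subset_itv; rewrite bnd_simp; lra.
- move=> x /andP[x0 x1]; rewrite -[leLHS]mulr1 ler_pM//.
    by rewrite -[leLHS](powRr0 (1 - x)); apply: ger_powR; lra.
  by rewrite -[leLHS](powRr0 x); apply: ger_powR; lra.
Qed.

Lemma preimage_affine_seg t s : 0 <= s < t ->
  (fun x => (t - s) * x + s) @^-1` `[0, t] = `[- (s / (t - s)), 1]%classic.
Proof.
move=> /andP[s0 st]; have c0 : 0 < t - s by rewrite subr_gt0.
have e1 x : (0 <= (t - s) * x + s) = (- (s / (t - s)) <= x).
  by rewrite -mulNr ler_pdivrMr// -lerBlDr sub0r mulrC.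
have e2 x : ((t - s) * x + s <= t) = (x <= 1).
  by rewrite -lerBrDr -[leRHS]mulr1 ler_pM2l.
by apply/seteqP; split=> x /=; rewrite !in_itv/= e1 e2.
Qed.

Let f2E a t s x : 0 < a < 1 -> 0 <= s < t -> x <= 1 ->
  (t - ((t - s) * x + s)) `^ ((1 - a) - 1) * ppow (a - 1) ((t - s) * x + s - s) =
  (t - s)^-1 * bfun a x.
Proof.
move=> /andP[a0 a1] /andP[s0 st] x1; have c0 : 0 < t - s by rewrite subr_gt0.
rewrite addrK ppowM ?(ltW c0)//.
have -> : t - ((t - s) * x + s) = (t - s) * (1 - x) by ring.
rewrite powRM ?(ltW c0) ?subr_ge0// mulrACA -powRD; last by rewrite (gt_eqF c0) implybT.
have -> : 1 - a - 1 + (a - 1) = -1 by ring.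
by rewrite powR_inv1 ?(ltW c0).
Qed.

Lemma semigroup_kernel_integrable a t s : 0 < a < 1 -> 0 <= s < t ->
  mu.-integrable `[0, t]
    (EFin \o (fun x => (t - x) `^ ((1 - a) - 1) * ppow (a - 1) (x - s))).
Proof.
move=> a01 st; have /andP[s0 st'] := st; have c0 : 0 < t - s by rewrite subr_gt0.
apply: (@integrable_affine _ (t - s) s); rewrite ?gt_eqF//.
  apply: measurable_funM.
    by apply: measurable_powR_comp; apply: measurable_funB.
  by apply: measurable_ppow_comp; apply: measurable_funB.
rewrite preimage_affine_seg//.
have u0 : 0 <= s / (t - s) by rewrite divr_ge0// ltW.
have := @integrableZl _ _ R mu _ (measurable_itv _) (t - s)^-1 _ (integrable_bfun a01 u0).
apply: eq_integrable => // x; rewrite inE/= in_itv/= => /andP[_ x1].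
by rewrite f2E.
Qed.

(** The two exponents add up to -1, which cancels the Jacobian t - s; hence the value depends on
    neither [s] nor [t]. *)
Lemma Rintegral_semigroup_kernel a t s : 0 < a < 1 -> 0 <= s < t ->
  \int[mu]_(x in `[0, t]) ((t - x) `^ ((1 - a) - 1) * ppow (a - 1) (x - s)) = betaB a.
Proof.
move=> a01 st; have /andP[s0 st'] := st; have c0 : 0 < t - s by rewrite subr_gt0.
rewrite (@Rintegral_affine _ (t - s) s); rewrite ?gt_eqF//; last first.
  apply: measurable_funM.
    by apply: measurable_powR_comp; apply: measurable_funB.
  by apply: measurable_ppow_comp; apply: measurable_funB.
rewrite preimage_affine_seg// gtr0_norm//.
have u0 : 0 <= s / (t - s) by rewrite divr_ge0// ltW.
transitivity ((t - s) * \int[mu]_(x in `[- (s / (t - s)), 1]) ((t - s)^-1 * bfun a x)).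
  congr (_ * _); apply: eq_Rintegral => x; rewrite inE/= in_itv/= => /andP[_ x1].
  by rewrite f2E.
rewrite RintegralZl//; last exact: integrable_bfun.
by rewrite Rintegral_bfun// mulVKf// gt_eqF.
Qed.

Lemma continuous_bounded g t : continuous g -> exists M, 0 <= M /\ forall s, 0 <= s <= t -> `|g s| <= M.
Proof.
move=> cg; have [M hM] := continuous_bounded01 (@continuous_scaler _ g t cg).
exists `|M|; split=> // s /andP[s0 st].
have [t0|t0] := leP t 0.
  have <- : 0 = s by apply/eqP; rewrite eq_le s0 (le_trans st).
  have := hM 0; rewrite lexx ler01 mulr0 => /(_ isT) /le_trans; apply; exact: ler_norm.
have := hM (s / t); rewrite mulrCA mulfV ?gt_eqF// mulr1 => h.
apply: le_trans (ler_norm _); apply: h.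
by rewrite divr_ge0 ?(ltW t0)//= ler_pdivrMr// mul1r.
Qed.

Lemma integrable_ppow_shift a g t s : 0 < a < 1 -> 0 <= s <= t -> continuous g ->
  mu.-integrable `[0, t[ (EFin \o (fun y => ppow (a - 1) (s - y) * g y)).
Proof.
move=> a01 /andP[s0 st] cg.
have [t0|t0] := leP t 0.
  by rewrite set_itv_ge ?bnd_simp -?leNgt//; exact: integrable_set0.
have [M [M0 hM]] := continuous_bounded t cg.
have i1 : mu.-integrable `[0, t] (EFin \o (fun y => ppow (a - 1) (s - y))).
  apply: (@integrable_affine _ (-1) s) => //.
    by apply: measurable_ppow_comp; apply: measurable_funB.
  have iM : mu.-integrable `[- t, t] (fun x => (ppow (a - 1) (s - (-1 * x + s)))%:E).
    have := integrable_ppow a01 t0; apply: eq_integrable => // x _ /=.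
    by congr (ppow _ _)%:E; ring.
  apply: integrableS iM => //.
    rewrite -[X in measurable X]setTI; apply: (measurable_affine (-1) s) => //.
  by move=> x; rewrite /= !in_itv/= => /andP[h1 h2]; apply/andP; split; lra.
have i2 : mu.-integrable `[0, t[ (EFin \o (fun y => M * ppow (a - 1) (s - y))).
  have := @integrableZl _ _ R mu _ (measurable_itv _) M _ i1.
  by apply: integrableS => //; apply: subset_itvl; rewrite bnd_simp.
apply: dominated_integrable i2 _ => //.
  apply: measurable_funM.
    by apply: measurable_ppow_comp; apply: measurable_funB.
  by apply: measurable_funTS; exact: continuous_measurable_fun.
move=> y; rewrite /= in_itv/= => /andP[y0 yt].
rewrite normrM [`|ppow _ _|]ger0_norm ?powR_ge0// mulrC ler_wpM2r ?powR_ge0//.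
by rewrite hM// y0 ltW.
Qed.

Lemma Rintegral_ppow_shift a g t s : 0 < a < 1 -> 0 <= s <= t -> continuous g ->
  \int[mu]_(y in `[0, t[) (ppow (a - 1) (s - y) * g y) = RLk a g s.
Proof.
move=> a01 /andP[s0 st] cg; have /andP[a0 a1] := a01.
have a10 : a - 1 != 0 by rewrite lt_eqF// subr_lt0.
rewrite -RLkE ?a0 ?(ltW a1)//.
transitivity (\int[mu]_(y in `[0, t]) (ppow (a - 1) (s - y) * g y)).
  rewrite Rintegral_itv_bndo_bndc//.
  by apply: integrable_ppow_shift => //; rewrite s0.
rewrite -(@Rintegral_vanish _ `[0, s]%classic).
- apply: eq_Rintegral => y; rewrite inE/= in_itv/= => /andP[y0 ys].
  by rewrite ppowE// subr_ge0.
- by apply: subset_itvl; rewrite bnd_simp.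
- move=> y; rewrite /= !in_itv/= => /andP[y0 yt]; rewrite y0/= => /negP.
  by rewrite -ltNge => sy; rewrite ppow_le0 ?mul0r// subr_le0 ltW.
Qed.

(** Exchange of the integrations over the triangle y < s < t; the inner integral over [s] is then
    the constant [betaB a]. *)
Lemma RLk_semigroup a g t : 0 < a < 1 -> continuous g -> 0 <= t ->
  RLk (1 - a) (RLk a g) t = betaB a * \int[mu]_(s in `[0, t]) g s.
Proof.
move=> a01 cg t0; have /andP[a0 a1] := a01.
have a01' : 0 < a <= 1 by rewrite a0 ltW.
have b01 : 0 < 1 - a <= 1 by rewrite subr_gt0 a1 gerBl ltW.
rewrite -RLkE//; last exact: continuous_RLk.
have cgi : mu.-integrable `[0, t[ (EFin \o g).
  have : mu.-integrable `[0, t] (EFin \o g).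
    by apply: continuous_integrable => x _; exact: cg.
  by apply: integrableS => //; apply: subset_itvl; rewrite bnd_simp.
(* The triangle is written as a rectangle on which [ppow] cuts off y > s. The endpoint y = t is left
   out so that the change of variable in the inner integral is never degenerate. *)
transitivity (\int[mu]_(s in `[0, t]) \int[mu]_(y in `[0, t[)
    ((t - s) `^ ((1 - a) - 1) * (ppow (a - 1) (s - y) * g y))).
  apply: eq_Rintegral => s; rewrite inE/= in_itv/= => st.
  rewrite RintegralZl//; last exact: integrable_ppow_shift.
  by rewrite Rintegral_ppow_shift.
have meas : measurable_fun setT (fun z : R * R =>
    (t - z.1) `^ ((1 - a) - 1) * (ppow (a - 1) (z.1 - z.2) * g z.2)).
  apply: measurable_funM.
    by apply: measurable_powR_comp; apply: measurable_funB.
  apply: measurable_funM.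
    by apply: measurable_ppow_comp; apply: measurable_funB.
  by apply: (measurableT_comp (continuous_measurable_fun cg)).
rewrite (@Rfubini _ _ _ _ R mu mu `[0, t]%classic `[0, t[%classic _
  (fun y => betaB a * `|g y|) _ _ meas)//.
- transitivity (\int[mu]_(y in `[0, t[) (betaB a * g y)).
    apply: eq_Rintegral => y; rewrite inE/= in_itv/= => yt.
    under eq_Rintegral do rewrite mulrA.
    rewrite RintegralZr//; last exact: semigroup_kernel_integrable.
    by rewrite Rintegral_semigroup_kernel.
  by rewrite RintegralZl// Rintegral_itv_bndo_bndc.
- move=> s; rewrite /= in_itv/= => st.
  have := @integrableZl _ _ R mu _ (measurable_itv _) ((t - s) `^ ((1 - a) - 1)) _
    (integrable_ppow_shift a01 st cg).
  exact.
- move=> y; rewrite /= in_itv/= => yt.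
  have := @integrableZr _ _ R mu _ (measurable_itv _) (g y) _
    (semigroup_kernel_integrable a01 yt).
  by apply: eq_integrable => // s _ /=; rewrite -EFinM mulrA.
- have := @integrableZl _ _ R mu _ (measurable_itv _) (betaB a) _ (integrable_norm cgi).
  exact.
- move=> y; rewrite /= in_itv/= => yt.
  have k0 s : 0 <= (t - s) `^ ((1 - a) - 1) * ppow (a - 1) (s - y).
    by rewrite mulr_ge0 ?powR_ge0.
  under eq_Rintegral do rewrite mulrA normrM (ger0_norm (k0 _)).
  rewrite RintegralZr//; last exact: semigroup_kernel_integrable.
  by rewrite Rintegral_semigroup_kernel.
Qed.

End semigroup.

(** * Primitives, and positivity of the exponential kernel *)

Section positivity.
Context {R : realType}.
Notation mu := (@lebesgue_measure R).
Local Notation I01 := (`[(0 : R), (1 : R)]%classic).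
Local Notation Rpos := (`](0 : R), +oo[%classic).
Implicit Types (F f g h v V : R -> R) (a b c m x M t s r T : R).

Lemma FTC2_oo F f a b : a <= b -> continuous F -> continuous f ->
  (forall x, a < x < b -> is_derive x 1 F (f x)) ->
  \int[mu]_(x in `[a, b]) f x = F b - F a.
Proof.
rewrite le_eqVlt => /predU1P[->|ab] cF cf dF.
  by rewrite set_itv1 Rintegral_set1 subrr.
rewrite /Rintegral (@continuous_FTC2 _ f F)//.
- exact: continuous_subspaceT.
- split.
  + by move=> x; rewrite in_itv/= => /dF [].
  + by apply: cvg_at_right_filter; apply: cF.
  + by apply: cvg_at_left_filter; apply: cF.
- by move=> x; rewrite in_itv/= => /dF /derivable_is_derive[].
Qed.

(** The primitive vanishing at 0, taken as the case of order one so that linearity, monotonicity and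
    continuity on the whole line are inherited from [RLk]. *)
Definition prim g t : R := RLk 1 g t.

Lemma primE g t : 0 <= t -> continuous g -> prim g t = \int[mu]_(s in `[0, t]) g s.
Proof.
move=> t0 cg; rewrite /prim -RLkE//; last by rewrite ltr01 lexx.
by apply: eq_Rintegral => s _; rewrite subrr powRr0 mul1r.
Qed.

Lemma continuous_prim g : continuous g -> continuous (prim g).
Proof. by move=> cg; apply: continuous_RLk => //; rewrite ltr01 lexx. Qed.

Lemma prim0 g : prim g 0 = 0.
Proof. by rewrite /prim RLk_le0. Qed.

Lemma is_derive_prim g t : 0 < t -> continuous g -> is_derive t 1 (prim g) (g t).
Proof.
move=> t0 cg.
have tt : t < t + 1 by rewrite ltrDl.
have ig : mu.-integrable `[0, t + 1] (EFin \o g).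
  by apply: continuous_integrable => x _; exact: cg.
have [d1 d2] := @continuous_FTC1_closed R g 0 t (t + 1) tt ig t0 (cg t).
have h : {near t, (fun x => \int[mu]_(s in `[0, x]) g s) =1 prim g}.
  by near=> u; rewrite primE// ltW//; near: u; exact: lt_nbhsr.
apply: (near_eq_is_derive h).
by apply: DeriveDef => //; rewrite -derive1E.
Unshelve. all: end_near. Qed.

Lemma prim_ge0 g t : 0 <= t -> continuous g -> (forall s, 0 <= s <= t -> 0 <= g s) ->
  0 <= prim g t.
Proof.
move=> t0 cg g0; rewrite primE//; apply: Rintegral_ge0 => s.
by rewrite /= in_itv/=; exact: g0.
Qed.

(** With Y the primitive of exp(r s) V(s), the function H = exp(-2rt) Y^2 / 2 has derivative equal
    to the integrand minus r exp(-2rt) Y^2. The integral is therefore at least H(T) - H(0) = H(T) >=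
    0. *)
Lemma exp_kernel_ge0 V r T : continuous V -> 0 <= r -> 0 <= T ->
  0 <= prim (fun t => V t * (expR (- (r * t)) * prim (fun s => expR (r * s) * V s) t)) T.
Proof.
move=> cV r0 T0.
have cE : continuous (fun s => expR (r * s) * V s) by cont.
have cY := continuous_prim cE; set Y := prim _ in cY *.
pose H t := expR (- (2 * r * t)) * (Y t * Y t) / 2.
have cH : continuous H by rewrite /H; cont.
pose H' t := expR (- (2 * r * t)) * (expR (r * t) * V t * Y t) -
             r * expR (- (2 * r * t)) * (Y t * Y t).
have cH' : continuous H' by rewrite /H'; cont.
have dH x : 0 < x < T -> is_derive x 1 H (H' x).
  move=> /andP[x0 xT].
  have dY := is_derive_prim x0 cE.
  have dE : is_derive x 1 (fun t => expR (- (2 * r * t))) (expR (- (2 * r * x)) * (- (2 * r * 1))).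
    have dl : is_derive x 1 (fun t => - (2 * r * t)) (- (2 * r * 1)).
      have := is_derive_scale (- (2 * r)) (is_derive_id1 x).
      by rewrite mulNr; under eq_fun do rewrite mulNr.
    exact: (is_derive_comp (is_derive_expR _) dl).
  have := is_derive_scale 2^-1 (is_derive_mul dE (is_derive_mul dY dY)).
  rewrite -/Y => h.
  have -> : H = (fun y => 2^-1 * (expR (- (2 * r * y)) * (Y y * Y y))).
    by apply/funext => y; rewrite /H mulrC.
  by apply: is_derive_eq h _; rewrite /H'; field.
have e := FTC2_oo T0 cH cH' dH.
have cI : continuous (fun t => V t * (expR (- (r * t)) * Y t)) by cont.
have HT : 0 <= H T - H 0.
  rewrite /H /Y prim0 !(mulr0, mul0r) subr0.
  by rewrite divr_ge0// mulr_ge0 ?expR_ge0// -expr2 sqr_ge0.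
apply: le_trans HT _; rewrite -e primE//; apply: le_Rintegral => //.
- by apply: continuous_integrable => x _; exact: cH'.
- by apply: continuous_integrable => x _; exact: cI.
- move=> x _; rewrite /H'.
  have -> : expR (- (2 * r * x)) * (expR (r * x) * V x * Y x) = V x * (expR (- (r * x)) * Y x).
    have -> : expR (- (r * x)) = expR (- (2 * r * x)) * expR (r * x).
      by rewrite -expRD; congr expR; ring.
    ring.
  by rewrite gerBl -expr2 mulr_ge0 ?sqr_ge0// mulr_ge0 ?expR_ge0.
Qed.

End positivity.

(** * The Gamma integral with a complex rate *)

Section phase.
Context {R : realType}.
Notation mu := (@lebesgue_measure R).
Local Notation Rpos := (`](0 : R), +oo[%classic).
Implicit Types (F h v V : R -> R) (a b c m x M t s r T : R).

Lemma is_derive_under_integral (f f' : R -> R -> R) (G : R -> R) s :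
  (forall s, mu.-integrable Rpos (EFin \o f s)) ->
  (forall s r, 0 < r -> is_derive s 1 (f^~ r) (f' s r)) ->
  (forall r, 0 <= G r) -> mu.-integrable Rpos (EFin \o G) ->
  (forall s r, 0 < r -> `|f' s r| <= G r) ->
  is_derive s 1 (fun s => \int[mu]_(r in Rpos) f s r) (\int[mu]_(r in Rpos) f' s r).
Proof.
move=> fi df G0 Gi fG.
have Is : `](s - 1), (s + 1)[%classic s by rewrite /= in_itv/=; lra.
have H1 x : `](s - 1), (s + 1)[%classic x -> mu.-integrable Rpos (EFin \o f x) by [].
have H2 x y : `](s - 1), (s + 1)[%classic x -> Rpos y -> derivable (f^~ y) x 1.
  by move=> _; rewrite /= in_itv/= andbT => y0; case: (df x y y0).
have e x y : Rpos y -> partial1of2 f x y = f' x y.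
  rewrite /= in_itv/= andbT => y0; rewrite partial1of2E.
  by case: (df x y y0) => _ ->.
have H3 x y : `](s - 1), (s + 1)[%classic x -> Rpos y -> `|partial1of2 f x y| <= G y.
  by move=> _ y0; rewrite e//; apply: fG; move: y0; rewrite /= in_itv/= andbT.
have dd := @derivable_under_integral R _ _ mu f Rpos (measurable_itv _) s (s - 1) (s + 1) Is H1 H2 G G0 Gi H3.
split; first exact: dd.
rewrite -derive1E (@differentiation_under_integral R _ _ mu f Rpos (measurable_itv _) s (s - 1) (s + 1) Is H1 H2 G G0 Gi H3).
by apply: eq_Rintegral => y; rewrite inE => y0; rewrite e.
Qed.

(** [gcos m s - i gsin m s] is the integral of r^(m-1) exp(-(1 + i s) r) over r > 0. *)
Definition gcos m s : R := \int[mu]_(r in Rpos) (r `^ (m - 1) * expR (- r) * cos (s * r)).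
Definition gsin m s : R := \int[mu]_(r in Rpos) (r `^ (m - 1) * expR (- r) * sin (s * r)).

Lemma integrable_gamma_bounded m h : 0 < m <= 2 -> continuous h ->
  (forall r, `|h r| <= 1) ->
  mu.-integrable Rpos (EFin \o (fun r => r `^ (m - 1) * expR (- r) * h r)).
Proof.
move=> m02 ch h1.
apply: dominated_integrable (integrable_gamma m02) _ => //.
  apply: continuous_measurable_gt0 => x x0; cont.
  exact: continuous_powR.
move=> r _; rewrite normrM ger0_norm ?mulr_ge0 ?powR_ge0 ?expR_ge0//.
by rewrite ler_piMr ?mulr_ge0 ?powR_ge0 ?expR_ge0.
Qed.

Lemma integrable_gcos m s : 0 < m <= 2 ->
  mu.-integrable Rpos (EFin \o (fun r => r `^ (m - 1) * expR (- r) * cos (s * r))).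
Proof.
move=> m02; apply: integrable_gamma_bounded => //; first by cont.
by move=> r; exact: cos_max.
Qed.

Lemma integrable_gsin m s : 0 < m <= 2 ->
  mu.-integrable Rpos (EFin \o (fun r => r `^ (m - 1) * expR (- r) * sin (s * r))).
Proof.
move=> m02; apply: integrable_gamma_bounded => //; first by cont.
by move=> r; exact: sin_max.
Qed.

Lemma is_derive_gcos m s : 0 < m <= 1 -> is_derive s 1 (gcos m) (- gsin (m + 1) s).
Proof.
move=> /andP[m0 m1].
have m02 : 0 < m <= 2 by rewrite m0 (le_trans m1)// ler1n.
have m12 : 0 < m + 1 <= 2 by rewrite addr_gt0//= -lerBrDr (le_trans m1)//; lra.
have := @is_derive_under_integral
  (fun s r => r `^ (m - 1) * expR (- r) * cos (s * r))
  (fun s r => - 1 * (r `^ (m + 1 - 1) * expR (- r) * sin (s * r)))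
  (fun r => r `^ (m + 1 - 1) * expR (- r)) s.
rewrite RintegralZl//; last exact: integrable_gsin.
rewrite mulN1r; apply.
- by move=> u; exact: integrable_gcos.
- move=> u r r0.
  have dl : is_derive u 1 (fun y => y * r) r.
    have := is_derive_scale r (is_derive_id1 u); rewrite mulr1.
    by under eq_fun do rewrite mulrC.
  have h := is_derive_scale (r `^ (m - 1) * expR (- r)) (is_derive_comp (is_derive_cos _) dl).
  apply: is_derive_eq h _.
  rewrite addrK -(mulr_powRB1 (ltW r0) m0); ring.
- by move=> r; rewrite mulr_ge0 ?powR_ge0 ?expR_ge0.
- exact: integrable_gamma.
- move=> u r r0; rewrite mulN1r normrN normrM ger0_norm ?mulr_ge0 ?powR_ge0 ?expR_ge0//.
  by rewrite ler_piMr ?mulr_ge0 ?powR_ge0 ?expR_ge0// sin_max.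
Qed.

Lemma is_derive_gsin m s : 0 < m <= 1 -> is_derive s 1 (gsin m) (gcos (m + 1) s).
Proof.
move=> /andP[m0 m1].
have m02 : 0 < m <= 2 by rewrite m0 (le_trans m1)// ler1n.
have m12 : 0 < m + 1 <= 2 by rewrite addr_gt0//= -lerBrDr (le_trans m1)//; lra.
have := @is_derive_under_integral
  (fun s r => r `^ (m - 1) * expR (- r) * sin (s * r))
  (fun s r => r `^ (m + 1 - 1) * expR (- r) * cos (s * r))
  (fun r => r `^ (m + 1 - 1) * expR (- r)) s.
apply.
- by move=> u; exact: integrable_gsin.
- move=> u r r0.
  have dl : is_derive u 1 (fun y => y * r) r.
    have := is_derive_scale r (is_derive_id1 u); rewrite mulr1.
    by under eq_fun do rewrite mulrC.
  have h := is_derive_scale (r `^ (m - 1) * expR (- r)) (is_derive_comp (is_derive_sin _) dl).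
  apply: is_derive_eq h _.
  rewrite addrK -(mulr_powRB1 (ltW r0) m0); ring.
- by move=> r; rewrite mulr_ge0 ?powR_ge0 ?expR_ge0.
- exact: integrable_gamma.
- move=> u r r0; rewrite normrM ger0_norm ?mulr_ge0 ?powR_ge0 ?expR_ge0//.
  by rewrite ler_piMr ?mulr_ge0 ?powR_ge0 ?expR_ge0// cos_max.
Qed.

Lemma powR_expR_le m r : 0 < m <= 1 -> 1 <= r -> r `^ m * expR (- r) <= 27%:R / r.
Proof.
move=> /andP[m0 m1] r1; have r0 : 0 < r by exact: lt_le_trans r1.
rewrite ler_pdivlMr// expRN mulrAC ler_pdivrMr ?expR_gt0//.
apply: le_trans (cube_le_expR (ltW r0)).
apply: (@le_trans _ _ (r * r)).
  by rewrite ler_wpM2r ?(ltW r0)// ler1_powR.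
apply: (@le_trans _ _ ((1 + r) ^+ 2)).
  by rewrite -expr2 lerXn2r ?nnegrE; lra.
by apply: ler_weXn2l => //; lra.
Qed.

(** These are the boundary terms at 0 and at infinity of the two integrations by parts below. *)
Lemma powR_expR_bounded_cvg0 m h : 0 < m <= 1 -> (forall r, `|h r| <= 1) ->
  r `^ m * expR (- r) * h r @[r --> 0^'+] --> 0 /\
  r `^ m * expR (- r) * h r @[r --> +oo] --> 0.
Proof.
move=> m01 h1; have /andP[m0 m1] := m01; split.
  apply/cvgrPdist_lt => e e0.
  have /cvgrPdist_lt/(_ e e0) := @powR_cvg0 R m m0.
  apply: filter_app; near=> r; rewrite !sub0r !normrN ger0_norm ?powR_ge0// => re.
  have r0 : 0 < r by near: r; exact: nbhs_right_gt.
  rewrite normrM (le_lt_trans _ re)//.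
  rewrite ger0_norm ?mulr_ge0 ?powR_ge0 ?expR_ge0//.
  rewrite -[leRHS]mulr1 ler_pM ?mulr_ge0 ?powR_ge0 ?expR_ge0//.
  by rewrite ler_piMr ?powR_ge0// expR_le1 oppr_le0 ltW.
apply/cvgrPdist_lt => e e0; near=> r; rewrite sub0r normrN.
have r1 : 1 <= r by near: r; apply: nbhs_pinfty_ge; rewrite num_real.
have r2 : 27%:R / e < r by near: r; apply: nbhs_pinfty_gt; rewrite num_real.
rewrite normrM ger0_norm ?mulr_ge0 ?powR_ge0 ?expR_ge0//.
apply: (@le_lt_trans _ _ (r `^ m * expR (- r))).
  by rewrite ler_piMr ?mulr_ge0 ?powR_ge0 ?expR_ge0.
apply: le_lt_trans (powR_expR_le m01 r1) _.
by rewrite ltr_pdivrMr ?(lt_le_trans _ r1)// mulrC -ltr_pdivrMr.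
Unshelve. all: end_near. Qed.

Lemma integral_lin3 (f1 f2 f3 : R -> R) a b c :
  mu.-integrable Rpos (EFin \o f1) -> mu.-integrable Rpos (EFin \o f2) ->
  mu.-integrable Rpos (EFin \o f3) ->
  mu.-integrable Rpos (EFin \o (fun r => a * f1 r + b * f2 r + c * f3 r)) /\
  \int[mu]_(r in Rpos) (a * f1 r + b * f2 r + c * f3 r) =
  a * \int[mu]_(r in Rpos) f1 r + b * \int[mu]_(r in Rpos) f2 r +
  c * \int[mu]_(r in Rpos) f3 r.
Proof.
move=> i1 i2 i3.
have j1 := @integrableZl _ _ R mu _ (measurable_itv _) a _ i1.
have j2 := @integrableZl _ _ R mu _ (measurable_itv _) b _ i2.
have j3 := @integrableZl _ _ R mu _ (measurable_itv _) c _ i3.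
have j12 := @integrableD _ _ R mu _ (measurable_itv _) _ _ j1 j2.
have j := @integrableD _ _ R mu _ (measurable_itv _) _ _ j12 j3.
split; first exact: j.
rewrite (@RintegralD _ _ R mu _ _ _ (measurable_itv _) j12 j3).
rewrite (@RintegralD _ _ R mu _ _ _ (measurable_itv _) j1 j2).
by rewrite !RintegralZl.
Qed.

(** The left side is the integral over r > 0 of the derivative of r^m exp(-r) cos(s r), whose limits
    at both ends are 0. *)
Lemma gcos_parts m s : 0 < m <= 1 ->
  m * gcos m s - gcos (m + 1) s - s * gsin (m + 1) s = 0.
Proof.
move=> /andP[m0 m1]; have m01 : 0 < m <= 1 by rewrite m0.
have m02 : 0 < m <= 2 by rewrite m0 (le_trans m1)// ler1n.
have m12 : 0 < m + 1 <= 2 by rewrite addr_gt0//= -lerBrDr (le_trans m1)//; lra.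
have [fi fE] := integral_lin3 m (-1) (- s)
  (integrable_gcos s m02) (integrable_gcos s m12) (integrable_gsin s m12).
have [h0 hy] := powR_expR_bounded_cvg0 m01 (fun r => cos_max (s * r)).
move: fi fE; set f := (X in EFin \o X) => fi fE.
suff dF : forall r, 0 < r ->
    is_derive r 1 (fun r => r `^ m * expR (- r) * cos (s * r)) (f r).
  have := integral_gt0_eq0 dF _ fi h0 hy; rewrite fE => <-.
    by rewrite /gcos /gsin mulN1r mulNr.
  by move=> r r0; rewrite /f; cont; exact: continuous_powR.
- move=> r r0.
  have d1 := is_derive1_powR m r0.
  have d2 : is_derive r 1 (fun y => expR (- y)) (expR (- r) * - 1).
    exact: (is_derive_comp (is_derive_expR _) (is_derive_opp r)).
  have d3 : is_derive r 1 (fun y => cos (s * y)) (- sin (s * r) * s).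
    apply: (is_derive_comp (is_derive_cos _)).
    by have := is_derive_scale s (is_derive_id1 r); rewrite mulr1.
  apply: is_derive_eq (is_derive_mul (is_derive_mul d1 d2) d3) _.
  by rewrite /f addrK; ring.
Qed.

Lemma gsin_parts m s : 0 < m <= 1 ->
  m * gsin m s - gsin (m + 1) s + s * gcos (m + 1) s = 0.
Proof.
move=> /andP[m0 m1]; have m01 : 0 < m <= 1 by rewrite m0.
have m02 : 0 < m <= 2 by rewrite m0 (le_trans m1)// ler1n.
have m12 : 0 < m + 1 <= 2 by rewrite addr_gt0//= -lerBrDr (le_trans m1)//; lra.
have [fi fE] := integral_lin3 m (-1) s
  (integrable_gsin s m02) (integrable_gsin s m12) (integrable_gcos s m12).
have [h0 hy] := powR_expR_bounded_cvg0 m01 (fun r => sin_max (s * r)).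
move: fi fE; set f := (X in EFin \o X) => fi fE.
suff dF : forall r, 0 < r ->
    is_derive r 1 (fun r => r `^ m * expR (- r) * sin (s * r)) (f r).
  have := integral_gt0_eq0 dF _ fi h0 hy; rewrite fE => <-.
    by rewrite /gcos /gsin mulN1r.
  by move=> r r0; rewrite /f; cont; exact: continuous_powR.
- move=> r r0.
  have d1 := is_derive1_powR m r0.
  have d2 : is_derive r 1 (fun y => expR (- y)) (expR (- r) * - 1).
    exact: (is_derive_comp (is_derive_expR _) (is_derive_opp r)).
  have d3 : is_derive r 1 (fun y => sin (s * y)) (cos (s * r) * s).
    apply: (is_derive_comp (is_derive_sin _)).
    by have := is_derive_scale s (is_derive_id1 r); rewrite mulr1.
  apply: is_derive_eq (is_derive_mul (is_derive_mul d1 d2) d3) _.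
  by rewrite /f addrK; ring.
Qed.

(* [gcos m s - i gsin m s = Gamma m (1 + i s)^(-m)]; only the argument matters *)
Lemma gcos_gsin_phase m s : 0 < m <= 1 -> exists E, [/\ 0 < E,
  gcos m s = E * cos (m * atan s) & gsin m s = E * sin (m * atan s)].
Proof.
move=> m01; have /andP[m0 m1] := m01.
have q0 x : 0 < 1 + x ^+ 2 by rewrite ltr_wpDr// sqr_ge0.
(* The two integrations by parts form a linear system of determinant 1 + x^2 for the integrals of
   index m+1. Since these are, up to sign, the derivatives of the integrals of index m, solving it
   gives a closed differential system. *)
have solve x (a b a1 b1 : R) : m * a - a1 - x * b1 = 0 -> m * b - b1 + x * a1 = 0 ->
    a1 = m * (a - x * b) / (1 + x ^+ 2) /\ b1 = m * (b + x * a) / (1 + x ^+ 2).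
  move=> h1 h2; have e1 : m * a = a1 + x * b1 by lra.
  have e2 : m * b = b1 - x * a1 by lra.
  have n0 : 1 + x ^+ 2 != 0 by rewrite gt_eqF.
  split; apply: (mulIf n0); rewrite divfK//.
    have -> : m * (a - x * b) = m * a - x * (m * b) by ring.
    by rewrite e1 e2; ring.
  have -> : m * (b + x * a) = m * b + x * (m * a) by ring.
  by rewrite e1 e2; ring.
have AB x := solve x _ _ _ _ (gcos_parts x m01) (gsin_parts x m01).
have A x := (AB x).1; have B x := (AB x).2.
pose rho x := (1 + x ^+ 2) `^ (m / 2).
have drho x : is_derive x 1 rho (m * x / (1 + x ^+ 2) * rho x).
  have d1 : is_derive x 1 (fun y => 1 + y ^+ 2) (2 * x).
    have := is_derive_add (is_derive_const 1 x) (is_derive_mul (is_derive_id1 x) (is_derive_id1 x)).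
    by move/is_derive_eq; apply; ring.
  have d2 := @is_derive_comp R (fun y => y `^ (m / 2)) (fun y => 1 + y ^+ 2) x _ _
    (is_derive1_powR (m / 2) (q0 x)) d1.
  apply: is_derive_eq d2 _.
  have m20 : 0 < m / 2 by rewrite divr_gt0.
  rewrite /rho -(mulr_powRB1 (ltW (q0 x)) m20).
  by move: (_ `^ _) (gt_eqF (q0 x)) => p /negbT n0; field.
have dps x : is_derive x 1 (fun y => m * atan y) (m * (1 + x ^+ 2)^-1).
  exact: (is_derive_scale m (is_derive1_atan x)).
have dc x := is_derive_comp (is_derive_cos _) (dps x).
have ds x := is_derive_comp (is_derive_sin _) (dps x).
have dgc x := is_derive_gcos x m01.
have dgs x := is_derive_gsin x m01.
(* As rho(x) exp(i m atan x) = (1 + i x)^m, the functions C and -D are the real and imaginary parts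
   of (gcos - i gsin)(1 + i x)^m. This product is constant and equals Gamma(m) at x = 0. *)
pose D x := rho x * (gsin m x * cos (m * atan x) - gcos m x * sin (m * atan x)).
pose C x := rho x * (gcos m x * cos (m * atan x) + gsin m x * sin (m * atan x)).
have dD x : is_derive x 1 D 0.
  have h := is_derive_mul (drho x) (is_derive_sub (is_derive_mul (dgs x) (dc x))
     (is_derive_mul (dgc x) (ds x))).
  apply: is_derive_eq h _; rewrite A B.
  move: (gcos m x) (gsin m x) (cos _) (sin _) (rho x) (gt_eqF (q0 x)) => a b k l p /negbT n0.
  by field.
have dC x : is_derive x 1 C 0.
  have h := is_derive_mul (drho x) (is_derive_add (is_derive_mul (dgc x) (dc x))
     (is_derive_mul (dgs x) (ds x))).
  apply: is_derive_eq h _; rewrite A B.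
  move: (gcos m x) (gsin m x) (cos _) (sin _) (rho x) (gt_eqF (q0 x)) => a b k l p /negbT n0.
  by field.
have gs0 : gsin m 0 = 0.
  rewrite /gsin; under eq_Rintegral do rewrite mul0r sin0 mulr0.
  by rewrite Rintegral_cst// mul0r.
have gc0 : gcos m 0 = Gamma m.
  by rewrite /gcos; under eq_Rintegral do rewrite mul0r cos0 mulr1.
have D0 : D s = 0.
  rewrite (@is_derive_0_is_cst _ D s 0) //.
  by rewrite /D atan0 mulr0 gs0 mul0r sin0 mulr0 subrr mulr0.
have C0 : C s = Gamma m.
  rewrite (@is_derive_0_is_cst _ C s 0) //.
  rewrite /C atan0 mulr0 gs0 gc0 sin0 cos0 mul0r addr0 mulr1.
  by rewrite /rho expr2 mulr0 addr0 powR1 mul1r.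
have r0 : 0 < rho s by rewrite powR_gt0.
exists (Gamma m / rho s); split.
- by rewrite divr_gt0// Gamma_gt0// m0 (le_trans m1)// ler1n.
- rewrite -C0 /C [rho s * _]mulrC mulfK ?gt_eqF//.
  move: D0 (cos2Dsin2 (m * atan s)) => /eqP; rewrite /D mulf_eq0 gt_eqF//= => /eqP.
  move: (gcos m s) (gsin m s) (cos _) (sin _) => a b k l e cs.
  rewrite -[LHS]mulr1 -cs; apply/eqP; rewrite -subr_eq0; apply/eqP.
  by transitivity (- l * (b * k - a * l)); [ring|rewrite e mulr0].
- rewrite -C0 /C [rho s * _]mulrC mulfK ?gt_eqF//.
  move: D0 (cos2Dsin2 (m * atan s)) => /eqP; rewrite /D mulf_eq0 gt_eqF//= => /eqP.
  move: (gcos m s) (gsin m s) (cos _) (sin _) => a b k l e cs.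
  rewrite -[LHS]mulr1 -cs; apply/eqP; rewrite -subr_eq0; apply/eqP.
  by transitivity (k * (b * k - a * l)); [ring|rewrite e mulr0].
Qed.

End phase.

(** * Positivity of the rotated Riemann-Liouville form *)

Section sector.
Context {R : realType}.
Notation mu := (@lebesgue_measure R).
Local Notation Rpos := (`](0 : R), +oo[%classic).
Local Notation I01 := (`[(0 : R), (1 : R)]%classic).
Local Notation I01o := (`[(0 : R), (1 : R)[%classic).
Implicit Types (F h v V : R -> R) (a b c m x M t s r T al : R).

Lemma sigma_finite_lebesgue_prod : sigma_finite setT (mu \x mu)%E.
Proof.
pose I n : set (measurableTypeR R) := `[- n%:R, n%:R]%classic.
exists (fun n => I n `*` I n).
  apply/esym; rewrite -subTset => -[x y] _.
  pose N := maxn (Num.bound `|x|) (Num.bound `|y|).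
  have hx : `|x| <= N%:R.
    by rewrite (le_trans (ltW (archi_boundP (normr_ge0 x))))// ler_nat leq_maxl.
  have hy : `|y| <= N%:R.
    by rewrite (le_trans (ltW (archi_boundP (normr_ge0 y))))// ler_nat leq_maxr.
  by exists N => //; split; rewrite /I/= in_itv/= -ler_norml.
move=> n; have mI : measurable (I n) by exact: measurable_itv.
split=> /=; first exact: (measurableX mI mI).
have muI : (lebesgue_measure (I n) < +oo)%E.
  rewrite /I lebesgue_measure_itv/=; case: ifP => _; last exact: ltry.
  by rewrite -EFinB ltry.
have muI0 : (0 <= lebesgue_measure (I n))%E by exact: measure_ge0.
rewrite product_measure1E//; apply: lte_mul_pinfty => //.
by rewrite ge0_fin_numE.
Qed.
(** Plane Lebesgue measure under its own name, so that it can carry the sigma-finite structure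
    required by [Rfubini] for the triple integral in r and (t, s). *)
Definition lebesgue_measure2 := (mu \x mu)%E.
HB.instance Definition _ := Measure.on lebesgue_measure2.
HB.instance Definition _ := @Measure_isSigmaFinite.Build _ _ _ lebesgue_measure2 sigma_finite_lebesgue_prod.

(** Substitution r -> r/t. With m = 1 - al it produces the kernel t^(al-1) out of damped
    oscillations in r t. *)
Lemma integrable_gamma_scale m t h : 0 < t -> 0 < m <= 2 -> measurable_fun setT h ->
  mu.-integrable Rpos (EFin \o (fun r => r `^ (m - 1) * h r)) ->
  mu.-integrable Rpos (EFin \o (fun r => r `^ (m - 1) * h (r * t))) /\
  \int[mu]_(r in Rpos) (r `^ (m - 1) * h (r * t)) =
  t `^ (- m) * \int[mu]_(r in Rpos) (r `^ (m - 1) * h r).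
Proof.
move=> t0 m02 mh hi.
have ti0 : t^-1 != 0 by rewrite invr_eq0 gt_eqF.
have pre : (fun x => t^-1 * x + 0) @^-1` Rpos = Rpos.
  by apply/seteqP; split=> x; rewrite /= !in_itv/= !andbT addr0 pmulr_rgt0// invr_gt0.
have mf : measurable_fun Rpos (fun r => r `^ (m - 1) * h (r * t)).
  apply: measurable_funM; first exact: measurable_powR_comp.
  by apply: (measurableT_comp mh); exact: measurable_funM.
have e x : 0 < x -> (t^-1 * x + 0) `^ (m - 1) * h ((t^-1 * x + 0) * t) =
    t `^ (1 - m) * (x `^ (m - 1) * h x).
  move=> x0; rewrite addr0 powRM ?invr_ge0 ?(ltW t0) ?(ltW x0)//.
  rewrite [t^-1 * x]mulrC divfK ?gt_eqF// mulrA; congr (_ * _ * _).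
  by rewrite -powR_inv1 ?(ltW t0)// -powRrM; congr powR; ring.
split.
  apply: (integrable_affine (b := 0) ti0) => //; rewrite pre.
  have := @integrableZl _ _ R mu _ (measurable_itv _) (t `^ (1 - m)) _ hi.
  apply: eq_integrable => // x; rewrite inE/= in_itv/= andbT => x0.
  by rewrite e.
rewrite (Rintegral_affine 0 ti0)// pre gtr0_norm ?invr_gt0//.
transitivity (t^-1 * \int[mu]_(x in Rpos) (t `^ (1 - m) * (x `^ (m - 1) * h x))).
  by congr (_ * _); apply: eq_Rintegral => x; rewrite inE/= in_itv/= andbT => /e.
rewrite RintegralZl// mulrA; congr (_ * _).
rewrite -[X in X * _]powR_inv1 ?(ltW t0)// -powRD; last by rewrite (gt_eqF t0) implybT.
by congr powR; ring.
Qed.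

Section rect.
Variables (al T : R).
Hypotheses (al01 : 0 < al < 1) (T0 : 0 < T).
Local Notation Dt := (`](0 : R), T]%classic).

Let al01' : 0 < al <= 1. Proof. by case/andP: al01 => -> /ltW. Qed.

Let int_kernel_o c : mu.-integrable I01o (EFin \o (fun s => c * (1 - s) `^ (al - 1))).
Proof.
have := @integrableZl _ _ R mu _ (measurable_itv _) c _ (integrable_kernel al01').
by apply: integrableS => //; apply: subset_itvl; rewrite bnd_simp.
Qed.

Let int_cst c : mu.-integrable Dt (EFin \o (fun=> c)).
Proof.
have : mu.-integrable `[0, T] (EFin \o (fun=> c)).
  by apply: continuous_integrable => x _; exact: continuous_for_cst.
by apply: integrableS => //; apply: subset_itvr; rewrite bnd_simp.
Qed.

(** The majorant c (1-s)^(al-1) is integrable on the rectangle. The side s = 1 is excluded because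
    the lag t(1-s) has to stay positive later. *)
Lemma rect_fubini (f : R * R -> R) c : measurable_fun setT f -> 0 <= c ->
  (forall t s, 0 < t <= T -> 0 <= s < 1 -> `|f (t, s)| <= c * (1 - s) `^ (al - 1)) ->
  (mu \x mu)%E.-integrable (Dt `*` I01o) (EFin \o f) /\
  \int[(mu \x mu)%E]_(z in Dt `*` I01o) f z =
  \int[mu]_(t in Dt) \int[mu]_(s in I01o) f (t, s).
Proof.
move=> mf c0 fc.
have h1 t : Dt t -> mu.-integrable I01o (fun s => (f (t, s))%:E).
  rewrite /= in_itv/= => t0.
  apply: (dominated_integrable _ _ (int_kernel_o c)) => //.
    by apply: measurable_funTS; exact: measurableT_comp.
  by move=> s; rewrite /= in_itv/=; exact: fc.
have h2 s : I01o s -> mu.-integrable Dt (fun t => (f (t, s))%:E).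
  rewrite /= in_itv/= => s0.
  apply: (dominated_integrable _ _ (int_cst (c * (1 - s) `^ (al - 1)))) => //.
    by apply: measurable_funTS; exact: measurableT_comp.
  by move=> t; rewrite /= in_itv/= => t0; exact: fc.
have h3 := int_kernel_o (c * T).
have h4 s : I01o s -> \int[mu]_(t in Dt) `|f (t, s)| <= c * T * (1 - s) `^ (al - 1).
  move=> s0; move: (s0); rewrite /= in_itv/= => s1.
  apply: (@le_trans _ _ (\int[mu]_(t in Dt) (c * (1 - s) `^ (al - 1)))).
    apply: le_Rintegral => //.
    - exact: (integrable_norm (h2 _ s0)).
    - by move=> t; rewrite /= in_itv/= => t0; exact: fc.
  rewrite Rintegral_cst// [X in _ * fine X](_ : _ = (lebesgue_measure Dt))//.
  by rewrite lebesgue_measure_itv/= lte_fin T0 -EFinB/= subr0 mulrAC.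
split.
  exact: (@Rfubini_integrable_prod _ _ _ _ R mu mu _ _ f _ (measurable_itv _) (measurable_itv _) mf h2 h3 h4).
exact: (@Rfubini_prod _ _ _ _ R mu mu _ _ f _ (measurable_itv _) (measurable_itv _) mf h1 h2 h3 h4).
Qed.

Variables (v1 v2 : R -> R) (sg : R).
Hypotheses (cv1 : continuous v1) (cv2 : continuous v2).

(** With v = v1 + i v2 and z = (t, s), [P + i Q] is v(ts) conj(v(t)). *)
Let P (z : R * R) := v1 (z.1 * z.2) * v1 z.1 + v2 (z.1 * z.2) * v2 z.1.
Let Q (z : R * R) := v2 (z.1 * z.2) * v1 z.1 - v1 (z.1 * z.2) * v2 z.1.
Let H1 x := expR (- x) * cos (sg * x).
Let H2 x := expR (- x) * sin (sg * x).
Let tau (z : R * R) := z.1 * (1 - z.2).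
(** Since [H1 - i H2] at x is exp(-(1 + i sg) x), this is r^(-al) times the real part of v(ts)
    conj(v(t)) exp(-(1 + i sg) r t(1-s)), with the Jacobian t of tau = t s. *)
Let ker (r : R) (z : R * R) := r `^ ((1 - al) - 1) *
  (z.1 * (P z * H1 (r * tau z) + Q z * H2 (r * tau z))).

Let cH1 : continuous H1. Proof. rewrite /H1; cont. Qed.
Let cH2 : continuous H2. Proof. rewrite /H2; cont. Qed.

Let mcomp d (Z : measurableType d) (g : R -> R) (k : Z -> R) :
  continuous g -> measurable_fun setT k -> measurable_fun setT (fun z => g (k z)).
Proof. by move=> cg mk; exact: (measurableT_comp (continuous_measurable_fun cg) mk). Qed.

Let m1mul : measurable_fun setT (fun z : R * R => z.1 * z.2).
Proof. exact: measurable_funM. Qed.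

Let mP : measurable_fun setT P.
Proof.
by apply: measurable_funD; apply: measurable_funM; apply: mcomp.
Qed.

Let mQ : measurable_fun setT Q.
Proof.
by apply: measurable_funB; apply: measurable_funM; apply: mcomp.
Qed.

Let mtau : measurable_fun setT tau.
Proof. by apply: measurable_funM => //; apply: measurable_funB. Qed.

Let mker : measurable_fun setT (fun w : R * (R * R) => ker w.1 w.2).
Proof.
have m2 (g : R * R -> R) : measurable_fun setT g ->
    measurable_fun setT (fun w : R * (R * R) => g w.2).
  by move=> mg; exact: (measurableT_comp mg measurable_snd).
have mt : measurable_fun setT (fun w : R * (R * R) => w.1 * tau w.2).
  by apply: measurable_funM => //; exact: m2.
apply: measurable_funM; first exact: measurable_powR_comp.
apply: measurable_funM; first exact: (m2 fst).
by apply: measurable_funD; apply: measurable_funM; [exact: m2|exact: mcomp|exact: m2|exact: mcomp].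
Qed.

Let Pbound : exists M, 0 <= M /\ forall t s, 0 < t <= T -> 0 <= s < 1 ->
  `|P (t, s)| <= M /\ `|Q (t, s)| <= M.
Proof.
have [M1 [M10 hM1]] := continuous_bounded T cv1.
have [M2 [M20 hM2]] := continuous_bounded T cv2.
exists (M1 * M1 + M2 * M2 + M2 * M1 + M1 * M2); split.
  by rewrite !addr_ge0// mulr_ge0.
move=> t s /andP[t0 tT] /andP[s0 s1].
have tt : 0 <= t <= T by rewrite ltW.
have ts : 0 <= t * s <= T.
  by rewrite mulr_ge0 ?(ltW t0)//= (le_trans _ tT)// ler_piMr ?(ltW t0)// ltW.
have a := hM1 _ tt; have b := hM1 _ ts; have c := hM2 _ tt; have d := hM2 _ ts.
have ab : `|v1 (t * s) * v1 t| <= M1 * M1 by rewrite normrM ler_pM.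
have cd : `|v2 (t * s) * v2 t| <= M2 * M2 by rewrite normrM ler_pM.
have da : `|v2 (t * s) * v1 t| <= M2 * M1 by rewrite normrM ler_pM.
have bc : `|v1 (t * s) * v2 t| <= M1 * M2 by rewrite normrM ler_pM.
have n1 := normr_ge0 (v1 (t * s) * v1 t); have n2 := normr_ge0 (v2 (t * s) * v2 t).
have n3 := normr_ge0 (v2 (t * s) * v1 t); have n4 := normr_ge0 (v1 (t * s) * v2 t).
rewrite /P /Q /=; split.
  by apply: le_trans (ler_normD _ _) _; lra.
by apply: le_trans (ler_normB _ _) _; lra.
Qed.

Let H1le x : `|H1 x| <= expR (- x).
Proof. by rewrite /H1 normrM ger0_norm ?expR_ge0// ler_piMr ?expR_ge0// cos_max. Qed.

Let H2le x : `|H2 x| <= expR (- x).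
Proof. by rewrite /H2 normrM ger0_norm ?expR_ge0// ler_piMr ?expR_ge0// sin_max. Qed.

Let m01 : 0 < 1 - al <= 1.
Proof. by case/andP: al01 => a0 a1; rewrite subr_gt0 a1 gerBl ltW. Qed.
Let m02 : 0 < 1 - al <= 2.
Proof. by case/andP: m01 => -> h; rewrite (le_trans h) ?ler1n. Qed.

Let iH1 : mu.-integrable Rpos (EFin \o (fun r => r `^ ((1 - al) - 1) * H1 r)).
Proof.
have := integrable_gcos sg m02; apply: eq_integrable => // x _ /=.
by rewrite /H1 mulrA.
Qed.

Let iH2 : mu.-integrable Rpos (EFin \o (fun r => r `^ ((1 - al) - 1) * H2 r)).
Proof.
have := integrable_gsin sg m02; apply: eq_integrable => // x _ /=.
by rewrite /H2 mulrA.
Qed.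

Let tau_gt0 t s : 0 < t <= T -> 0 <= s < 1 -> 0 < tau (t, s).
Proof.
by move=> /andP[t0 _] /andP[_ s1]; rewrite /tau/= mulr_gt0// subr_gt0.
Qed.

(** Integrating [r] out turns the superposition of damped oscillations into the fractional kernel
    times the complex constant gcos - i gsin. *)
Let ker_r t s : 0 < t <= T -> 0 <= s < 1 ->
  mu.-integrable Rpos (EFin \o (fun r => ker r (t, s))) /\
  \int[mu]_(r in Rpos) ker r (t, s) = t `^ al * (1 - s) `^ (al - 1) *
   (P (t, s) * gcos (1 - al) sg + Q (t, s) * gsin (1 - al) sg).
Proof.
move=> tT s1; have t0 : 0 < t by case/andP: tT.
have tau0 := tau_gt0 tT s1.
have [i1 e1] := integrable_gamma_scale tau0 m02 (continuous_measurable_fun cH1) iH1.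
have [i2 e2] := integrable_gamma_scale tau0 m02 (continuous_measurable_fun cH2) iH2.
have [i3 e3] := integral_lin3 (t * P (t, s)) (t * Q (t, s)) 0 i1 i2 i2.
have kE r : ker r (t, s) = t * P (t, s) * (r `^ ((1 - al) - 1) * H1 (r * tau (t, s))) +
    t * Q (t, s) * (r `^ ((1 - al) - 1) * H2 (r * tau (t, s))) +
    0 * (r `^ ((1 - al) - 1) * H2 (r * tau (t, s))).
  by rewrite /ker/=; ring.
split; first by apply: eq_integrable i3 => // r _ /=; rewrite kE.
under eq_Rintegral do rewrite kE.
rewrite e3 e1 e2.
have -> : \int[mu]_(r in Rpos) (r `^ ((1 - al) - 1) * H1 r) = gcos (1 - al) sg.
  by apply: eq_Rintegral => r _; rewrite /H1 mulrA.
have -> : \int[mu]_(r in Rpos) (r `^ ((1 - al) - 1) * H2 r) = gsin (1 - al) sg.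
  by apply: eq_Rintegral => r _; rewrite /H2 mulrA.
have -> : tau (t, s) `^ (- (1 - al)) = t `^ (al - 1) * (1 - s) `^ (al - 1).
  rewrite /tau/= opprB powRM ?(ltW t0)// subr_ge0.
  by case/andP: s1 => _ /ltW.
rewrite -(mulr_powRB1 (ltW t0) (_ : 0 < al)); last by case/andP: al01.
move: (gcos _ _) (gsin _ _) (_ `^ _) (_ `^ _) (P _) (Q _) => *; ring.
Qed.

Let ker_le M r t s : 0 < t <= T -> 0 <= s < 1 ->
  `|P (t, s)| <= M -> `|Q (t, s)| <= M ->
  `|ker r (t, s)| <= t * (2 * M) * (r `^ ((1 - al) - 1) * expR (- (r * tau (t, s)))).
Proof.
move=> /andP[t0 tT] s1 PM QM.
rewrite /ker normrM ger0_norm ?powR_ge0//.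
have -> : t * (2 * M) * (r `^ ((1 - al) - 1) * expR (- (r * tau (t, s)))) =
  r `^ ((1 - al) - 1) * (t * (2 * M * expR (- (r * tau (t, s))))) by ring.
rewrite ler_wpM2l ?powR_ge0// normrM -[(t, s).1]/t (gtr0_norm t0) ler_wpM2l ?(ltW t0)//.
apply: le_trans (ler_normD _ _) _; rewrite (normrM (P _)) (normrM (Q _)).
have -> : 2 * M = M + M by ring.
by rewrite mulrDl lerD// ler_pM// ?H1le ?H2le.
Qed.

(** Lets a bound independent of [s] be used as a majorant in [rect_fubini]. *)
Let one_le_kernel s : 0 <= s < 1 -> 1 <= (1 - s) `^ (al - 1).
Proof.
case/andP: al01 => a0 a1 /andP[s0 s1].
by rewrite -[leLHS](powRr0 (1 - s)); apply: ger_powR; lra.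
Qed.

Let ker_z r : 0 < r ->
  (mu \x mu)%E.-integrable (Dt `*` I01o) (fun z => (ker r z)%:E) /\
  \int[(mu \x mu)%E]_(z in Dt `*` I01o) ker r z =
  \int[mu]_(t in Dt) \int[mu]_(s in I01o) ker r (t, s).
Proof.
move=> r0; have [M [M0 hM]] := Pbound.
apply: (@rect_fubini (ker r) (T * (2 * M) * r `^ ((1 - al) - 1))).
- exact: (measurableT_comp mker (pair1_measurable r)).
- by rewrite !mulr_ge0 ?powR_ge0// ltW.
- move=> t s tT s1; have [PM QM] := hM t s tT s1.
  apply: le_trans (ker_le r tT s1 PM QM) _.
  case/andP: (tT) => t0 tT'.
  rewrite mulrA; apply: ler_pM; rewrite ?mulr_ge0 ?powR_ge0 ?expR_ge0 ?(ltW t0)//.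
    by rewrite ler_wpM2r ?powR_ge0// ler_wpM2r// mulr_ge0.
  apply: le_trans (one_le_kernel s1).
  by rewrite -expR0 ler_expR oppr_le0 mulr_ge0 ?(ltW r0) ?(ltW (tau_gt0 _ _)).
Qed.

(** Replacing the oscillation by 1 leaves a Gamma integral in [r], whose value is a multiple of t^al
    (1-s)^(al-1). This is the majorant for exchanging [r] with (t, s). *)
Let dom_int : exists g : R * R -> R,
  (mu \x mu)%E.-integrable (Dt `*` I01o) (EFin \o g) /\
  forall z, (Dt `*` I01o) z -> \int[mu]_(r in Rpos) `|ker r z| <= g z.
Proof.
have [M [M0 hM]] := Pbound.
pose G := Gamma (1 - al).
have G0 : 0 < G by exact: Gamma_gt0.
pose g z : R := 2 * M * G * (z.1 `^ al * (1 - z.2) `^ (al - 1)).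
have a0 : 0 < al by case/andP: al01.
exists g; split.
  apply: (@rect_fubini g (2 * M * G * T `^ al) _ _ _).1.
  - apply: measurable_funM => //; apply: measurable_funM; apply: measurable_powR_comp => //.
    exact: measurable_funB.
  - by rewrite !mulr_ge0 ?powR_ge0// ltW.
  - move=> t s /andP[t0 tT] s1; rewrite /g/= ger0_norm ?mulr_ge0 ?powR_ge0 ?(ltW G0)//.
    rewrite -[leRHS]mulrA ler_wpM2l ?mulr_ge0 ?(ltW G0)// ler_wpM2r ?powR_ge0//.
    by apply: ge0_ler_powR; rewrite ?nnegrE ?(ltW a0) ?(ltW t0) ?(ltW T0).
case=> t s [] /=; rewrite !in_itv/= => tT s1.
have [PM QM] := hM t s tT s1.
have tau0 := tau_gt0 tT s1; have t0 : 0 < t by case/andP: tT.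
have cE : continuous (fun x : R => expR (- x)) by cont.
have [i1 e1] := integrable_gamma_scale tau0 m02 (continuous_measurable_fun cE) (integrable_gamma m02).
have ig := @integrableZl _ _ R mu _ (measurable_itv _) (t * (2 * M)) _ i1.
apply: (@le_trans _ _ (\int[mu]_(r in Rpos) (t * (2 * M) * (r `^ ((1 - al) - 1) * expR (- (r * tau (t, s))))))).
  apply: le_Rintegral => //.
    exact: (integrable_norm (ker_r tT s1).1).
  by move=> r _; exact: ker_le.
rewrite RintegralZl// e1 -[X in _ * (_ * X)]/G /g/=.
have -> : tau (t, s) `^ (- (1 - al)) = t `^ (al - 1) * (1 - s) `^ (al - 1).
  rewrite /tau/= opprB powRM ?(ltW t0)// subr_ge0.
  by case/andP: s1 => _ /ltW.
rewrite -(mulr_powRB1 (ltW t0) a0).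
rewrite le_eqVlt; apply/orP; left; apply/eqP.
by move: (_ `^ _) (_ `^ _) => *; ring.
Qed.

Let sector_fubini :
  \int[mu]_(r in Rpos) \int[mu]_(t in Dt) \int[mu]_(s in I01o) ker r (t, s) =
  \int[mu]_(t in Dt) \int[mu]_(s in I01o) (t `^ al * (1 - s) `^ (al - 1) *
   (P (t, s) * gcos (1 - al) sg + Q (t, s) * gsin (1 - al) sg)).
Proof.
have [g [gi gk]] := dom_int.
have h1 r : Rpos r -> (mu \x mu)%E.-integrable (Dt `*` I01o) (fun z => (ker r z)%:E).
  by rewrite /= in_itv/= andbT => r0; exact: (ker_z r0).1.
have h2 z : (Dt `*` I01o) z -> mu.-integrable Rpos (fun r => (ker r z)%:E).
  by case: z => t s []; rewrite /= !in_itv/= => tT s1; exact: (ker_r tT s1).1.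
have mD2 : measurable (Dt `*` I01o : set (measurableTypeR R * measurableTypeR R)).
  by apply: measurableX; exact: measurable_itv.
have := @Rfubini _ _ _ _ R mu lebesgue_measure2 Rpos (Dt `*` I01o)
  (fun w => ker w.1 w.2) g (measurable_itv _) mD2 mker h1 h2 gi gk.
rewrite /= => e.
transitivity (\int[mu]_(x in Rpos) \int[lebesgue_measure2]_(y in Dt `*` I01o) ker x y).
  apply: eq_Rintegral => r; rewrite inE/= in_itv/= andbT => r0.
  by rewrite -(ker_z r0).2.
rewrite e {e}.
have [M [M0 hM]] := Pbound.
pose a := gcos (1 - al) sg; pose b := gsin (1 - al) sg.
pose phi (z : R * R) : R := z.1 `^ al * (1 - z.2) `^ (al - 1) * (P z * a + Q z * b).
rewrite -(@rect_fubini phi (T `^ al * (M * (`|a| + `|b|))) _ _ _).2.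
- apply: eq_Rintegral => -[t s]; rewrite inE /= !in_itv/= => -[tT s1].
  exact: (ker_r tT s1).2.
- apply: measurable_funM.
    apply: measurable_funM; apply: measurable_powR_comp => //; exact: measurable_funB.
  by apply: measurable_funD; apply: measurable_funM.
- by rewrite !mulr_ge0 ?powR_ge0 ?addr_ge0.
- move=> t s tT s1; have [PM QM] := hM t s tT s1.
  have a0 : 0 <= al by case/andP: al01 => /ltW.
  case/andP: (tT) => t0 tT'.
  rewrite /phi normrM normrM !(ger0_norm (powR_ge0 _ _)) mulrAC ler_wpM2r ?powR_ge0//.
  apply: ler_pM; rewrite ?powR_ge0//.
    by apply: ge0_ler_powR; rewrite ?nnegrE ?(ltW t0) ?(ltW T0).
  apply: le_trans (ler_normD _ _) _; rewrite mulrDr !normrM.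
  by rewrite lerD// ler_wpM2r.
Qed.

Let Wint_o m (h : R -> R) : 0 < m <= 1 -> continuous h ->
  \int[mu]_(s in I01o) ((1 - s) `^ (m - 1) * h s) = Wint m h.
Proof.
move=> m0 ch; rewrite Rintegral_itv_bndo_bndc//.
have := integrable_Wint_cont m0 ch.
by apply: integrableS => //; apply: subset_itvl; rewrite bnd_simp.
Qed.

Let prim_o (g : R -> R) : continuous g -> \int[mu]_(t in Dt) g t = prim g T.
Proof.
move=> cg; rewrite primE ?(ltW T0)// Rintegral_itv_obnd_cbnd//.
have : mu.-integrable `[0, T] (EFin \o g).
  by apply: continuous_integrable => x _; exact: cg.
by apply: integrableS => //; apply: subset_itvr; rewrite bnd_simp.
Qed.

Let one01 : 0 < (1:R) <= 1. Proof. by rewrite ltr01 lexx. Qed.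

(** For fixed [r] the oscillating factor is absorbed into the modulated function V = exp(i sg r u)
    v(u). The real and imaginary parts [V1], [V2] then contribute one form of [exp_kernel_ge0]
    each. *)
Let ker_ge0 r : 0 < r ->
  0 <= \int[mu]_(t in Dt) \int[mu]_(s in I01o) ker r (t, s).
Proof.
move=> r0.
pose V1 u := cos (sg * (r * u)) * v1 u - sin (sg * (r * u)) * v2 u.
pose V2 u := sin (sg * (r * u)) * v1 u + cos (sg * (r * u)) * v2 u.
have cV1 : continuous V1 by rewrite /V1; cont.
have cV2 : continuous V2 by rewrite /V2; cont.
pose Y (V : R -> R) := prim (fun s => expR (r * s) * V s).
have cY V : continuous V -> continuous (Y V).
  by move=> cV; apply: continuous_prim; cont.
pose c := r `^ ((1 - al) - 1).
have c0 : 0 <= c by exact: powR_ge0.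
pose N V t := V t * (expR (- (r * t)) * Y V t).
have cN V : continuous V -> continuous (N V).
  by move=> cV; have := cY V cV => cYV; rewrite /N; cont.
have e t : Dt t -> \int[mu]_(s in I01o) ker r (t, s) = c * (N V1 t + N V2 t).
  rewrite /= in_itv/= => /andP[t0 _].
  have ch V : continuous V -> continuous (fun s => expR (r * (t * s)) * V (t * s)).
    by move=> cV; cont.
  transitivity (Wint 1 (fun s => c * t * V1 t * expR (- (r * t)) * (expR (r * (t * s)) * V1 (t * s))
      + c * t * V2 t * expR (- (r * t)) * (expR (r * (t * s)) * V2 (t * s)))).
    rewrite -Wint_o//; last by cont.
    apply: eq_Rintegral => s _; rewrite subrr powRr0 mul1r /ker /P /Q /H1 /H2 /tau /V1 /V2 /=.
    have -> : expR (- (r * (t * (1 - s)))) = expR (- (r * t)) * expR (r * (t * s)).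
      by rewrite -expRD; congr expR; ring.
    have -> : sg * (r * (t * (1 - s))) = sg * (r * t) - sg * (r * (t * s)) by ring.
    rewrite cosB sinB -/c.
    move: (expR _) (expR _) (cos _) (cos _) (sin _) (sin _) (v1 t) (v2 t) (v1 _) (v2 _) => *.
    by ring.
  rewrite Wint_lin//; try exact: ch.
  rewrite /N /Y /prim /RLk ppowE ?(ltW t0)// powRr1 ?(ltW t0)//.
  by move: (Wint _ _) (Wint _ _) (expR _) (V1 t) (V2 t) => *; ring.
have -> : \int[mu]_(t in Dt) \int[mu]_(s in I01o) ker r (t, s) =
    \int[mu]_(t in Dt) (c * (N V1 t + N V2 t)).
  by apply: eq_Rintegral => t; rewrite inE; exact: e.
have cN1 := cN _ cV1; have cN2 := cN _ cV2.
rewrite prim_o; last by cont.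
have -> : prim (fun t => c * (N V1 t + N V2 t)) T = c * prim (N V1) T + c * prim (N V2) T.
  have := RLk_lin c c T one01 cN1 cN2; rewrite -/(prim _ _) => <-.
  by congr prim; apply/funext => t; rewrite mulrDr.
by rewrite addr_ge0// mulr_ge0//; apply: exp_kernel_ge0 => //; exact: ltW.
Qed.

(** After the integration over [r] is moved outside by [sector_fubini], the integrand in [r] is
    nonnegative by [ker_ge0]. *)
Lemma sector_ge0 : 0 <= prim (fun t =>
  gcos (1 - al) sg * (RLk al v1 t * v1 t + RLk al v2 t * v2 t) +
  gsin (1 - al) sg * (RLk al v2 t * v1 t - RLk al v1 t * v2 t)) T.
Proof.
have cw1 := continuous_RLk al01' cv1; have cw2 := continuous_RLk al01' cv2.
set H := (X in prim X T).
have -> : prim H T = \int[mu]_(t in Dt) \int[mu]_(s in I01o) (t `^ al * (1 - s) `^ (al - 1) *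
   (P (t, s) * gcos (1 - al) sg + Q (t, s) * gsin (1 - al) sg)).
  rewrite -prim_o; last by rewrite /H; cont.
  apply: eq_Rintegral => t; rewrite inE /= in_itv/= => /andP[t0 _].
  rewrite /H; move: (gcos _ _) (gsin _ _) => a b.
  transitivity (Wint al (fun s => t `^ al * (a * v1 t - b * v2 t) * v1 (t * s)
      + t `^ al * (a * v2 t + b * v1 t) * v2 (t * s))).
    rewrite Wint_lin//; try exact: continuous_scaler.
    rewrite /RLk ppowE ?(ltW t0)//.
    by move: (Wint _ _) (Wint _ _) (t `^ _) (v1 t) (v2 t) => *; ring.
  rewrite -Wint_o//; last by cont.
  apply: eq_Rintegral => s _; rewrite /P /Q /=.
  by move: (_ `^ _) (_ `^ _) (v1 t) (v2 t) (v1 _) (v2 _) => *; ring.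
rewrite -sector_fubini; apply: Rintegral_ge0 => r.
by rewrite /= in_itv/= andbT; exact: ker_ge0.
Qed.

End rect.

(** For v = v1 + i v2 the integrand is the real part of exp(-i psi) (I v) conj(v). It is
    [sector_ge0] with the positive modulus of the complex constant divided out. *)
Lemma sector_positivity al psi v1 v2 T : 0 < al < 1 ->
  `|psi| < (1 - al) * (pi / 2) -> continuous v1 -> continuous v2 -> 0 <= T ->
  0 <= prim (fun t =>
    cos psi * (RLk al v1 t * v1 t + RLk al v2 t * v2 t) +
    sin psi * (RLk al v2 t * v1 t - RLk al v1 t * v2 t)) T.
Proof.
move=> al01 hpsi cv1 cv2; rewrite le_eqVlt => /predU1P[<-|T0]; first by rewrite prim0.
have /andP[a0 a1] := al01.
have m0 : 0 < 1 - al by rewrite subr_gt0.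
have m01 : 0 < 1 - al <= 1 by rewrite m0 gerBl ltW.
(* This [sg] makes the phase (1-al) atan sg equal to psi; the bound on psi keeps psi/(1-al) inside
   ]-pi/2, pi/2[. *)
pose sg := tan (psi / (1 - al)).
have [E [E0 e1 e2]] := gcos_gsin_phase sg m01.
have asg : (1 - al) * atan sg = psi.
  rewrite /sg tanK; first by rewrite mulrC divfK// gt_eqF.
  rewrite in_itv/= ltr_pdivrMr// ltr_pdivlMr// mulNr (mulrC (pi / 2)).
  by rewrite -ltr_norml.
rewrite asg in e1 e2.
have := sector_ge0 al01 T0 sg cv1 cv2; rewrite e1 e2.
set G := (X in prim X T).
have al01' : 0 < al <= 1 by rewrite a0 ltW.
have cw1 := continuous_RLk al01' cv1; have cw2 := continuous_RLk al01' cv2.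
pose H t := cos psi * (RLk al v1 t * v1 t + RLk al v2 t * v2 t) +
    sin psi * (RLk al v2 t * v1 t - RLk al v1 t * v2 t).
have cH : continuous H by rewrite /H; cont.
have c0 : continuous ((fun=> 0) : R -> R) by cont.
have -> : prim G T = E * prim H T.
  have := @RLk_lin R 1 H (fun=> 0) E 0 T _ cH c0; rewrite ltr01 lexx => /(_ isT).
  rewrite [0 * RLk _ _ _]mul0r addr0 -/(prim _ _) => <-.
  by congr prim; apply/funext => t; rewrite /G /H /=; ring.
by rewrite (pmulr_rge0 _ E0).
Qed.

End sector.

(** * Energy estimate for a scalar complex equation *)

Section energy.
Context {R : realType}.
Implicit Types (F f g h v V : R -> R) (a b c m x M t s r T al : R).

Let one01 : 0 < (1:R) <= 1. Proof. by rewrite ltr01 lexx. Qed.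

Lemma ler_prim f g T : continuous f -> continuous g ->
  (forall s, 0 <= s <= T -> f s <= g s) -> prim f T <= prim g T.
Proof. by move=> cf cg fg; exact: ler_RLk. Qed.

Lemma prim_lin f g b c T : continuous f -> continuous g ->
  prim (fun s => b * f s + c * g s) T = b * prim f T + c * prim g T.
Proof. by move=> cf cg; exact: RLk_lin. Qed.

Lemma prim_scale f b T : continuous f -> prim (fun s => b * f s) T = b * prim f T.
Proof.
move=> cf; have := prim_lin b 0 T cf cf.
rewrite [0 * prim _ _]mul0r addr0 => <-.
by congr prim; apply/funext => t; rewrite mul0r addr0.
Qed.

Lemma prim_add f g T : continuous f -> continuous g ->
  prim (fun s => f s + g s) T = prim f T + prim g T.
Proof.
move=> cf cg; have := prim_lin 1 1 T cf cg; rewrite !mul1r => <-.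
by congr prim; apply/funext => t; rewrite !mul1r.
Qed.

Lemma eq_prim f g T : continuous f -> continuous g ->
  (forall s, 0 <= s <= T -> f s = g s) -> prim f T = prim g T.
Proof.
by move=> cf cg fg; apply/eqP; rewrite eq_le; apply/andP; split;
  apply: ler_prim => // s /fg ->.
Qed.

(** Weighted Young inequality for the real part of exp(-i psi) a conj(b): the difference of the two
    sides is |e a - exp(i psi) b|^2 / (2 e). *)
Lemma rotated_young psi e (a1 a2 b1 b2 : R) : 0 < e ->
  cos psi * (a1 * b1 + a2 * b2) + sin psi * (a2 * b1 - a1 * b2) <=
  e / 2 * (a1 ^+ 2 + a2 ^+ 2) + (2 * e)^-1 * (b1 ^+ 2 + b2 ^+ 2).
Proof.
move=> e0.
have cs := cos2Dsin2 psi; move: (cos psi) (sin psi) cs => c s cs.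
rewrite -subr_ge0.
have -> : e / 2 * (a1 ^+ 2 + a2 ^+ 2) + (2 * e)^-1 * (b1 ^+ 2 + b2 ^+ 2) -
    (c * (a1 * b1 + a2 * b2) + s * (a2 * b1 - a1 * b2)) =
  (2 * e)^-1 * ((e * a1 - (c * b1 - s * b2)) ^+ 2 + (e * a2 - (c * b2 + s * b1)) ^+ 2).
  have -> : (2 * e)^-1 * (b1 ^+ 2 + b2 ^+ 2) = (2 * e)^-1 * ((c ^+ 2 + s ^+ 2) * (b1 ^+ 2 + b2 ^+ 2)).
    by rewrite cs mul1r.
  by field; rewrite gt_eqF.
by rewrite mulr_ge0 ?addr_ge0 ?sqr_ge0// invr_ge0 mulr_ge0// ltW.
Qed.

(** Put lam = la + i lb and v = lam u + h, so that u - g = kap I v. Positivity of the rotated form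
    of v contains the term -c |u|^2 with c = - Re(exp(i psi) lam) > 0, and Young's inequality
    absorbs all other occurrences of u. The constant depends on neither [T] nor the data. *)
Lemma scalar_energy_psi al kap psi la lb : 0 < al < 1 -> 0 < kap ->
  `|psi| < (1 - al) * (pi / 2) -> 0 < sin psi * lb - cos psi * la ->
  exists C, 0 < C /\ forall T u1 u2 g1 g2 h1 h2, 0 <= T ->
  continuous u1 -> continuous u2 -> continuous g1 -> continuous g2 ->
  continuous h1 -> continuous h2 ->
  (forall t, 0 <= t <= T ->
     u1 t = g1 t + kap * RLk al (fun s => la * u1 s - lb * u2 s + h1 s) t) ->
  (forall t, 0 <= t <= T ->
     u2 t = g2 t + kap * RLk al (fun s => lb * u1 s + la * u2 s + h2 s) t) ->
  prim (fun t => u1 t ^+ 2 + u2 t ^+ 2) T <=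
  C * prim (fun t => (g1 t ^+ 2 + g2 t ^+ 2) + (h1 t ^+ 2 + h2 t ^+ 2)) T.
Proof.
move=> al01 kap0 hpsi; set c := sin psi * lb - cos psi * la => c0.
have al01' : 0 < al <= 1 by case/andP: al01 => -> /ltW.
pose L := la ^+ 2 + lb ^+ 2 + 1.
have L0 : 0 < L by rewrite ltr_wpDl// addr_ge0 ?sqr_ge0.
(* Chosen so that (e/2)|v|^2 costs only (c/4)|u|^2; with the other (c/4)|u|^2 from the product of u
   and h, the coefficient -c becomes -c/2. *)
pose e := c / (4 * L).
have e0 : 0 < e by rewrite divr_gt0// mulr_gt0.
pose K := c^-1 + e + (2 * e)^-1.
have K0 : 0 < K by rewrite !addr_gt0 ?invr_gt0// mulr_gt0.
exists (2 / c * K); split; first by rewrite mulr_gt0// divr_gt0.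
move=> T u1 u2 g1 g2 h1 h2 T0 cu1 cu2 cg1 cg2 ch1 ch2 eu1 eu2.
pose v1 s := la * u1 s - lb * u2 s + h1 s.
pose v2 s := lb * u1 s + la * u2 s + h2 s.
have cv1 : continuous v1 by rewrite /v1; cont.
have cv2 : continuous v2 by rewrite /v2; cont.
have cw1 := continuous_RLk al01' cv1; have cw2 := continuous_RLk al01' cv2.
have := sector_positivity al01 hpsi cv1 cv2 T0.
set S := (X in prim X T) => S0.
have cS : continuous S by rewrite /S; cont.
pose U t := u1 t ^+ 2 + u2 t ^+ 2.
pose G t := (g1 t ^+ 2 + g2 t ^+ 2) + (h1 t ^+ 2 + h2 t ^+ 2).
have cU : continuous U by rewrite /U; cont.
have cG : continuous G by rewrite /G; cont.
have : prim S T <= prim (fun t => kap^-1 * (- (c / 2)) * U t + kap^-1 * K * G t) T.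
  apply: ler_prim => //; first by cont.
  move=> t tT; rewrite -mulrA -mulrA -mulrDr.
  rewrite -(ler_pM2l kap0) mulVKf ?gt_eqF//.
  have -> : kap * S t = cos psi * ((u1 t - g1 t) * v1 t + (u2 t - g2 t) * v2 t) +
      sin psi * ((u2 t - g2 t) * v1 t - (u1 t - g1 t) * v2 t).
    by rewrite eu1// eu2// -/v1 -/v2 /S; ring.
  have y1 := @rotated_young psi (c / 2) (u1 t) (u2 t) (h1 t) (h2 t) (divr_gt0 c0 (ltr0n _ 2)).
  have y2 := @rotated_young psi e^-1 (- g1 t) (- g2 t) (v1 t) (v2 t).
  rewrite invr_gt0 in y2; have {}y2 := y2 e0.
  have vle : v1 t ^+ 2 + v2 t ^+ 2 <= 2 * L * U t + 2 * (h1 t ^+ 2 + h2 t ^+ 2).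
    rewrite -subr_ge0.
    have -> : 2 * L * U t + 2 * (h1 t ^+ 2 + h2 t ^+ 2) - (v1 t ^+ 2 + v2 t ^+ 2) =
      2 * U t + (la * u1 t - lb * u2 t - h1 t) ^+ 2 + (lb * u1 t + la * u2 t - h2 t) ^+ 2.
      by rewrite /U /L /v1 /v2; ring.
    by rewrite !addr_ge0 ?sqr_ge0// mulr_ge0// addr_ge0 ?sqr_ge0.
  have eL : e / 2 * (2 * L * U t) = c / 4 * U t by rewrite /e; field; rewrite gt_eqF.
  have evle : e / 2 * (v1 t ^+ 2 + v2 t ^+ 2) <= c / 4 * U t + e * (h1 t ^+ 2 + h2 t ^+ 2).
    apply: (@le_trans _ _ (e / 2 * (2 * L * U t + 2 * (h1 t ^+ 2 + h2 t ^+ 2)))).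
      by rewrite ler_pM2l// divr_gt0.
    by rewrite mulrDr eL lerD2l; rewrite mulrA divfK.
  have -> : cos psi * ((u1 t - g1 t) * v1 t + (u2 t - g2 t) * v2 t) +
      sin psi * ((u2 t - g2 t) * v1 t - (u1 t - g1 t) * v2 t) =
    - c * U t + (cos psi * (u1 t * h1 t + u2 t * h2 t) + sin psi * (u2 t * h1 t - u1 t * h2 t))
    + (cos psi * (- g1 t * v1 t + - g2 t * v2 t) + sin psi * (- g2 t * v1 t - - g1 t * v2 t)).
    by rewrite /U /c /v1 /v2; ring.
  have H0 : 0 <= h1 t ^+ 2 + h2 t ^+ 2 by rewrite addr_ge0 ?sqr_ge0.
  have G0 : 0 <= g1 t ^+ 2 + g2 t ^+ 2 by rewrite addr_ge0 ?sqr_ge0.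
  have gE : (- g1 t) ^+ 2 + (- g2 t) ^+ 2 = g1 t ^+ 2 + g2 t ^+ 2 by rewrite !sqrrN.
  have e1E : (2 * e^-1)^-1 = e / 2 by rewrite invfM invrK mulrC.
  have c1E : (2 * (c / 2))^-1 = c^-1 by rewrite mulrC divfK.
  have e2E : e^-1 / 2 = (2 * e)^-1 by rewrite [in RHS]invfM mulrC.
  rewrite gE e1E e2E in y2; rewrite c1E in y1.
  rewrite -/(U t) in y1; rewrite /G /K.
  have k1 : 0 <= c^-1 * (g1 t ^+ 2 + g2 t ^+ 2) by rewrite mulr_ge0// invr_ge0 ltW.
  have k2 : 0 <= e * (g1 t ^+ 2 + g2 t ^+ 2) by rewrite mulr_ge0// ltW.
  have k3 : 0 <= (2 * e)^-1 * (h1 t ^+ 2 + h2 t ^+ 2).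
    by rewrite mulr_ge0// invr_ge0 mulr_ge0// ltW.
  move: (cos psi * _ + _) (cos psi * _ + _) y1 y2 => A B y1 y2.
  move: (U t) (h1 t ^+ 2 + h2 t ^+ 2) (g1 t ^+ 2 + g2 t ^+ 2) (v1 t ^+ 2 + v2 t ^+ 2)
     (2 * e)^-1 c^-1 y1 y2 evle k1 k2 k3 => U' H' G' V' E' C' y1 y2 evle k1 k2 k3.
  lra.
rewrite (prim_lin _ _ T cU cG) => hle; move: (le_trans S0 hle).
rewrite -!mulrA -mulrDr pmulr_rge0 ?invr_gt0// mulNr addrC subr_ge0 => h.
have -> : prim U T = 2 / c * (c / 2 * prim U T) by field; rewrite gt_eqF.
by rewrite -!mulrA in h *; rewrite !ler_pM2l ?invr_gt0.
Qed.

Lemma cos_lt0_pi y : pi / 2 < y -> y <= pi -> cos y < 0 :> R.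
Proof.
move=> y1 y2; have -> : y = pi - (pi - y) by ring.
by rewrite cosB cospi sinpi mulN1r mul0r addr0 oppr_lt0 cos_gt0_pihalf//; lra.
Qed.

(** A number of argument th > al pi/2 in absolute value needs a rotation by less than (1-al) pi/2 to
    enter the open left half-plane; the sign of psi follows that of the imaginary part. *)
Lemma sector_angle al la lb : 0 < al < 1 -> la ^+ 2 + lb ^+ 2 != 0 ->
  al * pi / 2 < acos (la / Num.sqrt (la ^+ 2 + lb ^+ 2)) ->
  exists psi : R, `|psi| < (1 - al) * (pi / 2) /\ 0 < sin psi * lb - cos psi * la.
Proof.
move=> /andP[a0 a1] l0; have L0 : 0 < la ^+ 2 + lb ^+ 2.
  by rewrite lt_neqAle eq_sym l0 addr_ge0 ?sqr_ge0.
set rho := Num.sqrt _; have rho0 : 0 < rho by rewrite sqrtr_gt0.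
have rhoE : rho ^+ 2 = la ^+ 2 + lb ^+ 2 by rewrite sqr_sqrtr// ltW.
have lar : -1 <= la / rho <= 1.
  rewrite -ler_norml normrM normfV (gtr0_norm rho0) ler_pdivrMr// mul1r.
  by rewrite -sqrtr_sqr ler_wsqrtr// lerDl sqr_ge0.
set th := acos _ => hth.
have laE : la = rho * cos th by rewrite /th acosK// mulrC divfK// gt_eqF.
have th0 : 0 <= th by rewrite acos_ge0.
have thpi : th <= pi by rewrite acos_lepi.
have lbE : `|lb| = rho * sin th.
  have s0 : 0 <= sin th by apply: sin_ge0_pi; rewrite th0.
  apply/eqP; rewrite -(@eqrXn2 _ 2)// ?mulr_ge0 ?(ltW rho0)// exprMn real_normK ?num_real//.
  have := cos2Dsin2 th => cs; rewrite -subr_eq0.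
  have -> : lb ^+ 2 = rho ^+ 2 - la ^+ 2 by rewrite rhoE; ring.
  by rewrite laE -(mulr1 (rho ^+ 2)) -[in X in X - _ - _]cs; apply/eqP; ring.
have pi0 := pi_gt0 R.
have [p [p0 hp hc]] : exists p : R, [/\ 0 <= p, p < (1 - al) * (pi / 2) & cos (p + th) < 0].
  have [h|h] := ltP (pi / 2) th.
    exists 0; split=> //; first by rewrite mulr_gt0 ?subr_gt0// divr_gt0.
    by rewrite add0r; exact: cos_lt0_pi.
  (* Midpoint between the rotation that reaches the imaginary axis and the largest admissible
     one. *)
  exists ((pi / 2 - th + (1 - al) * (pi / 2)) / 2).
  have e1 : pi / 2 - th < (1 - al) * (pi / 2) by lra.
  have e2 : (1 - al) * (pi / 2) < pi / 2.
    by rewrite -[ltRHS]mul1r ltr_pM2r ?divr_gt0//; lra.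
  by split; [lra|lra|apply: cos_lt0_pi; lra].
have key : 0 < sin p * `|lb| - cos p * la.
  rewrite lbE laE.
  have -> : sin p * (rho * sin th) - cos p * (rho * cos th) = - (rho * cos (p + th)).
    by rewrite cosD; ring.
  by rewrite oppr_gt0 pmulr_rlt0.
have [lb0|lb0] := leP 0 lb.
  by exists p; rewrite ger0_norm//; split=> //; move: key; rewrite ger0_norm.
exists (- p); rewrite normrN ger0_norm//; split=> //.
by rewrite cosN sinN mulNr; move: key; rewrite ltr0_norm// mulrN.
Qed.

End energy.

(** * Finite sums, and an annihilating product for a matrix *)

Section finite_sums.
Context {R : realType}.
Implicit Types (f g h : R -> R) (a b c t T al : R).

Lemma continuous_for_bigsum (I : Type) (r : seq I) (F : I -> R -> R) t :
  (forall i, continuous (F i)) -> {for t, continuous (fun s => \sum_(i <- r) F i s)}.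
Proof.
move=> cF; elim: r => [|i r IH].
  have -> : (fun s => \sum_(i <- [::]) F i s) = (fun=> 0) by apply/funext => s; rewrite big_nil.
  by cont.
have -> : (fun s => \sum_(j <- i :: r) F j s) = (fun s => F i s + \sum_(j <- r) F j s).
  by apply/funext => s; rewrite big_cons.
by apply: continuous_for_add; [exact: cF|exact: IH].
Qed.

Lemma RLk_zero al t : 0 < al <= 1 -> RLk al (fun=> 0) t = 0.
Proof.
move=> al01; have c0 : continuous ((fun=> 0) : R -> R) by cont.
transitivity (RLk al (fun s => 0 * (fun=> 0) s + 0 * (fun=> 0) s) t).
  by congr RLk; apply/funext => s; rewrite mul0r addr0.
by rewrite (RLk_lin 0 0 t al01 c0 c0) !mul0r addr0.
Qed.

Lemma RLk_bigsum (I : Type) (r : seq I) (F : I -> R -> R) (a : I -> R) al t :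
  0 < al <= 1 -> (forall i, continuous (F i)) ->
  RLk al (fun s => \sum_(i <- r) a i * F i s) t = \sum_(i <- r) a i * RLk al (F i) t.
Proof.
move=> al01 cF; elim: r => [|i r IH].
  rewrite big_nil; under eq_fun do rewrite big_nil.
  exact: RLk_zero.
have cS : continuous (fun s => \sum_(j <- r) a j * F j s).
  by move=> u; apply: continuous_for_bigsum => j; have := cF j => ?; cont.
have := RLk_lin (a i) 1 t al01 (cF i) cS; rewrite mul1r IH big_cons => <-.
by congr RLk; apply/funext => s; rewrite big_cons mul1r.
Qed.

(** Cauchy-Schwarz with 1 added to the sum of the squares of [a], which keeps the factor positive.
    It follows by expanding the sum of (N x_i - a_i S)^2. *)
Lemma sum_sqr_le (I : finType) (a x : I -> R) :
  (\sum_i a i * x i) ^+ 2 <= (1 + \sum_i a i ^+ 2) * \sum_i x i ^+ 2.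
Proof.
set S := \sum_i a i * x i; set N := 1 + \sum_i a i ^+ 2; set X := \sum_i x i ^+ 2.
have N1 : 1 <= N by rewrite lerDl sumr_ge0// => i _; rewrite sqr_ge0.
have N0 : 0 < N by exact: lt_le_trans N1.
have X0 : 0 <= X by rewrite sumr_ge0// => i _; rewrite sqr_ge0.
have : 0 <= \sum_i (N * x i - a i * S) ^+ 2 by rewrite sumr_ge0// => i _; rewrite sqr_ge0.
have -> : \sum_i (N * x i - a i * S) ^+ 2 = N ^+ 2 * X - (N + 1) * S ^+ 2.
  transitivity (\sum_i (N ^+ 2 * x i ^+ 2 + (- (2 * N * S) * (a i * x i) + S ^+ 2 * a i ^+ 2))).
    by apply: eq_bigr => i _; ring.
  rewrite big_split/= big_split/= -!mulr_sumr -/S -/X.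
  have -> : \sum_i a i ^+ 2 = N - 1 by rewrite /N addrAC subrr add0r.
  by ring.
rewrite subr_ge0 => h.
have : (N + 1) * S ^+ 2 <= (N + 1) * (N * X).
  apply: le_trans h _; rewrite mulrDl mul1r expr2 -mulrA lerDl.
  by rewrite mulr_ge0// ltW.
by rewrite ler_pM2l// addr_gt0.
Qed.

End finite_sums.

(** Cayley-Hamilton for the characteristic polynomial split into linear factors. *)
Lemma eigenvalue_annihilator (F : closedFieldType) n (B : 'M[F]_n) :
  exists s : seq F, (forall lam, lam \in s -> eigenvalue B lam) /\
    foldr (fun lam M => (B - lam%:M) *m M) 1%:M s = 0.
Proof.
case: n B => [|n] B.
  by exists [::]; split=> //; rewrite [LHS]flatmx0.
have [s hs] := closed_field_poly_normal (char_poly B).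
rewrite (monicP (char_poly_monic B)) scale1r in hs.
exists s; split.
  by move=> lam ls; rewrite eigenvalue_root_char hs root_prod_XsubC.
have <- := Cayley_Hamilton B; rewrite hs {hs}.
elim: s => [|lam s IH] /=; first by rewrite big_nil !rmorph1.
by rewrite big_cons rmorphM rmorphB/= horner_mx_X horner_mx_C IH.
Qed.

(** * Energy estimate for linear systems *)

Section vector_energy.
Context {R : realType} (d : nat).
Implicit Types (x u g h : R -> 'cV[R]_d) (v : 'cV[R]_d) (m : 'rV[R[i]]_d) (t T al kap : R).

Definition sqn v : R := \sum_(i < d) v i ord0 ^+ 2.

Definition cvec x := forall i, continuous (fun t => x t i ord0).

Lemma sqn_ge0 v : 0 <= sqn v.
Proof. by rewrite sumr_ge0// => i _; rewrite sqr_ge0. Qed.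

Lemma continuous_sqn x : cvec x -> continuous (fun t => sqn (x t)).
Proof.
move=> cx t; apply: continuous_for_bigsum => i.
by have := cx i => ci; cont.
Qed.

(** [rpair] and [ipair] are the real and imaginary parts of a complex linear functional [m] applied
    to a real vector. *)
Definition rpair m v : R := \sum_j complex.Re (m ord0 j) * v j ord0.
Definition ipair m v : R := \sum_j complex.Im (m ord0 j) * v j ord0.

Lemma continuous_rpair m x : cvec x -> continuous (fun t => rpair m (x t)).
Proof.
move=> cx t; apply: continuous_for_bigsum => i.
by have := cx i => ci; cont.
Qed.

Lemma continuous_ipair m x : cvec x -> continuous (fun t => ipair m (x t)).
Proof.
move=> cx t; apply: continuous_for_bigsum => i.
by have := cx i => ci; cont.
Qed.

Lemma pair_sqr_le m : exists N, 0 < N /\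
  forall v, rpair m v ^+ 2 + ipair m v ^+ 2 <= N * sqn v.
Proof.
exists ((1 + \sum_j complex.Re (m ord0 j) ^+ 2) + (1 + \sum_j complex.Im (m ord0 j) ^+ 2)).
split.
  by rewrite addr_gt0// ltr_wpDr// sumr_ge0// => i _; rewrite sqr_ge0.
by move=> v; rewrite mulrDl lerD//; exact: sum_sqr_le.
Qed.

Lemma Re_sum (I : Type) (r : seq I) (F : I -> R[i]) :
  complex.Re (\sum_(i <- r) F i) = \sum_(i <- r) complex.Re (F i).
Proof. by apply: (big_morph (@complex.Re R)) => // -[a b] [a' b']. Qed.

Lemma Im_sum (I : Type) (r : seq I) (F : I -> R[i]) :
  complex.Im (\sum_(i <- r) F i) = \sum_(i <- r) complex.Im (F i).
Proof. by apply: (big_morph (@complex.Im R)) => // -[a b] [a' b']. Qed.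

Lemma ReM (z w : R[i]) : complex.Re (z * w) =
  complex.Re z * complex.Re w - complex.Im z * complex.Im w.
Proof. by case: z => a b; case: w. Qed.

Lemma ImM (z w : R[i]) : complex.Im (z * w) =
  complex.Re z * complex.Im w + complex.Im z * complex.Re w.
Proof. by case: z => a b; case: w. Qed.

Lemma ReB (z w : R[i]) : complex.Re (z - w) = complex.Re z - complex.Re w.
Proof. by case: z => a b; case: w. Qed.

Lemma ImB (z w : R[i]) : complex.Im (z - w) = complex.Im z - complex.Im w.
Proof. by case: z => a b; case: w. Qed.

Lemma ReMC (z : R[i]) (a : R) : complex.Re (z * real_complex R a) = complex.Re z * a.
Proof. by rewrite ReM/= mulr0 subr0. Qed.

Lemma ImMC (z : R[i]) (a : R) : complex.Im (z * real_complex R a) = complex.Im z * a.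
Proof. by rewrite ImM/= mulr0 add0r. Qed.

Variables (A : 'M[R]_d).
Let AC := map_mx (real_complex R) A.

(** Real part of m A v = lam (m v) + m (A - lam) v. *)
Lemma rpair_mulmx m (lam : R[i]) v :
  rpair m (A *m v) = complex.Re lam * rpair m v - complex.Im lam * ipair m v
    + rpair (m *m (AC - lam%:M)) v.
Proof.
rewrite /rpair /ipair !mulr_sumr -sumrB -big_split/=.
under eq_bigr do rewrite mxE mulr_sumr.
rewrite exchange_big/=; apply: eq_bigr => k _.
rewrite mulmxBr mul_mx_scalar !mxE ReB Re_sum ReM.
under [in RHS]eq_bigr do rewrite mxE ReMC.
under eq_bigr do rewrite mulrA.
by rewrite -mulr_suml; ring.
Qed.

Lemma ipair_mulmx m (lam : R[i]) v :
  ipair m (A *m v) = complex.Im lam * rpair m v + complex.Re lam * ipair m v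
    + ipair (m *m (AC - lam%:M)) v.
Proof.
rewrite /rpair /ipair !mulr_sumr -!big_split/=.
under eq_bigr do rewrite mxE mulr_sumr.
rewrite exchange_big/=; apply: eq_bigr => k _.
rewrite mulmxBr mul_mx_scalar !mxE ImB Im_sum ImM.
under [in RHS]eq_bigr do rewrite mxE ImMC.
under eq_bigr do rewrite mulrA.
by rewrite -mulr_suml; ring.
Qed.

Lemma rpairD m v w : rpair m (v + w) = rpair m v + rpair m w.
Proof. by rewrite -big_split; apply: eq_bigr => j _; rewrite mxE mulrDr. Qed.

Lemma ipairD m v w : ipair m (v + w) = ipair m v + ipair m w.
Proof. by rewrite -big_split; apply: eq_bigr => j _; rewrite mxE mulrDr. Qed.

Definition RLv al x t : 'cV[R]_d := \col_i RLk al (fun s => x s i ord0) t.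

Lemma rpair_RLv m al kap u g (y : R -> 'cV[R]_d) t : 0 < al <= 1 -> cvec y ->
  u t = g t + kap *: RLv al y t ->
  rpair m (u t) = rpair m (g t) + kap * RLk al (fun s => rpair m (y s)) t.
Proof.
move=> al01 cy ->; rewrite rpairD; congr (_ + _).
rewrite /rpair RLk_bigsum// mulr_sumr; apply: eq_bigr => j _.
by rewrite !mxE; ring.
Qed.

Lemma ipair_RLv m al kap u g (y : R -> 'cV[R]_d) t : 0 < al <= 1 -> cvec y ->
  u t = g t + kap *: RLv al y t ->
  ipair m (u t) = ipair m (g t) + kap * RLk al (fun s => ipair m (y s)) t.
Proof.
move=> al01 cy ->; rewrite ipairD; congr (_ + _).
rewrite /ipair RLk_bigsum// mulr_sumr; apply: eq_bigr => j _.
by rewrite !mxE; ring.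
Qed.

Lemma cvecD x y : cvec x -> cvec y -> cvec (fun t => x t + y t).
Proof.
move=> cx cy i; have ci := cx i; have cj := cy i.
have -> : (fun t => (x t + y t) i ord0) = (fun t => x t i ord0 + y t i ord0).
  by apply/funext => t; rewrite mxE.
by cont.
Qed.

Lemma cvecM (B : 'M[R]_d) x : cvec x -> cvec (fun t => B *m x t).
Proof.
move=> cx i.
have -> : (fun t => (B *m x t) i ord0) = (fun t => \sum_j B i j * x t j ord0).
  by apply/funext => t; rewrite mxE.
by move=> t; apply: continuous_for_bigsum => j; have cj := cx j; cont.
Qed.

Lemma cvecZ a x : cvec x -> cvec (fun t => a *: x t).
Proof.
move=> cx i; have ci := cx i.
have -> : (fun t => (a *: x t) i ord0) = (fun t => a * x t i ord0).
  by apply/funext => t; rewrite mxE.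
by cont.
Qed.

Lemma cvec_RLv al x : 0 < al <= 1 -> cvec x -> cvec (RLv al x).
Proof.
move=> al01 cx i.
have -> : (fun t => RLv al x t i ord0) = RLk al (fun s => x s i ord0).
  by apply/funext => t; rewrite mxE.
exact: continuous_RLk.
Qed.

(** The second condition says that exp(i psi) lam has negative real part. This is the form in which
    the argument condition enters the energy estimates. *)
Definition good_eigenvalue al (lam : R[i]) := exists psi : R,
  `|psi| < (1 - al) * (pi / 2) /\
  0 < sin psi * complex.Im lam - cos psi * complex.Re lam.

Definition prodA (s : seq R[i]) : 'M[R[i]]_d :=
  foldr (fun lam M => (AC - lam%:M) *m M) 1%:M s.

(** Induction on the list of eigenvalues: m u solves the scalar equation with eigenvalue lam and
    forcing m' u + m h, where m' = m (A - lam) is killed by the shorter product and so already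
    controlled. For the empty list m = 0. *)
Lemma functional_energy al kap (s : seq R[i]) : 0 < al < 1 -> 0 < kap ->
  (forall lam, lam \in s -> good_eigenvalue al lam) ->
  forall m, m *m prodA s = 0 -> exists C, 0 < C /\
  forall T u g h, 0 <= T -> cvec u -> cvec g -> cvec h ->
  (forall t, 0 <= t <= T -> u t = g t + kap *: RLv al (fun s => A *m u s + h s) t) ->
  prim (fun t => rpair m (u t) ^+ 2 + ipair m (u t) ^+ 2) T <=
  C * prim (fun t => sqn (g t) + sqn (h t)) T.
Proof.
move=> al01 kap0; have al01' : 0 < al <= 1 by case/andP: al01 => -> /ltW.
elim: s => [|lam s IH] gs m.
  rewrite /= mulmx1 => ->; exists 1; split=> // T u g h T0 cu cg ch _.
  have cS : continuous (fun t => sqn (g t) + sqn (h t)).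
    have := continuous_sqn cg => c1; have := continuous_sqn ch => c2; cont.
  rewrite mul1r; apply: ler_prim => //.
    have := continuous_rpair (m := 0) cu => c1; have := continuous_ipair (m := 0) cu => c2.
    by cont.
  move=> t _; rewrite /rpair /ipair !big1; last 2 first.
  - by move=> j _; rewrite mxE/= mul0r.
  - by move=> j _; rewrite mxE/= mul0r.
  by rewrite expr0n/= addr0 addr_ge0 ?sqn_ge0.
rewrite /= mulmxA => m0.
have [||C' [C'0 hC']] := IH _ (m *m (AC - lam%:M)) => //.
  by move=> l ls; apply: gs; rewrite inE ls orbT.
have [psi [hpsi hl]] := gs lam (mem_head _ _).
have [C0 [C00 hC0]] := scalar_energy_psi al01 kap0 hpsi hl.
have [N [N0 hN]] := pair_sqr_le m.
exists (C0 * (2 * N + 2 * C')); split.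
  by rewrite mulr_gt0// addr_gt0// mulr_gt0.
move=> T u g h T0 cu cg ch eu.
have h1 := hC' T u g h T0 cu cg ch eu.
set m' := m *m (AC - lam%:M) in m0 h1.
have cy : cvec (fun s => A *m u s + h s) by apply: cvecD => //; exact: cvecM.
have c1 := continuous_rpair (m := m) cu; have c2 := continuous_ipair (m := m) cu.
have c3 := continuous_rpair (m := m) cg; have c4 := continuous_ipair (m := m) cg.
have c5 := continuous_rpair (m := m) ch; have c6 := continuous_ipair (m := m) ch.
have c7 := continuous_rpair (m := m') cu; have c8 := continuous_ipair (m := m') cu.
have c9 := continuous_sqn cg; have c10 := continuous_sqn ch.
have := hC0 T (fun t => rpair m (u t)) (fun t => ipair m (u t))
  (fun t => rpair m (g t)) (fun t => ipair m (g t))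
  (* The part of m A u that is not lam (m u) is treated as forcing, together with m h. *)
  (fun t => rpair m' (u t) + rpair m (h t)) (fun t => ipair m' (u t) + ipair m (h t))
  T0 c1 c2 c3 c4 _ _ _ _.
set LHS := prim _ T => hLHS.
apply: (@le_trans _ _ (C0 * prim (fun t => N * (sqn (g t) + sqn (h t)) + (N * (sqn (g t) + sqn (h t)) +
   2 * (rpair m' (u t) ^+ 2 + ipair m' (u t) ^+ 2))) T)).
  apply: le_trans (hLHS _ _ _ _) _; [cont|cont| | |].
  - move=> t tT; rewrite (rpair_RLv m al01' cy (eu t tT)).
    congr (_ + _ * RLk _ _ _); apply/funext => s'.
    by rewrite rpairD (rpair_mulmx _ lam) -/m' addrA.
  - move=> t tT; rewrite (ipair_RLv m al01' cy (eu t tT)).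
    congr (_ + _ * RLk _ _ _); apply/funext => s'.
    by rewrite ipairD (ipair_mulmx _ lam) -/m' addrA.
  rewrite ler_pM2l//; apply: ler_prim; [cont|cont|].
  move=> t _; have n1 := hN (g t); have n2 := hN (h t).
  have n3 : 0 <= N * sqn (g t) by rewrite mulr_ge0 ?sqn_ge0// ltW.
  have q1 : 0 <= (rpair m' (u t) - rpair m (h t)) ^+ 2 by exact: sqr_ge0.
  have q2 : 0 <= (ipair m' (u t) - ipair m (h t)) ^+ 2 by exact: sqr_ge0.
  have -> : (rpair m' (u t) + rpair m (h t)) ^+ 2 = 2 * rpair m' (u t) ^+ 2 +
     2 * rpair m (h t) ^+ 2 - (rpair m' (u t) - rpair m (h t)) ^+ 2 by ring.
  have -> : (ipair m' (u t) + ipair m (h t)) ^+ 2 = 2 * ipair m' (u t) ^+ 2 +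
     2 * ipair m (h t) ^+ 2 - (ipair m' (u t) - ipair m (h t)) ^+ 2 by ring.
  move: (_ ^+ 2) q1 (_ ^+ 2) q2 => Q1 q1 Q2 q2.
  rewrite !mulrDr; move: (N * sqn (g t)) (N * sqn (h t)) n1 n2 n3 => X Y n1 n2 n3.
  by lra.
rewrite -[leRHS]mulrA ler_pM2l//.
pose S t := sqn (g t) + sqn (h t).
pose Q t := rpair m' (u t) ^+ 2 + ipair m' (u t) ^+ 2.
have cS : continuous S by rewrite /S; cont.
have cQ : continuous Q by rewrite /Q; cont.
change (is_true (prim (fun t => N * S t + (N * S t + 2 * Q t)) T <= (2 * N + 2 * C') * prim S T)).
change (is_true (prim Q T <= C' * prim S T)) in h1.
have e : prim (fun t => N * S t + (N * S t + 2 * Q t)) T = 2 * N * prim S T + 2 * prim Q T.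
  rewrite prim_add; [|by cont|by cont].
  by rewrite (prim_lin N 2 T cS cQ) prim_scale//; ring.
have -> : (2 * N + 2 * C') * prim S T = 2 * N * prim S T + 2 * (C' * prim S T) by ring.
by rewrite e lerD2l ler_pM2l.
Qed.

(** The previous estimate is applied to each coordinate functional, which the full annihilating
    product kills, and the results are summed. *)
Lemma vector_energy al kap : 0 < al < 1 -> 0 < kap ->
  (forall lam, eigenvalue AC lam -> good_eigenvalue al lam) ->
  exists C, 0 < C /\ forall T u g h, 0 <= T -> cvec u -> cvec g -> cvec h ->
  (forall t, 0 <= t <= T -> u t = g t + kap *: RLv al (fun s => A *m u s + h s) t) ->
  prim (fun t => sqn (u t)) T <= C * prim (fun t => sqn (g t) + sqn (h t)) T.
Proof.
move=> al01 kap0 gA; have [s [sA s0]] := eigenvalue_annihilator AC.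
have gs lam : lam \in s -> good_eigenvalue al lam by move=> /sA /gA.
pose e i : 'rV[R[i]]_d := delta_mx ord0 i.
have rE i v : rpair (e i) v = v i ord0.
  rewrite /rpair (bigD1 i)//= mxE !eqxx/= mul1r big1 ?addr0// => j ji.
  by rewrite mxE (negbTE ji)/= mul0r.
have iE i v : ipair (e i) v = 0.
  rewrite /ipair big1// => j _; rewrite mxE eqxx/=.
  by case: (j == i); rewrite /= mul0r.
have /choice[C hC] : forall i, exists C, 0 < C /\
  forall T u g h, 0 <= T -> cvec u -> cvec g -> cvec h ->
  (forall t, 0 <= t <= T -> u t = g t + kap *: RLv al (fun s => A *m u s + h s) t) ->
  prim (fun t => u t i ord0 ^+ 2) T <= C * prim (fun t => sqn (g t) + sqn (h t)) T.
  move=> i; have [|C [C0 hC]] := functional_energy al01 kap0 gs (m := e i).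
    by rewrite [prodA s]s0 mulmx0.
  exists C; split=> // T u g h T0 cu cg ch eu.
  have := hC T u g h T0 cu cg ch eu; congr (prim _ _ <= _).
  by apply/funext => t; rewrite rE iE expr0n addr0.
exists (1 + \sum_i C i); split.
  by rewrite ltr_wpDr// sumr_ge0// => i _; exact: ltW (hC i).1.
move=> T u g h T0 cu cg ch eu.
have c1 := continuous_sqn cg; have c2 := continuous_sqn ch.
have p0 : 0 <= prim (fun t => sqn (g t) + sqn (h t)) T.
  by apply: prim_ge0 => //; [cont|move=> s' _; rewrite addr_ge0 ?sqn_ge0].
have -> : prim (fun t => sqn (u t)) T = \sum_i 1 * prim (fun t => u t i ord0 ^+ 2) T.
  rewrite /prim -RLk_bigsum ?ltr01 ?lexx//; last by move=> i; have ci := cu i; cont.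
  by congr RLk; apply/funext => t; apply: eq_bigr => i _; rewrite mul1r.
rewrite mulrDl mul1r ler_wpDl// mulr_suml ler_sum// => i _.
by rewrite mul1r; exact: (hC i).2.
Qed.

End vector_energy.

(** * A decaying function whose fractional integral is nearly constant *)

Section corrector.
Context {R : realType}.
Notation mu := (@lebesgue_measure R).
Local Notation I01 := (`[(0 : R), (1 : R)]%classic).
Implicit Types (f g h : R -> R) (a b c t s T al be : R).

(** The absolute value keeps the base at least 1, hence the function positive and continuous on the
    whole line. *)
Definition tpow a t : R := (1 + `|t|) `^ a.

Lemma tpow_gt0 a t : 0 < tpow a t.
Proof. by rewrite powR_gt0// ltr_wpDr. Qed.

Lemma continuous_tpow a : continuous (tpow a).
Proof.
move=> t; apply: (@continuous_for_comp _ (fun y => y `^ a) (fun t => 1 + `|t|)).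
  apply: continuous_for_add; first exact: continuous_for_cst.
  by apply: cvg_norm; exact: continuous_for_id.
by apply: continuous_powR; rewrite ltr_wpDr.
Qed.

Lemma ler_tpow a b t : a <= b -> tpow a t <= tpow b t.
Proof. by move=> ab; apply: ler_powR => //; rewrite lerDl. Qed.

Lemma tpow_le1 a t : a <= 0 -> tpow a t <= 1.
Proof. by move=> a0; rewrite -[leRHS](powRr0 (1 + `|t|)); apply: ler_tpow. Qed.

Lemma tpow_sqr a t : tpow a t ^+ 2 = tpow (2 * a) t.
Proof.
have t0 : 1 + `|t| != 0 by rewrite gt_eqF// ltr_wpDr.
by rewrite expr2 /tpow -powRD ?t0 ?implybT//; congr powR; ring.
Qed.

Section bound.
Variable al : R.
Hypothesis al01 : 0 < al < 1.
Let a0 : 0 < al. Proof. by case/andP: al01. Qed.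
Let a1 : al < 1. Proof. by case/andP: al01. Qed.
Let gam := (1 - al) / 2.
Let g0 : 0 < gam. Proof. by rewrite divr_gt0// subr_gt0. Qed.
Let Bq := betaB (1 - al).
Let del := 1 - al - gam.
Let d0 : 0 < del. Proof. by have := a1; rewrite /del /gam; lra. Qed.

(** This is t^al (1 + t s)^(-al), the rescaled integrand of I applied to (1+t)^(-al). It increases
    to s^(-al) as t tends to infinity. *)
Let phi t s := (t / (1 + t * s)) `^ al.

Fact phi_le t s : 0 < t -> 0 < s <= 1 -> phi t s <= s `^ (- al).
Proof.
move=> t0 /andP[s0 s1]; have ts : 0 < 1 + t * s by rewrite addr_gt0// mulr_gt0.
have -> : s `^ (- al) = (s^-1) `^ al.
  by rewrite -[s^-1]powR_inv1 ?(ltW s0)// -powRrM mulN1r.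
apply: ge0_ler_powR; rewrite ?nnegrE ?invr_ge0 ?(ltW a0) ?(ltW s0)//.
  by rewrite divr_ge0 ?(ltW t0) ?(ltW ts).
by rewrite ler_pdivrMr// ler_pdivlMl// mulrC lerDr.
Qed.

(** With y = ts/(1+ts) the difference is s^(-al)(1 - y^al) <= s^(-al)(1-y) = s^(-al)/(1+ts), and
    1/(1+ts) <= (ts)^(-gam). Spending only the power gam keeps the bound integrable at s = 0. *)
Fact phi_ge t s : 0 < t -> 0 < s <= 1 ->
  s `^ (- al) - phi t s <= t `^ (- gam) * s `^ (del - 1).
Proof.
move=> t0 /andP[s0 s1]; have ts0 : 0 < t * s by rewrite mulr_gt0.
have ts : 0 < 1 + t * s by rewrite addr_gt0.
pose y := (t * s) / (1 + t * s).
have y0 : 0 < y by rewrite divr_gt0.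
have y1 : y <= 1 by rewrite ler_pdivrMr// mul1r lerDr.
have -> : phi t s = s `^ (- al) * y `^ al.
  have -> : s `^ (- al) = (s^-1) `^ al.
    by rewrite -[s^-1]powR_inv1 ?(ltW s0)// -powRrM mulN1r.
  rewrite -powRM ?invr_ge0 ?(ltW s0) ?(ltW y0)// /phi /y.
  by congr powR; field; rewrite !gt_eqF.
have -> : t `^ (- gam) * s `^ (del - 1) = s `^ (- al) * (t * s) `^ (- gam).
  rewrite powRM ?(ltW t0) ?(ltW s0)// mulrCA -powRD; last by rewrite (gt_eqF s0) implybT.
  by congr (_ * _ `^ _); rewrite /del; ring.
have -> : s `^ (- al) - s `^ (- al) * y `^ al = s `^ (- al) * (1 - y `^ al) by ring.
rewrite ler_wpM2l ?powR_ge0//.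
apply: (@le_trans _ _ (1 - y)).
  by rewrite lerB//; apply: ger1_powR; rewrite ?y0 ?y1// ltW.
have -> : 1 - y = (1 + t * s)^-1 by rewrite /y; field; rewrite gt_eqF.
rewrite powRN lef_pV2 ?posrE ?powR_gt0//.
apply: (@le_trans _ _ ((1 + t * s) `^ gam)).
  by apply: ge0_ler_powR; rewrite ?nnegrE ?(ltW g0) ?(ltW ts0) ?(ltW ts) ?lerDr.
by apply: ler1_powR; [rewrite lerDl ltW|have := a0; rewrite /gam; lra].
Qed.

Local Notation Io := (`](0 : R), (1 : R)]%classic).

Fact Io_int f : mu.-integrable I01 (EFin \o f) ->
  mu.-integrable Io (EFin \o f) /\ \int[mu]_(s in I01) f s = \int[mu]_(s in Io) f s.
Proof.
move=> fi; have fo : mu.-integrable Io (EFin \o f).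
  by apply: integrableS fi => //; exact: subset_itv_oc_cc.
by split => //; rewrite -Rintegral_itv_obnd_cbnd.
Qed.

Fact RLk_tpow t : 0 < t ->
  mu.-integrable I01 (EFin \o (fun s => (1 - s) `^ (al - 1) * phi t s)) /\
  RLk al (tpow (- al)) t = \int[mu]_(s in I01) ((1 - s) `^ (al - 1) * phi t s).
Proof.
move=> t0; have al01' : 0 < al <= 1 by rewrite a0 ltW.
have i0 := integrable_Wint_cont al01' (continuous_scaler (t := t) (@continuous_tpow (- al))).
have e s : 0 <= s <= 1 -> phi t s = t `^ al * tpow (- al) (t * s).
  move=> /andP[s0 s1]; have ts : 0 < 1 + t * s by rewrite ltr_wpDr// mulr_ge0// ltW.
  rewrite /phi /tpow ger0_norm ?mulr_ge0 ?(ltW t0)//.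
  rewrite powRM ?invr_ge0 ?(ltW t0) ?(ltW ts)// -[(1 + t * s)^-1]powR_inv1 ?(ltW ts)//.
  by rewrite -powRrM mulN1r.
have i1 := @integrableZl _ _ R mu _ (measurable_itv _) (t `^ al) _ i0.
split.
  apply: eq_integrable i1 => // s; rewrite inE/= in_itv/= => s01.
  by rewrite e//= -EFinM; congr EFin; ring.
rewrite /RLk ppowE ?(ltW t0)// /Wint -(@RintegralZl _ _ R mu I01)//.
by apply: eq_Rintegral => s; rewrite inE/= in_itv/= => s01; rewrite e//; ring.
Qed.

Fact iB : mu.-integrable I01 (EFin \o (fun s => (1 - s) `^ (al - 1) * s `^ (- al))).
Proof.
have := @integrable_beta R al (1 - al) _ _.
rewrite a0 subr_gt0 a1 (ltW a1) gerBl (ltW a0) => /(_ isT isT).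
apply: eq_integrable => // s _ /=; congr (_ * _ `^ _)%:E; ring.
Qed.

Fact BqE : Bq = \int[mu]_(s in I01) ((1 - s) `^ (al - 1) * s `^ (- al)).
Proof.
by apply: eq_Rintegral => s _; congr (_ `^ _ * _ `^ _); ring.
Qed.

Lemma RLk_tpow_bounds : exists C, 0 < C /\ forall t, 0 < t ->
  0 <= Bq - RLk al (tpow (- al)) t <= C * t `^ (- gam) .
Proof.
have iD : mu.-integrable I01 (EFin \o (fun s => (1 - s) `^ (al - 1) * s `^ (del - 1))).
  apply: integrable_beta; first by rewrite a0 ltW.
  by have := a0; rewrite d0/= /del /gam; lra.
pose B' := \int[mu]_(s in I01) ((1 - s) `^ (al - 1) * s `^ (del - 1)).
have B'0 : 0 <= B' by apply: Rintegral_ge0 => s _; rewrite mulr_ge0 ?powR_ge0.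
exists (1 + B'); split; first by rewrite ltr_wpDr.
move=> t t0; have [it ->] := RLk_tpow t0; rewrite BqE.
have [io ->] := Io_int it; have [bo ->] := Io_int iB; have [co dE] := Io_int iD.
rewrite -RintegralB//.
have bio := @integrableB _ _ R mu _ (measurable_itv _) _ _ bo io.
apply/andP; split.
  apply: Rintegral_ge0 => s; rewrite /= in_itv/= => s01.
  by rewrite subr_ge0 ler_wpM2l ?powR_ge0// phi_le.
apply: (@le_trans _ _ (B' * t `^ (- gam))); last first.
  by rewrite ler_wpM2r ?powR_ge0// lerDr.
rewrite mulrC /B' dE -RintegralZl//; apply: le_Rintegral => //.
  exact: (@integrableZl _ _ R mu _ (measurable_itv _) (t `^ (- gam)) _ co).
move=> s; rewrite /= in_itv/= => s01.
by rewrite -mulrBr mulrCA ler_wpM2l ?powR_ge0// phi_ge.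
Qed.

(** For t > 1 this is [RLk_tpow_bounds] with a weaker exponent; for t <= 1 the left side is at most
    [Bq] and the weight is at least 1/2. *)
Lemma corrector_bound : exists C, 0 < C /\ forall t, 0 <= t ->
  `|Bq - RLk al (tpow (- al)) t| <= C * tpow (- (al * (1 - al) / 2)) t.
Proof.
have [C [C0 hC]] := RLk_tpow_bounds.
have Bq0 : 0 < Bq by apply: betaB_gt0; rewrite subr_gt0 a1 gtrBl a0.
(* Below the available rate gam; twice this exponent is the one of the weight [thw], since the bound
   is squared in the energy estimate. *)
pose be := al * (1 - al) / 2.
have be0 : 0 < be by rewrite divr_gt0// mulr_gt0// subr_gt0.
have beg : be <= gam by rewrite /be /gam ler_pM2r ?invr_gt0// ler_piMl// ?subr_ge0 ltW.
have be1 : be <= 1 by rewrite (le_trans beg)//; have := a0; rewrite /gam; lra.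
exists (2 * (Bq + C)); split; first by rewrite mulr_gt0// addr_gt0.
move=> t; rewrite le_eqVlt => /predU1P[<-|t0].
  rewrite RLk_le0// subr0 gtr0_norm// /tpow normr0 addr0 powR1 mulr1; lra.
have /andP[h1 h2] := hC t t0.
rewrite ger0_norm//.
have tp : 0 < tpow (- be) t by exact: tpow_gt0.
have [t1|t1] := leP t 1.
  apply: (@le_trans _ _ Bq).
    rewrite gerBl; apply: mulr_ge0; first exact: powR_ge0.
    by apply: Rintegral_ge0 => s _; rewrite mulr_ge0 ?powR_ge0.
  have h : 1 <= 2 * tpow (- be) t.
    rewrite -ler_pdivrMl// mulr1 /tpow powRN lef_pV2 ?posrE ?powR_gt0 ?ltr_wpDr//.
    apply: (@le_trans _ _ (1 + `|t|)); first by apply: ler1_powR => //; rewrite lerDl.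
    rewrite gtr0_norm//; by rewrite (_ : 2 = 1 + 1)// lerD2l.
  have -> : 2 * (Bq + C) * tpow (- (al * (1 - al) / 2)) t =
    (Bq + C) * (2 * tpow (- be) t) by rewrite /be mulrAC mulrC.
  by rewrite -[leLHS]mulr1; apply: ler_pM => //; rewrite ?(ltW Bq0)// lerDl ltW.
apply: le_trans h2 _.
have h : t `^ (- gam) <= 2 * tpow (- be) t.
  apply: (@le_trans _ _ (t `^ (- be))).
    by apply: ler_powR; rewrite ?lerN2// ltW.
  rewrite /tpow !powRN gtr0_norm// -ler_pdivrMl// -invfM.
  have t1' : 0 < 1 + t by rewrite addr_gt0.
  rewrite lef_pV2 ?posrE ?mulr_gt0 ?powR_gt0//.
  apply: (@le_trans _ _ ((2 * t) `^ be)).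
    apply: ge0_ler_powR; rewrite ?nnegrE ?(ltW be0) ?(ltW t1') ?mulr_ge0 ?(ltW t0)//.
    by rewrite mulr_natl mulr2n lerD2r ltW.
  by rewrite powRM ?(ltW t0)// ler_pM2r ?powR_gt0//; apply: ler1_powR => //; rewrite ler1n.
have -> : 2 * (Bq + C) * tpow (- (al * (1 - al) / 2)) t =
    (Bq + C) * (2 * tpow (- be) t) by rewrite /be mulrAC mulrC.
by apply: ler_pM; rewrite ?(ltW C0) ?powR_ge0// lerDr ltW.
Qed.
End bound.
End corrector.

(** * Energy estimate with a constant initial value and a small perturbation *)

Section perturbed_energy.
Context {R : realType} (d : nat).
Notation mu := (@lebesgue_measure R).
Local Notation I01 := (`[(0 : R), (1 : R)]%classic).
Implicit Types (v w b : 'cV[R]_d) (u x y g h : R -> 'cV[R]_d) (a c t T al kap : R).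

Lemma sqnD v w : sqn (v + w) <= 2 * sqn v + 2 * sqn w.
Proof.
rewrite /sqn !mulr_sumr -big_split/=; apply: ler_sum => i _; rewrite mxE.
by have := sqr_ge0 (v i ord0 - w i ord0); lra.
Qed.

Lemma sqnN v : sqn (- v) = sqn v.
Proof. by apply: eq_bigr => i _; rewrite mxE sqrrN. Qed.

Lemma sqnZ a v : sqn (a *: v) = a ^+ 2 * sqn v.
Proof. by rewrite mulr_sumr; apply: eq_bigr => i _; rewrite mxE exprMn. Qed.

Lemma sqnB v w : sqn (v - w) <= 2 * sqn v + 2 * sqn w.
Proof. by rewrite -(sqnN w); exact: sqnD. Qed.

Lemma sqn_mulmx (B : 'M[R]_d) : exists N, 0 < N /\ forall v, sqn (B *m v) <= N * sqn v.
Proof.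
exists (1 + \sum_i (1 + \sum_j B i j ^+ 2)); split.
  by rewrite ltr_wpDr// sumr_ge0// => i _; rewrite addr_ge0// sumr_ge0// => j _; exact: sqr_ge0.
move=> v; apply: (@le_trans _ _ ((\sum_i (1 + \sum_j B i j ^+ 2)) * sqn v)).
  rewrite {1}/sqn mulr_suml; apply: ler_sum => i _.
  by rewrite mxE; exact: (sum_sqr_le (fun j => B i j) (fun j => v j ord0)).
by rewrite ler_wpM2r ?sqn_ge0// lerDr.
Qed.

Lemma RLvD al x y t : 0 < al <= 1 -> cvec x -> cvec y ->
  RLv al (fun s => x s + y s) t = RLv al x t + RLv al y t.
Proof.
move=> al01 cx cy; apply/colP => i; rewrite !mxE.
rewrite -[RLk al (fun s => x s i ord0) t]mul1r -[RLk al (fun s => y s i ord0) t]mul1r.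
by rewrite -RLk_lin//; congr RLk; apply/funext => s; rewrite mxE !mul1r.
Qed.

Lemma RLv_col al (q : R -> R) v t : 0 < al <= 1 -> continuous q ->
  RLv al (fun s => q s *: v) t = RLk al q t *: v.
Proof.
move=> al01 cq; apply/colP => i; rewrite !mxE.
transitivity (v i ord0 * RLk al q t + 0 * RLk al q t); last by rewrite mul0r addr0 mulrC.
by rewrite -RLk_lin//; congr RLk; apply/funext => s; rewrite mxE mul0r addr0 mulrC.
Qed.

Lemma cvec_cst b : cvec (fun=> b).
Proof. by move=> i; cont. Qed.

Lemma cvec_col (q : R -> R) v : continuous q -> cvec (fun t => q t *: v).
Proof.
move=> cq i; rewrite (_ : (fun t => _) = (fun t => q t * v i ord0)); first by cont.
by apply/funext => t; rewrite mxE.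
Qed.

Variables (A : 'M[R]_d) (al kap : R).
Hypothesis al01 : 0 < al < 1.
Hypothesis kap0 : 0 < kap.
Hypothesis gA : forall lam, eigenvalue (map_mx (real_complex R) A) lam ->
  good_eigenvalue al lam.
Hypothesis uA : A \in unitmx.

Let a0 : 0 < al. Proof. by case/andP: al01. Qed.
Let a1 : al < 1. Proof. by case/andP: al01. Qed.
Let al1 : 0 < al <= 1. Proof. by rewrite a0 ltW. Qed.

(** The weight that dominates the squares of both the corrector (1+t)^(-al) and its residual. It
    decays but is not integrable; its primitive grows like a power of T below 1. *)
Definition thw : R -> R := tpow (- (al * (1 - al))).

Lemma thw_bounds t : 0 <= thw t <= 1.
Proof.
by rewrite ltW ?tpow_gt0//= tpow_le1// oppr_le0 mulr_ge0// ?subr_ge0 ltW.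
Qed.

Lemma continuous_thw : continuous thw.
Proof. exact: continuous_tpow. Qed.

(** Used directly as data, the constant b would cost T |b|^2. Subtracting p = q w, with q =
    (1+t)^(-al) and w proportional to A^-1 b, replaces b by the decaying terms -p and r b, where r =
    1 - I q / Bq. Then [vector_energy] applies to z = u - p. *)
Lemma perturbed_energy : exists eps C, [/\ 0 < eps, 0 < C & forall T b u g h, 0 <= T ->
  cvec u -> cvec g -> cvec h ->
  (forall t, 0 <= t <= T ->
     u t = b + g t + kap *: RLv al (fun s => A *m u s + h s) t) ->
  (forall t, 0 <= t <= T -> sqn (h t) <= eps * sqn (u t)) ->
  prim (fun t => sqn (u t)) T <=
  C * (sqn b * prim thw T + prim (fun t => sqn (g t)) T)].
Proof.
have [C1 [C10 hE]] := vector_energy al01 kap0 gA.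
have [Cq [Cq0 hq]] := corrector_bound al01.
have Bq0 : 0 < betaB (1 - al) :> R by apply: betaB_gt0; rewrite subr_gt0 a1 gtrBl a0.
have [N [N0 hN]] := sqn_mulmx (invmx A).
set Bq := betaB (1 - al) in hq Bq0.
(* Chosen so that kap I(A p) = -(I q / Bq) b, which tends to -b. *)
pose k := - (kap * Bq)^-1.
pose M := k ^+ 2 * N.
have M0 : 0 <= M by rewrite mulr_ge0 ?sqr_ge0// ltW.
pose D := 2 * (Cq / Bq) ^+ 2 + 4 * M.
have D0 : 0 <= D by apply: addr_ge0; apply: mulr_ge0 => //; exact: sqr_ge0.
(* With this eps the perturbation contributes a quarter of the energy U of u to that of z, hence at
   most U/2 after u = z + p; the final constant is what remains after moving U/2 to the left. *)
exists (4 * C1)^-1; exists (16 * C1 + 4 * C1 * D + 4 * M); split.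
- by rewrite invr_gt0 mulr_gt0.
- apply: ltr_wpDr; first exact: mulr_ge0.
  apply: ltr_wpDr; last exact: mulr_gt0.
  by apply: mulr_ge0 => //; rewrite mulr_ge0// ltW.
move=> T b u g h T0 cu cg ch eu hh.
pose q : R -> R := tpow (- al).
have cq : continuous q by exact: continuous_tpow.
pose w := k *: (invmx A *m b).
have wb : sqn w <= M * sqn b by rewrite /w sqnZ /M -mulrA ler_wpM2l ?sqr_ge0.
have Aw : A *m w = k *: b by rewrite /w -scalemxAr mulKVmx.
pose p t := q t *: w.
have cp : cvec p by exact: cvec_col.
have cNp : cvec (fun t => - p t).
  have -> : (fun t => - p t) = (fun t => - q t *: w) by apply/funext => t; rewrite scaleNr.
  by apply: cvec_col; cont.
pose z t := u t - p t.
have cz : cvec z by exact: cvecD.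
pose r t := 1 - RLk al q t / Bq.
have cr : continuous r by have ck := continuous_RLk al1 cq; rewrite /r; cont.
pose G t := (g t - p t) + r t *: b.
have cG : cvec G by apply: cvecD; [exact: cvecD|exact: cvec_col].
have ez t : 0 <= t <= T -> z t = G t + kap *: RLv al (fun s => A *m z s + h s) t.
  move=> tT; rewrite /z eu//.
  have -> : (fun s => A *m u s + h s) = (fun s => (A *m z s + h s) + q s *: (A *m w)).
    by apply/funext => s; rewrite /z mulmxBr -scalemxAr addrAC subrK.
  rewrite RLvD//; [|by apply: cvecD => //; exact: cvecM|exact: cvec_col].
  rewrite RLv_col// Aw /G /r.
  rewrite scalerDr !scalerA scalerBl scale1r.
  have -> : kap * RLk al q t * k = - (RLk al q t / Bq).
    by rewrite /k; field; rewrite !gt_eqF.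
  by rewrite scaleNr; apply/colP => i; rewrite !mxE; ring.
have := hE T z G h T0 cz cG ch ez.
have thq t : 0 <= t -> q t ^+ 2 <= thw t.
  by move=> t0; rewrite tpow_sqr; apply: ler_tpow; have := a0; have := sqr_ge0 al; lra.
have thr t : 0 <= t -> r t ^+ 2 <= (Cq / Bq) ^+ 2 * thw t.
  move=> t0; have := hq t t0.
  have -> : r t = (Bq - RLk al q t) / Bq by rewrite /r; field; rewrite gt_eqF.
  move=> h1; rewrite !exprMn [leRHS]mulrAC ler_wpM2r ?sqr_ge0//.
  (* The squared rate of [corrector_bound] is exactly the weight. *)
  have -> : thw t = tpow (- (al * (1 - al) / 2)) t ^+ 2.
    by rewrite tpow_sqr; congr tpow; field.
  by rewrite -exprMn -real_normK ?num_real// lerXn2r ?nnegrE// (le_trans _ h1).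
have hG t : 0 <= t <= T -> sqn (G t) <= 4 * sqn (g t) + (D * sqn b) * thw t.
  move=> /andP[t0 tT]; apply: le_trans (sqnD _ _) _.
  have s1 := sqnB (g t) (p t); rewrite sqnZ.
  rewrite [sqn (p t)]sqnZ in s1.
  have s2 := thr t t0; have s3 := thq t t0.
  have s4 : q t ^+ 2 * sqn w <= thw t * (M * sqn b).
    by apply: ler_pM; rewrite ?sqr_ge0 ?sqn_ge0.
  have s5 : r t ^+ 2 * sqn b <= (Cq / Bq) ^+ 2 * thw t * sqn b.
    by rewrite ler_wpM2r ?sqn_ge0.
  rewrite /D; move: s1 s4 s5; move: (r t ^+ 2 * sqn b) (q t ^+ 2 * sqn w) => X Y.
  move: ((Cq / Bq) ^+ 2) => Z s1 s4 s5.
  have -> : (2 * Z + 4 * M) * sqn b * thw t = 2 * (Z * thw t * sqn b) + 4 * (thw t * (M * sqn b)) by ring.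
  move: s1 s4 s5; lra.
have c1 := continuous_sqn cG; have c2 := continuous_sqn ch; have c3 := continuous_sqn cu.
have c4 := continuous_sqn cg; have c5 := continuous_sqn cz; have c6 := continuous_thw.
set U := prim (fun t => sqn (u t)) T; set Z := prim (fun t => sqn (z t)) T.
set V := prim (fun t => sqn (g t)) T; set Th := prim thw T.
move=> h1.
have V0 : 0 <= V by apply: prim_ge0 => // s _; exact: sqn_ge0.
have Th0 : 0 <= Th by apply: prim_ge0 => // s _; case/andP: (thw_bounds s).
have h2 : Z <= C1 * (4 * V + (D * sqn b * Th + (4 * C1)^-1 * U)).
  apply: le_trans h1 _; rewrite ler_pM2l// /V /Th /U -!prim_scale//.
  rewrite -!prim_add//; [|cont|cont|cont|].
    apply: ler_prim; [cont|cont|]; first by move=> s sT; rewrite addrA lerD ?hG ?hh.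
  by cont.
have h3 : U <= 2 * Z + 2 * (M * sqn b) * Th.
  rewrite /Z /Th -prim_lin//; apply: ler_prim => //; first by cont.
  move=> s /andP[s0 _]; have -> : u s = z s + p s by rewrite /z subrK.
  apply: le_trans (sqnD _ _) _; rewrite lerD2l -mulrA ler_pM2l// sqnZ mulrC.
  by apply: ler_pM; rewrite ?sqr_ge0 ?sqn_ge0// thq.
have e1 : C1 * (4 * V + (D * sqn b * Th + (4 * C1)^-1 * U)) =
  4 * (C1 * V) + C1 * D * (sqn b * Th) + U / 4 by field; rewrite gt_eqF.
rewrite e1 in h2.
have -> : (16 * C1 + 4 * C1 * D + 4 * M) * (sqn b * Th + V) =
  16 * (C1 * V) + 4 * (C1 * D * (sqn b * Th)) + 4 * (M * sqn b * Th) + (16 * (C1 * (sqn b * Th))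
   + (4 * (C1 * D * V) + 4 * (M * V))) by ring.
have b0 := sqn_ge0 b.
have q1 : 0 <= C1 * (sqn b * Th) by rewrite mulr_ge0 ?(ltW C10)// mulr_ge0.
have q2 : 0 <= C1 * D * V by rewrite mulr_ge0// mulr_ge0// ltW.
have q3 : 0 <= M * V by rewrite mulr_ge0.
rewrite -[2 * (M * _) * _]mulrA in h3.
move: (M * sqn b * Th) (C1 * V) (C1 * D * (sqn b * Th)) (C1 * (sqn b * Th))
  (C1 * D * V) (M * V) q1 q2 q3 h2 h3 => *.
lra.
Qed.
End perturbed_energy.

(** * From the integrated bound to a pointwise bound by time dilation *)

Section decay.
Context {R : realType} (d : nat).
Notation mu := (@lebesgue_measure R).
Local Notation I01 := (`[(0 : R), (1 : R)]%classic).
Implicit Types (v w b : 'cV[R]_d) (x y : R -> 'cV[R]_d) (g : R -> R) (a c t T al kap : R).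

Lemma is_derive_right_le g T (D : R) (K : R) (e : R) : 0 < e -> is_derive T 1 g D ->
  (forall h : R, 0 < h < e -> g (T + h) - g T <= K * h) -> D <= K.
Proof.
move=> e0 [dg <-] hK; have := @cvg_dnbhs_at_right _ _ _ _ _ dg.
move=> /cvgr_to_le; apply; near=> h.
have h0 : 0 < h by near: h; exact: nbhs_right_gt.
have he : h < e by near: h; exact: nbhs_right_lt.
rewrite /shift/= scaler1 ler_pdivrMl// [h * K]mulrC [h + T]addrC; apply: hK.
by rewrite h0.
Unshelve. all: by end_near. Qed.

Lemma prim_dil g c T : 0 < c -> prim g (c * T) = c * prim (fun s => g (c * s)) T.
Proof. by move=> c0; rewrite /prim RLk_scale// powR_inv1 ?ltW// mulVKf// gt_eqF. Qed.

Lemma prim_cst c T : 0 <= T -> prim (fun=> c) T = c * T.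
Proof.
move=> T0; rewrite primE//; last by cont.
transitivity (c * T - c * 0); last by rewrite mulr0 subr0.
apply: (@FTC2_oo R (fun t => c * t) (fun=> c)) => //; [cont|cont|] => x _.
by have h := is_derive_scale c (is_derive_id1 x); apply: is_derive_eq h _; rewrite mulr1.
Qed.

(** The coefficient of [v] is only slightly above 1, as needed when eta tends to 0 in the comparison
    of x(ct) with x(t). *)
Lemma sqnD_young v w (eta : R) : 0 < eta <= 1 ->
  sqn (v + w) <= 2 / eta * sqn w + (1 + eta) * sqn v.
Proof.
move=> /andP[e0 e1]; rewrite /sqn !mulr_sumr -big_split/=; apply: ler_sum => i _; rewrite mxE.
move: (v i ord0) (w i ord0) => p q.
have h1 : 0 <= (eta * p - q) ^+ 2 / eta by rewrite mulr_ge0 ?sqr_ge0// invr_ge0 ltW.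
have h2 : 0 <= (eta^-1 - 1) * q ^+ 2.
  by rewrite mulr_ge0 ?sqr_ge0// subr_ge0 -invr1 lef_pV2 ?posrE.
have e : (eta * p - q) ^+ 2 / eta = eta * p ^+ 2 - 2 * p * q + eta^-1 * q ^+ 2.
  by field; rewrite gt_eqF.
rewrite e in h1; move: (eta^-1) h1 h2 => f h1 h2; lra.
Qed.

Lemma RLv_dil al x c t : 0 < c ->
  RLv al (fun s => x (c * s)) t = c `^ (- al) *: RLv al x (c * t).
Proof. by move=> c0; apply/colP => i; rewrite !mxE (RLk_scale _ (fun s => x s i ord0)). Qed.

Lemma cvec_dil x c : cvec x -> cvec (fun t => x (c * t)).
Proof. by move=> cx i; have ci := cx i; exact: (continuous_scaler (t := c) ci). Qed.

Variables (A : 'M[R]_d) (al kap : R).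
Hypothesis al01 : 0 < al < 1.
Hypothesis kap0 : 0 < kap.
Hypothesis gA : forall lam, eigenvalue (map_mx (real_complex R) A) lam ->
  good_eigenvalue al lam.
Hypothesis uA : A \in unitmx.

Let a0 : 0 < al. Proof. by case/andP: al01. Qed.
Let a1 : al < 1. Proof. by case/andP: al01. Qed.
Let al1 : 0 < al <= 1. Proof. by rewrite a0 ltW. Qed.

Lemma prim_thw_le T : 0 <= T -> 0 <= prim (thw al) T <= T.
Proof.
move=> T0; have ct := @continuous_thw R al; apply/andP; split.
  by apply: prim_ge0 => // s _; case/andP: (thw_bounds al01 s).
rewrite -[leRHS]mul1r -prim_cst//; apply: ler_prim => //; first by cont.
by move=> s _; case/andP: (thw_bounds al01 s).
Qed.

(** The weight is nonincreasing on the positive half-line. *)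
Lemma prim_thw_dil c T : 1 <= c -> 0 <= T -> prim (thw al) (c * T) <= c * prim (thw al) T.
Proof.
move=> c1 T0; have c0 : 0 < c by exact: lt_le_trans ltr01 c1.
have ct := @continuous_thw R al.
rewrite (prim_dil _ _ c0); apply: ler_wpM2l; first exact: ltW.
apply: ler_prim => //; first by cont.
move=> s /andP[s0 _]; rewrite /thw /tpow !powRN lef_pV2 ?posrE ?powR_gt0 ?ltr_wpDr//.
apply: ge0_ler_powR; rewrite ?nnegrE ?addr_ge0//.
  by apply: mulr_ge0; rewrite ?subr_ge0 ltW.
by rewrite lerD2l normrM ler_peMl// gtr0_norm.
Qed.

Lemma onem_powRN_bounds c : 1 < c -> 0 <= 1 - c `^ (- al) <= c - 1.
Proof.
move=> c1; have c0 : 0 < c by exact: lt_trans c1.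
apply/andP; split.
  by rewrite subr_ge0 -(powRr0 c); apply: ler_powR; rewrite ?oppr_le0 ltW.
have : c^-1 <= c `^ (- al).
  by rewrite -powR_inv1 ?(ltW c0)//; apply: ler_powR; rewrite ?lerN2 ltW.
have : 2 - c <= c^-1.
  rewrite -subr_ge0; have -> : c^-1 - (2 - c) = (c - 1) ^+ 2 / c by field; rewrite gt_eqF.
  by rewrite mulr_ge0 ?sqr_ge0// invr_ge0 ltW.
lra.
Qed.

(** Let N(T) be the integral of |x|^2 over [0, T] and M(T) the weighted bound for it. The difference
    y(t) = x(ct) - x(t) satisfies the perturbed equation with data of size c - 1, so its energy is
    O((c-1)^2) M(T). Hence N(cT) - N(T) = O(c-1) M(T), and c -> 1 bounds T N'(T) = T |x(T)|^2
    without differentiating x. *)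
Lemma dilation_decay : exists eps C : R, [/\ 0 < eps, 0 < C &
  forall (ft : 'cV[R]_d -> 'cV[R]_d) x (x0 : 'cV[R]_d), cvec x -> cvec (fun t => ft (x t)) ->
  (forall t, 0 <= t -> x t = x0 + kap *: RLv al (fun s => A *m x s + ft (x s)) t) ->
  ft 0 = 0 -> (forall v w, sqn (ft v - ft w) <= eps * sqn (v - w)) ->
  forall T, 0 <= T -> T * sqn (x T) <= C * (sqn x0 * prim (thw al) T)].
Proof.
have [eps [C [eps0 C0 hE]]] := perturbed_energy al01 kap0 gA uA.
pose C4 := C * (1 + C).
exists eps; exists (C + 2 * (2 * C4 + C)); split=> //.
  have : 0 < C4 by rewrite mulr_gt0// addr_gt0.
  by move: C0; lra.
move=> ft x x0 cx cf ex f0 hf T; rewrite le_eqVlt => /predU1P[<-|T0].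
  by rewrite prim0 mul0r !mulr0.
have ct := @continuous_thw R al; have csx := continuous_sqn cx.
pose N := prim (fun t => sqn (x t)).
pose M t := sqn x0 * prim (thw al) t.
have hN t : 0 <= t -> N t <= C * M t.
  move=> t0; have := hE t x0 x (fun=> 0) (fun t => ft (x t)) t0 cx _ cf.
  rewrite (_ : prim (fun=> sqn (0 : 'cV[R]_d)) t = 0) ?addr0; last first.
    rewrite prim_cst// -[X in sqn X](scale0r 0) sqnZ expr0n/= !mul0r//.
  apply; first exact: cvec_cst.
    by move=> s /andP[s0 _]; exact: ex.
  by move=> s _; have := hf (x s) 0; rewrite f0 !subr0.
have M0 : 0 <= M T by rewrite mulr_ge0 ?sqn_ge0//; case/andP: (prim_thw_le (ltW T0)).
(* The restriction c <= 2 bounds the factor c from N(cT) = c X, where X is the integral of |x(ct)|^2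
   over [0, T]. *)
have key c : 1 < c <= 2 -> N (c * T) - N T <= (c - 1) * ((C + 2 * (2 * C4 + C)) * M T).
  move=> /andP[c1 c2]; have c0 : 0 < c by exact: lt_trans c1.
  pose l := 1 - c `^ (- al).
  have cg : cvec (fun t => l *: x (c * t)) by apply: cvecZ; exact: cvec_dil.
  have cd := cvec_dil (c := c) cx.
  have cNx : cvec (fun t => - x t).
    have -> : (fun t => - x t) = (fun t => -1 *: x t) by apply/funext => t; rewrite scaleN1r.
    exact: cvecZ.
  have cNf : cvec (fun t => - ft (x t)).
    have -> : (fun t => - ft (x t)) = (fun t => -1 *: ft (x t)) by apply/funext => t; rewrite scaleN1r.
    exact: cvecZ.
  have cfd := cvec_dil (c := c) cf.
  pose y t := x (c * t) - x t.
  have cy : cvec y by exact: cvecD.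
  pose h t := ft (x (c * t)) - ft (x t).
  have ch : cvec h by exact: cvecD.
  (* Scaling gives kap I(F(x(c .)))(t) = c^(-al) (x(ct) - x0). The mismatch l = 1 - c^(-al) is moved
     into the data -l x0 and l x(ct), both of size at most c - 1. *)
  have ey t : 0 <= t <= T ->
      y t = - (l *: x0) + l *: x (c * t) + kap *: RLv al (fun s => A *m y s + h s) t.
    move=> /andP[t0 _].
    have e1 := ex t t0; have e2 := ex (c * t) (mulr_ge0 (ltW c0) t0).
    pose F s := A *m x s + ft (x s).
    have cF : cvec F by apply: cvecD => //; exact: cvecM.
    have cNF : cvec (fun s => -1 *: F s) by exact: cvecZ.
    have -> : (fun s => A *m y s + h s) = (fun s => F (c * s) + -1 *: F s).
      by apply/funext => s; rewrite /y /h /F mulmxBr scaleN1r opprD addrACA.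
    rewrite RLvD//; last exact: (cvec_dil (c := c) cF).
    rewrite (RLv_dil _ F)//.
    have -> : RLv al (fun s => -1 *: F s) t = - RLv al F t.
      apply/colP => i; rewrite !mxE.
      transitivity (-1 * RLk al (fun s => F s i ord0) t + 0 * RLk al (fun s => F s i ord0) t); last by ring.
      by rewrite -RLk_lin//; congr RLk; apply/funext => s; rewrite mxE mul0r addr0.
    rewrite /y e1 -/F scalerDr scalerA [kap * _]mulrC -scalerA.
    have -> : kap *: RLv al F (c * t) = x (c * t) - x0 by rewrite e2 addrAC subrr add0r.
    rewrite scalerN; move: (kap *: RLv al F t) => z.
    by rewrite /l; apply/colP => i; rewrite !mxE; ring.
  have hh t : 0 <= t <= T -> sqn (h t) <= eps * sqn (y t) by move=> _; exact: hf.
  have := hE T _ y _ h (ltW T0) cy cg ch ey hh.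
  have /andP[l0 l1] := onem_powRN_bounds c1; rewrite -/l in l0 l1.
  have cs1 := continuous_sqn cd; have cs2 := continuous_sqn cy.
  have -> : prim (fun t => sqn (l *: x (c * t))) T = l ^+ 2 * prim (fun t => sqn (x (c * t))) T.
    by rewrite -prim_scale//; congr prim; apply/funext => t; rewrite sqnZ.
  rewrite sqnN sqnZ.
  have e3 : N (c * T) = c * prim (fun t => sqn (x (c * t))) T by rewrite /N prim_dil.
  set Y := prim (fun t => sqn (y t)) T; set X := prim (fun t => sqn (x (c * t))) T in e3 *.
  move=> hY.
  have hX : X <= C * M T.
    rewrite -(ler_pM2l c0) -e3; apply: le_trans (hN _ _) _; first by rewrite mulr_ge0 ?(ltW c0) ?(ltW T0).
    rewrite [leRHS]mulrCA (ler_pM2l C0) /M [leRHS]mulrCA ler_wpM2l ?sqn_ge0//.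
    by apply: prim_thw_dil; exact: ltW.
  pose eta := c - 1; have et0 : 0 < eta by rewrite subr_gt0.
  have et1 : eta <= 1 by rewrite /eta; lra.
  have hY2 : Y <= eta ^+ 2 * (C4 * M T).
    apply: le_trans hY _; have -> : eta ^+ 2 * (C4 * M T) = C * (eta ^+ 2 * (M T + C * M T)).
      by rewrite /C4; ring.
    rewrite ler_pM2l// -mulrA -mulrDr; apply: ler_pM.
    - exact: sqr_ge0.
    - rewrite addr_ge0//; apply: prim_ge0; rewrite ?ltW// => s _; exact: sqn_ge0.
    - by rewrite lerXn2r ?nnegrE// ltW.
    - by rewrite lerD2l.
  (* Young's inequality with eta = c - 1: as Y is O(eta^2), the term 2 Y / eta is still O(eta). *)
  have hXY : X <= 2 / eta * Y + (1 + eta) * N T.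
    rewrite /X /Y /N -prim_lin//; apply: ler_prim => //; first by cont.
    move=> s _; have -> : x (c * s) = x s + y s by rewrite /y addrC subrK.
    by apply: sqnD_young; rewrite et0.
  have hN' := hN T (ltW T0).
  have hXY2 : X <= N T + eta * ((2 * C4 + C) * M T).
    apply: le_trans hXY _.
    have : 2 / eta * Y <= eta * (2 * C4 * M T).
      have -> : eta * (2 * C4 * M T) = 2 / eta * (eta ^+ 2 * (C4 * M T)) by field; rewrite gt_eqF.
      by rewrite ler_wpM2l// divr_ge0// ltW.
    have : eta * N T <= eta * (C * M T) by rewrite ler_pM2l.
    move: (2 / eta * Y) => Z; lra.
  have : c * X <= c * (N T + eta * ((2 * C4 + C) * M T)) by rewrite ler_pM2l.
  have -> : c * (N T + eta * ((2 * C4 + C) * M T)) =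
    N T + eta * N T + c * (eta * ((2 * C4 + C) * M T)) by rewrite /eta; ring.
  rewrite -e3.
  have P0 : 0 <= (2 * C4 + C) * M T.
    by rewrite mulr_ge0// addr_ge0 ?(ltW C0)// /C4 !mulr_ge0 ?addr_ge0 ?(ltW C0).
  have : c * (eta * ((2 * C4 + C) * M T)) <= 2 * (eta * ((2 * C4 + C) * M T)).
    by rewrite ler_wpM2r// mulr_ge0// ltW.
  have : eta * N T <= eta * (C * M T) by rewrite ler_pM2l.
  rewrite -/eta.
  have -> : eta * ((C + 2 * (2 * C4 + C)) * M T) =
    eta * (C * M T) + 2 * (eta * ((2 * C4 + C) * M T)) by ring.
  move: (eta * ((2 * C4 + C) * M T)) => P; move: (eta * N T) (c * P) => p1 p2 h1 h2 h3; lra.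
have dN : is_derive T 1 N (sqn (x T)) by exact: (is_derive_prim T0 csx).
have : sqn (x T) <= (C + 2 * (2 * C4 + C)) * M T / T.
  (* The increment h corresponds to the dilation factor c = 1 + h/T, and h < T gives c <= 2. *)
  apply: (is_derive_right_le T0 dN) => h /andP[h0 hT].
  have -> : T + h = (1 + h / T) * T by field; rewrite gt_eqF.
  apply: le_trans (key _ _) _.
    by rewrite ltrDl divr_gt0//= -[2]/(1 + 1) lerD2l ler_pdivrMr// mul1r ltW.
  by rewrite le_eqVlt; apply/orP; left; apply/eqP; field; rewrite gt_eqF.
by rewrite ler_pdivlMr// [_ * T]mulrC.
Qed.
End decay.

(** * Algebraic decay of solutions of the Volterra equation *)

Section solution_decay.
Context {R : realType} (d : nat).
Notation mu := (@lebesgue_measure R).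
Local Notation I01 := (`[(0 : R), (1 : R)]%classic).
Local Notation Io := (`](0 : R), (1 : R)]%classic).
Variables (A : 'M[R]_d) (al kap : R).
Hypothesis al01 : 0 < al < 1.
Hypothesis kap0 : 0 < kap.
Hypothesis gA : forall lam, eigenvalue (map_mx (real_complex R) A) lam ->
  good_eigenvalue al lam.
Hypothesis uA : A \in unitmx.

Let a0 : 0 < al. Proof. by case/andP: al01. Qed.
Let a1 : al < 1. Proof. by case/andP: al01. Qed.
Let p := al * (1 - al).

(** After rescaling to [0, 1], the weight at T s is at most (T s)^(-p), and s^(-p) is integrable
    because p = al (1-al) < 1. *)
Lemma prim_thw_decay : exists C : R, 0 < C /\
  forall T, 0 < T -> prim (thw al) T <= C * T * T `^ (- p).
Proof.
have p0 : 0 < p by rewrite mulr_gt0// subr_gt0.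
have p1 : p < 1.
  by apply: (@le_lt_trans _ _ (1 - al)); rewrite ?gtrBl// ler_piMl ?subr_ge0 ?(ltW a1).
have ip : mu.-integrable I01 (EFin \o (fun s => s `^ ((1 - p) - 1))).
  by apply: integrable_powR01; rewrite subr_gt0 p1 gerBl ltW.
have I0 : 0 <= \int[mu]_(s in Io) s `^ ((1 - p) - 1).
  by apply: Rintegral_ge0 => s _; exact: powR_ge0.
exists (1 + \int[mu]_(s in Io) s `^ ((1 - p) - 1)); split; first by rewrite ltr_wpDr.
move=> T T0; rewrite /prim /RLk ppowE ?(ltW T0)// powRr1 ?(ltW T0)//.
have l01 : 0 < (1 : R) <= 1 by rewrite ltr01 lexx.
have ct := continuous_scaler (t := T) (@continuous_thw R al).
have [i1 e1] := Io_int (integrable_Wint_cont l01 ct).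
have [i2 _] := Io_int ip.
rewrite /Wint e1 [_ * T]mulrC -mulrA ler_pM2l//.
apply: (@le_trans _ _ (\int[mu]_(s in Io) (T `^ (- p) * s `^ ((1 - p) - 1)))).
  apply: le_Rintegral => //.
    exact: (@integrableZl _ _ R mu _ (measurable_itv _) (T `^ (- p)) _ i2).
  move=> s; rewrite /= in_itv/= => /andP[s0 s1].
  rewrite subrr powRr0 mul1r (_ : 1 - p - 1 = - p); last by ring.
  have Ts : 0 < T * s by rewrite mulr_gt0.
  rewrite -powRM ?(ltW T0) ?(ltW s0)// /thw /tpow !powRN lef_pV2 ?posrE ?powR_gt0 ?ltr_wpDr//.
  apply: ge0_ler_powR; rewrite ?nnegrE ?(ltW p0) ?(ltW Ts) ?addr_ge0//.
  by rewrite gtr0_norm// lerDr.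
by rewrite RintegralZl// mulrC ler_wpM2r ?powR_ge0// lerDr.
Qed.

(** Both bounds come from T |x(T)|^2 <= C |x0|^2 times the primitive of the weight at T: that
    primitive is at most T, and also at most a multiple of T^(1-p). *)
Lemma solution_decay : exists eps C : R, [/\ 0 < eps, 0 < C &
  forall (ft : 'cV[R]_d -> 'cV[R]_d) (x : R -> 'cV[R]_d) (x0 : 'cV[R]_d),
  cvec x -> cvec (fun t => ft (x t)) ->
  (forall t, 0 <= t -> x t = x0 + kap *: RLv al (fun s => A *m x s + ft (x s)) t) ->
  ft 0 = 0 -> (forall v w, sqn (ft v - ft w) <= eps * sqn (v - w)) ->
  forall t, 0 <= t -> sqn (x t) <= C * sqn x0 /\ t `^ p * sqn (x t) <= C * sqn x0].
Proof.
have p0 : 0 < p by rewrite mulr_gt0// subr_gt0.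
have [eps [C [eps0 C0 hD]]] := dilation_decay al01 kap0 gA uA.
have [D [D0 hT]] := prim_thw_decay.
exists eps; exists (1 + C + C * D); split=> //.
  by rewrite addr_gt0 ?mulr_gt0// addr_gt0.
move=> ft x x0 cx cf ex f0 hf t; rewrite le_eqVlt => /predU1P[<-|t0].
  have e : x 0 = x0.
    rewrite ex//; apply/colP => i; rewrite !mxE RLk_le0// mulr0 addr0//.
  rewrite e powR0 ?gt_eqF// mul0r; have := sqn_ge0 x0.
  split; last by rewrite mulr_ge0// ltW// addr_gt0 ?mulr_gt0// addr_gt0.
  by rewrite -[leLHS]mul1r ler_wpM2r// -addrA lerDl addr_ge0 ?mulr_ge0// ltW.
have h1 := hD ft x x0 cx cf ex f0 hf t (ltW t0).
have x00 := sqn_ge0 x0.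
have CD : 0 < C * D by rewrite mulr_gt0.
split.
  rewrite -(ler_pM2l t0); apply: le_trans h1 _.
  have -> : t * ((1 + C + C * D) * sqn x0) = C * (sqn x0 * t) + (1 + C * D) * (sqn x0 * t) by ring.
  apply: ler_wpDr; first by rewrite mulr_ge0 ?mulr_ge0 ?addr_ge0 ?(ltW CD) ?(ltW t0).
  rewrite ler_pM2l//; apply: ler_wpM2l => //.
  by case/andP: (prim_thw_le al01 (ltW t0)).
have tp : 0 < t `^ p by rewrite powR_gt0.
rewrite -(ler_pM2l t0) mulrCA.
apply: (@le_trans _ _ (t `^ p * (C * (sqn x0 * (D * t * t `^ (- p)))))).
  rewrite ler_pM2l//; apply: le_trans h1 _; rewrite ler_pM2l//; apply: ler_wpM2l => //.
  exact: hT.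
rewrite powRN.
have -> : t `^ p * (C * (sqn x0 * (D * t / t `^ p))) = t * (C * D * sqn x0).
  by move: (t `^ p) tp => q q0; field; rewrite gt_eqF.
by rewrite ler_pM2l//; apply: ler_wpM2r => //; rewrite lerDr addr_ge0// ltW.
Qed.
End solution_decay.

(** * Contraction estimates for the fractional integral *)

Section picard.
Context {R : realType}.
Notation mu := (@lebesgue_measure R).
Local Notation I01 := (`[(0 : R), (1 : R)]%classic).
Local Notation Ic := (`[(0 : R), (1 : R)[%classic).

Lemma ler_geo (a b c : R) : (forall m : nat, a <= b + c / 2 ^+ m) -> a <= b.
Proof.
move=> h; apply/ler_addgt0Pr => e e0.
have [c0|c0] := leP c 0.
  by have := h 0%N; rewrite expr0 divr1; move: c0 e0; lra.
apply: le_trans (h (Num.bound (c / e))) _; rewrite lerD2l.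
have := archi_boundP (divr_ge0 (ltW c0) (ltW e0)); set m := Num.bound _ => hm.
rewrite ler_pdivrMr ?exprn_gt0// mulrC -ler_pdivrMr//.
apply: le_trans (ltW hm) _; rewrite -natrX ler_nat.
by apply: ltnW; exact: ltn_expl.
Qed.

(** The limit satisfies the estimate with every admissible constant E', not only with the given E.
    This matters because the Cauchy constant of the Picard iterates depends on the time horizon,
    while the limit must be chosen once for each time. *)
Lemma geo_limit (u : nat -> R) (E : R) :
  (forall n m, (n <= m)%N -> `|u m - u n| <= E / 2 ^+ n) ->
  exists l, forall E', (forall n m, (n <= m)%N -> `|u m - u n| <= E' / 2 ^+ n) ->
    forall n, `|u n - l| <= E' / 2 ^+ n.
Proof.
move=> hE.
have E0 n : 0 <= E / 2 ^+ n by have := hE n n (leqnn n); rewrite subrr normr0.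
pose S : set R := range (fun n => u n - E / 2 ^+ n).
have ubS m : ubound S (u m + E / 2 ^+ m).
  move=> _ [n _ <-]; have [nm|mn] := leqP n m.
    by have := hE n m nm; rewrite ler_norml => /andP[]; have := E0 m; lra.
  by have := hE m n (ltnW mn); rewrite ler_norml => /andP[]; have := E0 n; lra.
have S0 : S !=set0 by exists (u 0%N - E / 2 ^+ 0); exists 0%N.
have hl n : `|u n - sup S| <= E / 2 ^+ n.
  rewrite ler_norml; apply/andP; split.
    by have : sup S <= u n + E / 2 ^+ n by [exact: ge_sup]; lra.
  have : u n - E / 2 ^+ n <= sup S.
    by apply: ub_le_sup; [exists (u 0%N + E / 2 ^+ 0); exact: ubS|exists n].
  lra.
exists (sup S) => E' hE' n; apply: (@ler_geo _ _ (E + E')) => m.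
have [nm|mn] := leqP n m.
  have h1 := hE' n m nm; have h2 := hl m; have h3 := ler_distD (u m) (u n) (sup S).
  rewrite distrC in h1.
  have : 0 <= E' / 2 ^+ m by have := hE' m m (leqnn m); rewrite subrr normr0.
  by rewrite mulrDl; lra.
have h1 := hE' m n (ltnW mn); have h2 := hl m; have h3 := ler_distD (u m) (u n) (sup S).
have : 0 <= E' / 2 ^+ n by have := hE' n n (leqnn n); rewrite subrr normr0.
by rewrite mulrDl; lra.
Qed.

Lemma powR_le_expR (y a : R) : 0 < y -> 0 < a <= 1 -> y `^ a <= expR y.
Proof.
move=> y0 /andP[a0 a1]; have [y1|y1] := leP y 1.
  apply: (@le_trans _ _ 1); last by rewrite -expR0 ler_expR ltW.
  have <- : (1 : R) `^ a = 1 by rewrite powR1.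
  by apply: ge0_ler_powR; rewrite ?nnegrE// ltW.
apply: (@le_trans _ _ y); first by apply: ler1_powR => //; exact: ltW.
by have := expR_ge1Dx y; lra.
Qed.

(** Bielecki's weight: for lam large, K I is a contraction by 1/2 on [0, T] in the norm weighted by
    exp(-lam t). *)
Lemma bielecki (al K T : R) : 0 < al <= 1 -> 0 < K -> 0 < T ->
  exists lam : R, 0 < lam /\ forall t, 0 <= t <= T ->
    K * RLk al (fun s => expR (lam * s)) t <= expR (lam * t) / 2.
Proof.
move=> al01 K0 T0; have /andP[a0 a1] := al01.
have h01 : 0 < al / 2 <= 1 by apply/andP; split; [rewrite divr_gt0|lra].
have /andP[h0 h1] := h01.
pose c := Wint (al / 2) (fun=> 1 : R).
have c0 : 0 < c by exact: Wint1_gt0.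
have Kc : 0 < 2 * K * c by rewrite !mulr_gt0.
(* Solves K c (T/lam)^(al/2) = 1/2. *)
pose lam := T * (2 * K * c) `^ (2 / al).
have l0 : 0 < lam by apply: mulr_gt0 => //; exact: powR_gt0.
exists lam; split => // t /andP[]; rewrite le_eqVlt => /predU1P[<- _|t0 tT].
  by rewrite RLk_le0// mulr0 divr_ge0// expR_ge0.
have lt0 : 0 < lam * t by rewrite mulr_gt0.
have ce : continuous (fun s : R => expR (lam * s)) by cont.
have i1 := integrable_Wint_cont al01 (continuous_scaler (t := t) ce).
have ct1 : continuous ((fun=> 1) : R -> R) by cont.
have i2 := integrable_Wint_cont h01 ct1.
have I1 : mu.-integrable Ic (EFin \o (fun s => (1 - s) `^ (al - 1) * expR (lam * (t * s)))).
  by apply: integrableS i1 => //; exact: subset_itv_co_cc.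
have I2 : mu.-integrable Ic (EFin \o (fun s : R => (1 - s) `^ (al / 2 - 1) * 1)).
  by apply: integrableS i2 => //; exact: subset_itv_co_cc.
pose k := expR (lam * t) * (lam * t) `^ (- (al / 2)).
have hW : Wint al (fun s => expR (lam * (t * s))) <= k * c.
  rewrite /c /Wint -Rintegral_itv_bndo_bndc// -[X in _ <= _ * X]Rintegral_itv_bndo_bndc//.
  rewrite -RintegralZl//; apply: le_Rintegral => //.
    exact: (@integrableZl _ _ R mu _ (measurable_itv _) k _ I2).
  move=> s; rewrite /= in_itv/= => /andP[s0 s1].
  have s1' : 0 < 1 - s by rewrite subr_gt0.
  have y0 : 0 < lam * t * (1 - s) by rewrite mulr_gt0.
  have -> : lam * (t * s) = lam * t - lam * t * (1 - s) by ring.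
  rewrite expRD /k mulr1 mulrCA -[leRHS]mulrA ler_pM2l ?expR_gt0//.
  (* Half of the order keeps the singularity at s = 1 integrable; the other half is traded for
     smallness through y^(al/2) <= exp(y) with y = lam t (1-s). *)
  have -> : al - 1 = (al / 2 - 1) + al / 2 by field.
  rewrite [X in X * _ <= _]powRD ?(gt_eqF s1') ?implybT// [leRHS]mulrC -[leLHS]mulrA ler_pM2l ?powR_gt0//.
  rewrite expRN ler_pdivrMr ?expR_gt0// powRN [leRHS]mulrC ler_pdivlMr ?powR_gt0//.
  by rewrite -powRM ?(ltW lt0) ?(ltW s1')// [X in X `^ _]mulrC; apply: powR_le_expR.
rewrite /RLk ppowE ?(ltW t0)//.
apply: (@le_trans _ _ (K * (t `^ al * (k * c)))).
  by rewrite ler_pM2l// ler_pM2l ?powR_gt0.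
have -> : K * (t `^ al * (k * c)) = expR (lam * t) * (K * c * (t / lam) `^ (al / 2)).
  have -> : (t / lam) `^ (al / 2) = t `^ (al / 2) / lam `^ (al / 2).
    rewrite powRM ?invr_ge0 ?(ltW l0) ?(ltW t0)// -[lam^-1]powR_inv1 ?(ltW l0)//.
    by rewrite -powRrM mulN1r powRN.
  have -> : k = expR (lam * t) / (lam `^ (al / 2) * t `^ (al / 2)).
    by rewrite /k powRN powRM ?(ltW l0) ?(ltW t0).
  have -> : t `^ al = t `^ (al / 2) * t `^ (al / 2).
    by rewrite -powRD ?(gt_eqF t0) ?implybT//; congr powR; field.
  have : t `^ (al / 2) != 0 by rewrite gt_eqF ?powR_gt0.
  have : lam `^ (al / 2) != 0 by rewrite gt_eqF ?powR_gt0.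
  by move: (t `^ _) (lam `^ _) (expR _) => x y z y0 x0; field; rewrite x0 y0.
rewrite ler_pM2l ?expR_gt0//.
apply: (@le_trans _ _ (K * c * (T / lam) `^ (al / 2))).
  rewrite ler_pM2l ?mulr_gt0//; apply: ge0_ler_powR; rewrite ?nnegrE ?(ltW h0)//.
  - by rewrite divr_ge0 ?ltW.
  - by rewrite divr_ge0 ?ltW.
  - by rewrite ler_pM2r ?invr_gt0.
have -> : T / lam = (2 * K * c) `^ (- (2 / al)).
  by rewrite /lam powRN; field; rewrite !gt_eqF ?powR_gt0.
rewrite -powRrM (_ : - (2 / al) * (al / 2) = -1); last by field; rewrite gt_eqF.
rewrite powR_inv1 ?(ltW Kc)// le_eqVlt; apply/orP; left; apply/eqP.
by field; rewrite !gt_eqF.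
Qed.

(** Each step halves the bound in the weighted norm; the constant exp(lam T) is the price for
    returning to the supremum norm. *)
Lemma RLk_iter_bound (al K T : R) : 0 < al <= 1 -> 0 < K -> 0 < T ->
  exists E : R, 0 < E /\ forall (z : nat -> R -> R) (M : R),
  (forall n, continuous (z n)) -> 0 <= M ->
  (forall t, 0 <= t <= T -> z 0%N t <= M) ->
  (forall n t, 0 <= t <= T -> z n.+1 t <= K * RLk al (z n) t) ->
  forall n t, 0 <= t <= T -> z n t <= E * M / 2 ^+ n.
Proof.
move=> al01 K0 T0; have [lam [l0 hl]] := bielecki al01 K0 T0.
exists (expR (lam * T)); split; first exact: expR_gt0.
move=> z M cz M0 z0 hz.
suff h n t : 0 <= t <= T -> z n t <= M / 2 ^+ n * expR (lam * t).
  move=> n t tT; apply: le_trans (h n t tT) _.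
  rewrite -[leRHS]mulrA [leRHS]mulrC.
  apply: ler_wpM2l; first by rewrite divr_ge0// exprn_ge0.
  by rewrite ler_expR ler_pM2l//; case/andP: tT.
have ce : continuous (fun s : R => expR (lam * s)) by cont.
elim: n t => [|n IH] t tT.
  apply: le_trans (z0 t tT) _; rewrite expr0 divr1 ler_peMr//.
  by rewrite -expR0 ler_expR mulr_ge0 ?(ltW l0)//; case/andP: tT.
apply: le_trans (hz n t tT) _; have /andP[t0 tT'] := tT.
pose e s := expR (lam * s).
have : RLk al (z n) t <= RLk al (fun s => M / 2 ^+ n * e s + 0 * e s) t.
  apply: ler_RLk => //; first by rewrite /e; cont.
  by move=> s /andP[s0 st]; rewrite mul0r addr0 IH// s0 (le_trans st).
rewrite RLk_lin// mul0r addr0 => h.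
apply: (@le_trans _ _ (K * (M / 2 ^+ n * RLk al e t))); first by rewrite ler_pM2l.
have -> : M / 2 ^+ n.+1 * expR (lam * t) = M / 2 ^+ n * (expR (lam * t) / 2).
  by rewrite exprS; field; rewrite expf_neq0.
by rewrite mulrCA; apply: ler_wpM2l; [rewrite divr_ge0// exprn_ge0|exact: hl].
Qed.

(** The iteration bound for the constant sequence [z] gives z <= E M / 2^n for every n. *)
Lemma RLk_gronwall (al K T : R) (z : R -> R) : 0 < al <= 1 -> 0 < K -> continuous z ->
  (forall t, 0 <= t <= T -> z t <= K * RLk al z t) ->
  forall t, 0 <= t <= T -> z t <= 0.
Proof.
move=> al01 K0 cz hz t; have [T0|T0] := ltP 0 T; last first.
  move=> /andP[t0 tT]; have : z t <= K * RLk al z t by apply: hz; rewrite t0.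
  have -> : t = 0 by apply/le_anti; rewrite t0 (le_trans tT).
  by rewrite RLk_le0 ?mulr0//; case/andP: al01.
have [E [E0 hE]] := RLk_iter_bound al01 K0 T0.
have [M [M0 hM]] := continuous_bounded T cz.
have h := hE (fun=> z) M (fun=> cz) M0 _ (fun=> hz).
move=> tT; apply: (@ler_geo _ 0 (E * M)) => m; rewrite add0r.
by apply: h => // s sT; exact: le_trans (ler_norm _) (hM s sT).
Qed.
End picard.

(** * Global existence and uniqueness for a Lipschitz right-hand side *)

Section vector_picard.
Context {R : realType} (d : nat).
Notation mu := (@lebesgue_measure R).
Implicit Types (v w : 'cV[R]_d) (x y : R -> 'cV[R]_d) (t T al kap : R).

(** The l1 norm is used here because it passes through the componentwise operator [RLv] by a finite
    sum of scalar estimates, see [n1_RLv]. *)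
Definition n1 v : R := \sum_i `|v i ord0|.

Lemma n1_ge0 v : 0 <= n1 v.
Proof. exact: sumr_ge0. Qed.

Lemma n1_0 : n1 0 = 0.
Proof. by rewrite /n1 big1// => i _; rewrite mxE normr0. Qed.

Lemma n1N v : n1 (- v) = n1 v.
Proof. by apply: eq_bigr => i _; rewrite mxE normrN. Qed.

Lemma n1D v w : n1 (v + w) <= n1 v + n1 w.
Proof. by rewrite -big_split/=; apply: ler_sum => i _; rewrite mxE ler_normD. Qed.

Lemma n1Z a v : n1 (a *: v) = `|a| * n1 v.
Proof. by rewrite mulr_sumr; apply: eq_bigr => i _; rewrite mxE normrM. Qed.

Lemma ler_n1 v i : `|v i ord0| <= n1 v.
Proof. by rewrite /n1 (bigD1 i)//= lerDl sumr_ge0. Qed.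

Lemma n1_eq0 v : n1 v <= 0 -> v = 0.
Proof.
move=> v0; apply/colP => i; rewrite mxE; apply/normr0_eq0/le_anti.
by rewrite normr_ge0 (le_trans (ler_n1 v i)).
Qed.

Lemma n1_distD v w u : n1 (v - w) <= n1 (v - u) + n1 (u - w).
Proof. by apply: le_trans (n1D _ _); rewrite addrA subrK. Qed.

Lemma sqn_le_n1 v : sqn v <= n1 v ^+ 2.
Proof.
rewrite expr2 {1}/n1 mulr_suml; apply: ler_sum => i _.
by rewrite -(real_normK (num_real _)) expr2 ler_wpM2l// ler_n1.
Qed.

Lemma n1_le_sqn v : n1 v ^+ 2 <= (1 + d%:R) * sqn v.
Proof.
have := sum_sqr_le (fun=> 1) (fun i => `|v i ord0|).
under eq_bigr do rewrite mul1r.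
under [X in _ * X]eq_bigr do rewrite real_normK ?num_real//.
by under [X in 1 + X]eq_bigr do rewrite expr1n; rewrite sumr_const card_ord.
Qed.

Lemma continuous_n1 x : cvec x -> continuous (fun t => n1 (x t)).
Proof.
move=> cx t; apply: (@continuous_for_bigsum R _ _ (fun i s => `|x s i ord0|)) => i s.
by apply: cvg_norm; exact: cx.
Qed.

Lemma cvecN x : cvec x -> cvec (fun t => - x t).
Proof.
move=> cx; have -> : (fun t => - x t) = (fun t => -1 *: x t).
  by apply/funext => t; rewrite scaleN1r.
exact: cvecZ.
Qed.

Lemma cvecB x y : cvec x -> cvec y -> cvec (fun t => x t - y t).
Proof. by move=> cx cy; apply: cvecD => //; exact: cvecN. Qed.

Lemma RLvB al x y t : 0 < al <= 1 -> cvec x -> cvec y ->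
  RLv al x t - RLv al y t = RLv al (fun s => x s - y s) t.
Proof.
move=> al01 cx cy; apply/colP => i; rewrite !mxE.
transitivity (1 * RLk al (fun s => x s i ord0) t + -1 * RLk al (fun s => y s i ord0) t).
  by rewrite mul1r mulN1r.
by rewrite -RLk_lin//; congr RLk; apply/funext => s; rewrite !mxE mul1r mulN1r.
Qed.

Lemma n1_RLv al x t : 0 < al <= 1 -> cvec x -> n1 (RLv al x t) <= RLk al (fun s => n1 (x s)) t.
Proof.
move=> al01 cx.
have -> : (fun s => n1 (x s)) = (fun s => \sum_i 1 * `|x s i ord0|).
  by apply/funext => s; apply: eq_bigr => i _; rewrite mul1r.
rewrite (RLk_bigsum _ (F := fun i s => `|x s i ord0|))//; last first.
  by move=> i s; apply: cvg_norm; exact: cx.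
by apply: ler_sum => i _; rewrite mul1r mxE; apply: RLk_norm.
Qed.

Definition n1_lipschitz (L : R) (F : 'cV[R]_d -> 'cV[R]_d) :=
  forall v w, n1 (F v - F w) <= L * n1 (v - w).

Lemma cvec_lip L F x : 0 < L -> n1_lipschitz L F -> cvec x -> cvec (fun t => F (x t)).
Proof.
move=> L0 hF cx i t; apply/cvgrPdist_le => e e0.
have cc : cvec (fun=> x t) by exact: cvec_cst.
have c1 := continuous_n1 (cvecB cc cx).
have : {for t, continuous (fun s => n1 (x t - x s))} by exact: c1.
rewrite /prop_for/= /continuous_at subrr => /cvgrPdist_le/(_ (e / L)); rewrite divr_gt0// => /(_ isT).
apply: filterS => s.
rewrite n1_0 sub0r normrN (ger0_norm (n1_ge0 _)) ler_pdivlMr// mulrC; apply: le_trans.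
apply: le_trans (hF _ _); apply: le_trans (ler_n1 _ i).
by rewrite !mxE.
Qed.

Variables (al kap L : R) (F : 'cV[R]_d -> 'cV[R]_d).
Hypothesis al1 : 0 < al <= 1.
Hypothesis kap0 : 0 < kap.
Hypothesis L0 : 0 < L.
Hypothesis hF : n1_lipschitz L F.

Lemma RLv_lip x y t : cvec x -> cvec y ->
  n1 (kap *: RLv al (fun s => F (x s)) t - kap *: RLv al (fun s => F (y s)) t) <=
  (kap * L) * RLk al (fun s => n1 (x s - y s)) t.
Proof.
move=> cx cy; have cFx := cvec_lip L0 hF cx; have cFy := cvec_lip L0 hF cy.
rewrite -scalerBr n1Z gtr0_norm// RLvB// -mulrA ler_pM2l//.
apply: le_trans (n1_RLv _ al1 (cvecB cFx cFy)) _.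
have c1 := continuous_n1 (cvecB cFx cFy); have c2 := continuous_n1 (cvecB cx cy).
rewrite -[leRHS]addr0 -[X in _ + X](mul0r (RLk al (fun s => n1 (x s - y s)) t)) -RLk_lin//.
by apply: ler_RLk => //; [cont|move=> s _; rewrite mul0r addr0; exact: hF].
Qed.

(** The function n1(x - y) is bounded by kap L times its own fractional integral, so [RLk_gronwall]
    forces it to vanish. *)
Lemma volterra_unique T x y (x0 : 'cV[R]_d) : cvec x -> cvec y ->
  (forall t, 0 <= t <= T -> x t = x0 + kap *: RLv al (fun s => F (x s)) t) ->
  (forall t, 0 <= t <= T -> y t = x0 + kap *: RLv al (fun s => F (y s)) t) ->
  forall t, 0 <= t <= T -> x t = y t.
Proof.
move=> cx cy hx hy t tT; apply/subr0_eq/n1_eq0.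
have c2 := continuous_n1 (cvecB cx cy).
apply: (RLk_gronwall al1 (mulr_gt0 kap0 L0) c2 _ tT) => s sT.
by rewrite [X in n1 X](_ : _ = kap *: RLv al (fun s => F (x s)) s -
    kap *: RLv al (fun s => F (y s)) s) ?RLv_lip// hx// hy// opprD addrACA subrr add0r.
Qed.

Fixpoint picard (x0 : 'cV[R]_d) n : R -> 'cV[R]_d :=
  if n is n'.+1 then fun t => x0 + kap *: RLv al (fun s => F (picard x0 n' s)) t
  else fun=> x0.

Lemma cvec_picard (x0 : 'cV[R]_d) n : cvec (picard x0 n).
Proof.
elim: n => [|n IH] /=; first exact: cvec_cst.
by apply: cvecD; [exact: cvec_cst|apply: cvecZ; apply: cvec_RLv => //; exact: (cvec_lip L0 hF)].
Qed.

Lemma picard_le0 (x0 : 'cV[R]_d) n t : t <= 0 -> picard x0 n t = x0.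
Proof.
case: n => [//|n] t0 /=; apply/colP => i; rewrite !mxE RLk_le0 ?mulr0 ?addr0//.
by case/andP: al1.
Qed.

(** Successive differences decay geometrically by [RLk_iter_bound], and their sum telescopes.
    Negative times are covered as well, since all iterates equal [x0] there. *)
Lemma picard_cauchy (x0 : 'cV[R]_d) T : exists E, 0 <= E /\ forall n m t, (n <= m)%N -> t <= T ->
  n1 (picard x0 m t - picard x0 n t) <= E / 2 ^+ n.
Proof.
have [T' [T'0 TT']] : exists T', 0 < T' /\ T <= T'.
  by exists (1 + `|T|); rewrite ltr_wpDr//; split=> //; have := ler_norm T; lra.
have [E [E0 hE]] := RLk_iter_bound al1 (mulr_gt0 kap0 L0) T'0.
pose z n t := n1 (picard x0 n.+1 t - picard x0 n t).
have cz n : continuous (z n) by apply: continuous_n1; apply: cvecB; exact: cvec_picard.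
have [M [M0 hM]] := continuous_bounded T' (cz 0%N).
have hz n t : t <= T -> z n t <= E * M / 2 ^+ n.
  move=> tT; have [t0|t0] := leP t 0.
    rewrite /z !picard_le0// subrr n1_0.
    by rewrite divr_ge0 ?exprn_ge0// mulr_ge0// ltW.
  apply: (hE z M cz M0); last by rewrite (ltW t0) (le_trans tT).
    by move=> s sT; apply: le_trans (ler_norm _) (hM s sT).
  move=> k s sT; rewrite [z k.+1 s](_ : _ = n1 (kap *: RLv al (fun s => F (picard x0 k.+1 s)) s -
    kap *: RLv al (fun s => F (picard x0 k s)) s)); last first.
    by rewrite /z [picard x0 k.+2]/= [picard x0 k.+1 in X in _ - X]/= opprD addrACA subrr add0r.
  by apply: RLv_lip; exact: cvec_picard.
exists (2 * (E * M)); split; first by rewrite !mulr_ge0// ltW.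
move=> n m t nm tT; rewrite -(subnKC nm).
have EM : 0 <= E * M by rewrite mulr_ge0// ltW.
(* The subtracted term is the remaining tail of the geometric series, which makes the induction on
   [k] close exactly. *)
suff h k : n1 (picard x0 (n + k) t - picard x0 n t) <=
    2 * (E * M) / 2 ^+ n - 2 * (E * M) / 2 ^+ (n + k).
  by apply: le_trans (h _) _; rewrite gerBl divr_ge0 ?exprn_ge0// mulr_ge0.
elim: k => [|k IH]; first by rewrite addn0 !subrr n1_0.
apply: le_trans (n1_distD _ _ (picard x0 (n + k) t)) _; rewrite addnS.
have := hz (n + k)%N t tT; rewrite /z.
have -> : 2 * (E * M) / 2 ^+ (n + k).+1 = E * M / 2 ^+ (n + k).
  by rewrite exprS; field; rewrite expf_neq0.
have e : 2 * (E * M) / 2 ^+ (n + k) = 2 * (E * M / 2 ^+ (n + k)) by rewrite !mulrA.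
rewrite e in IH; move: IH; move: (E * M / 2 ^+ (n + k)) (2 * (E * M) / 2 ^+ n) (n1 _) (n1 _) => a b c c'.
by lra.
Qed.

(** The limit is taken pointwise in time. On each half-line t <= T convergence is uniform, which
    gives continuity and lets the integral equation pass to the limit. *)
Lemma picard_exists (x0 : 'cV[R]_d) : exists x, cvec x /\
  forall t, 0 <= t -> x t = x0 + kap *: RLv al (fun s => F (x s)) t.
Proof.
have /choice[x hx] : forall t, exists v, forall E,
    (forall n m, (n <= m)%N -> n1 (picard x0 m t - picard x0 n t) <= E / 2 ^+ n) ->
    forall n i, `|picard x0 n t i ord0 - v i ord0| <= E / 2 ^+ n.
  move=> t; have [E [E0 hE]] := picard_cauchy x0 t.
  have co E' n m i : n1 (picard x0 m t - picard x0 n t) <= E' / 2 ^+ n ->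
      `|picard x0 m t i ord0 - picard x0 n t i ord0| <= E' / 2 ^+ n.
    by apply: le_trans; apply: le_trans (ler_n1 _ i); rewrite !mxE.
  have /choice[l hl] : forall i, exists l, forall E',
    (forall n m, (n <= m)%N -> `|picard x0 m t i ord0 - picard x0 n t i ord0| <= E' / 2 ^+ n) ->
    forall n, `|picard x0 n t i ord0 - l| <= E' / 2 ^+ n.
    by move=> i; apply: (geo_limit (E := E)) => n m nm; apply: co; exact: hE.
  exists (\col_i l i) => E' h n i; rewrite mxE; apply: hl => k m km.
  by apply: co; exact: h.
have hT T : exists E, 0 <= E /\ forall n t, t <= T -> forall i,
    `|picard x0 n t i ord0 - x t i ord0| <= E / 2 ^+ n.
  have [E [E0 hE]] := picard_cauchy x0 T; exists E; split=> // n t tT i.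
  by apply: hx => k m km; exact: hE.
have small (E e : R) : 0 < e -> exists n : nat, E / 2 ^+ n < e.
  move=> e0; case: (pselect (exists n : nat, E / 2 ^+ n < e)) => // /forallNP h.
  suff : e <= 0 by rewrite leNgt e0.
  by apply: (@ler_geo _ _ _ E) => m; rewrite add0r leNgt; apply/negP; exact: h.
have cx : cvec x.
  move=> i t; have [E [E0 hE]] := hT (t + 1); apply/cvgrPdist_le => e e0.
  have e30 : 0 < e / 3 by rewrite divr_gt0.
  have [n hn] := small E _ e30.
  have : {for t, continuous (fun s => picard x0 n s i ord0)} by exact: cvec_picard.
  move=> /cvgrPdist_le/(_ _ e30).
  have nt : \forall s \near t, s < t + 1 by apply: lt_nbhsl; rewrite ltrDl.
  move=> hp; near=> s.
  have s1 : s <= t + 1 by apply: ltW; near: s.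
  have p1 := hE n t _ i; have p2 := hE n s s1 i.
  have p3 : `|picard x0 n t i ord0 - picard x0 n s i ord0| <= e / 3 by near: s.
  have := p1 (ltac:(by rewrite lerDl)).
  move: (picard x0 n t i ord0) (picard x0 n s i ord0) (x t i ord0) (x s i ord0) p2 p3 => a b c c'.
  by move: hn; rewrite !ler_norml => hn /andP[q1 q2] /andP[q3 q4] /andP[q5 q6]; apply/andP; split; lra.
exists x; split=> // t t0; apply/subr0_eq/n1_eq0.
have [E [E0 hE]] := hT t.
have hE1 n s : s <= t -> n1 (picard x0 n s - x s) <= d%:R * E / 2 ^+ n.
  move=> st; rewrite -mulrA mulr_natl -[X in _ *+ X]card_ord -sumr_const; apply: ler_sum => i _.
  by rewrite !mxE; exact: hE.
pose K := RLk al (fun=> 1) t.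
apply: (@ler_geo _ _ _ (d%:R * E + kap * L * (d%:R * E * K))) => n; rewrite add0r.
have h1 := hE1 n.+1 t (lexx t).
have cp : cvec (picard x0 n) by exact: cvec_picard.
have h2 := RLv_lip t cp cx.
have h3 : RLk al (fun s => n1 (picard x0 n s - x s)) t <= (d%:R * E / 2 ^+ n) * K.
  have c1 := continuous_n1 (cvecB cp cx).
  rewrite -[leRHS]addr0 -[X in _ + X](mul0r K) -RLk_lin//; [|cont|cont].
  apply: ler_RLk => //; first by cont.
  by move=> s /andP[_ st]; rewrite mul0r addr0 mulr1; exact: hE1.
have -> : x t - (x0 + kap *: RLv al (fun s => F (x s)) t) = (x t - picard x0 n.+1 t) +
  (kap *: RLv al (fun s => F (picard x0 n s)) t - kap *: RLv al (fun s => F (x s)) t).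
  by rewrite /= opprD addrA; apply/colP => i; rewrite !mxE; ring.
apply: le_trans (n1D _ _) _.
rewrite -n1N opprB mulrDl; apply: lerD.
  apply: le_trans h1 _; rewrite ler_wpM2l ?mulr_ge0// lef_pV2 ?posrE ?exprn_gt0//.
  by rewrite ler_eXn2l ?ltr1n ?leqnSn.
apply: le_trans h2 _; rewrite -[leRHS]mulrA ler_pM2l ?mulr_gt0//.
by apply: le_trans h3 _; rewrite mulrAC.
Unshelve. all: by end_near. Qed.
End vector_picard.

(** * Equivalence of the Caputo equation and the Volterra equation *)

Section caputo.
Context {R : realType}.
Notation mu := (@lebesgue_measure R).
Implicit Types (z g h : R -> R) (al t T : R).

Lemma eq_RLk al g h t : 0 < al <= 1 -> continuous g -> continuous h ->
  (forall s, 0 <= s <= t -> g s = h s) -> RLk al g t = RLk al h t.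
Proof.
by move=> a01 cg ch e; apply/le_anti; rewrite !ler_RLk// => s /e ->.
Qed.

Lemma is_derive_eq_near f g (t v e : R) : 0 < e -> (forall s, `|t - s| < e -> f s = g s) ->
  is_derive t 1 g v -> is_derive t 1 f v.
Proof.
move=> e0 fg; apply: near_eq_is_derive.
near=> s; apply/esym/fg; near: s; exact: (nbhsx_ballx t e e0).
Unshelve. all: by end_near. Qed.

(** Equal to 1/Gamma(al) by the Beta-Gamma identity. In this form the constant is the one that the
    semigroup law produces, and that identity need not be invoked. *)
Definition kapC al : R := Gamma (1 - al) / betaB al.

Lemma kapC_gt0 al : 0 < al < 1 -> 0 < kapC al.
Proof.
move=> al01; have /andP[a0 a1] := al01.
by rewrite divr_gt0 ?betaB_gt0// Gamma_gt0// subr_gt0 a1/=; lra.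
Qed.

Lemma RL_integralE al h t : 0 < al <= 1 -> 0 <= t -> continuous h ->
  RL_integral al h t = (Gamma al)^-1 * RLk al h t.
Proof. by move=> al01 t0 ch; rewrite /RL_integral RLkE. Qed.

Variable al : R.
Hypothesis al01 : 0 < al < 1.
Let a0 : 0 < al. Proof. by case/andP: al01. Qed.
Let a1 : al < 1. Proof. by case/andP: al01. Qed.
Let al1 : 0 < al <= 1. Proof. by rewrite a0 ltW. Qed.
Let alc1 : 0 < 1 - al <= 1. Proof. by rewrite subr_gt0 a1 gerBl ltW. Qed.
Let alc : 0 < 1 - al < 1. Proof. by rewrite subr_gt0 a1 gtrBl. Qed.
Let Gam0 : 0 < Gamma (1 - al). 
Proof. by apply: Gamma_gt0; rewrite subr_gt0 a1/=; have := a0; lra. Qed.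
Let B0 : 0 < betaB al. Proof. exact: betaB_gt0. Qed.

(** By the semigroup law the integral of order 1 - al of z - z(0) is the primitive of g, whose
    derivative is g. *)
Lemma caputo_of_volterra z g (z0 : R) t : continuous z -> continuous g ->
  (forall s, 0 <= s -> z s = z0 + kapC al * RLk al g s) -> 0 < t ->
  is_Caputo_derivative al z t (g t).
Proof.
move=> cz cg hz t0; apply: (@is_derive_eq_near _ (prim g) t _ t t0); last exact: is_derive_prim.
move=> s; rewrite ltr_distlC => /andP[s0 _]; rewrite subrr in s0.
have e0 : z 0 = z0 by rewrite hz// RLk_le0// mulr0 addr0.
have ck := continuous_RLk al1 cg.
rewrite RL_integralE ?(ltW s0)//; last by rewrite /=; cont.
rewrite (@eq_RLk _ _ (fun s => kapC al * RLk al g s + 0 * RLk al g s))//.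
- rewrite RLk_lin// mul0r addr0 RLk_semigroup ?(ltW s0)// -primE ?(ltW s0)// /kapC.
  by field; rewrite !gt_eqF.
- by cont.
- by cont.
- by move=> r /andP[r0 _]; rewrite hz// e0 mul0r addr0 addrAC subrr add0r.
Qed.

(** Integrating the Caputo equation shows that the residual y = z - z(0) - kap I g has vanishing
    integral of order 1 - al. Applying the integral of order al makes the primitive of y vanish,
    hence y itself. [zc] is a continuous function on the line that agrees with z on [0, T]. *)
Lemma volterra_of_caputo z (zc : R -> R) g T : continuous zc -> continuous g ->
  (forall s, 0 <= s <= T -> zc s = z s) ->
  (forall t, 0 < t < T -> is_Caputo_derivative al z t (g t)) ->
  forall t, 0 <= t < T -> zc t = z 0 + kapC al * RLk al g t.
Proof.
move=> czc cg ez hz.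
pose w s := zc s - z 0.
have cw : continuous w by rewrite /w; cont.
pose H := RLk (1 - al) w.
have cH : continuous H by exact: continuous_RLk.
have dH t : 0 < t < T -> is_derive t 1 H (Gamma (1 - al) * g t).
  move=> /andP[t0 tT].
  pose e := Num.min t (T - t).
  have e0 : 0 < e by rewrite lt_min t0 subr_gt0.
  apply: (@is_derive_eq_near _ (fun s => Gamma (1 - al) * RL_integral (1 - al) (fun s => z s - z 0) s) t _ e e0).
    move=> s; rewrite lt_min !ltr_distlC subrr => /andP[/andP[s0 _] /andP[_ sT]].
    have {}sT : s < T by move: sT; rewrite addrC subrK.
    have -> : RL_integral (1 - al) (fun s => z s - z 0) s = RL_integral (1 - al) w s.
      congr (_ * _); apply: eq_Rintegral => r; rewrite inE/= in_itv/= => /andP[r0 rs].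
      by rewrite /w ez// r0 (le_trans rs)// ltW.
    by rewrite RL_integralE ?(ltW s0)// mulVKf// gt_eqF.
  by apply: is_derive_scale; apply: hz; rewrite t0.
have HE t : 0 <= t < T -> H t = Gamma (1 - al) * prim g t.
  move=> /andP[t0 tT]; rewrite primE//.
  have e : \int[mu]_(s in `[0, t]) (Gamma (1 - al) * g s) = H t - H 0.
    apply: FTC2_oo => //; first by cont.
    by move=> s /andP[s0 st]; apply: dH; rewrite s0 (lt_trans st).
  rewrite [H 0]RLk_le0 ?subr_gt0// subr0 in e.
  by rewrite -e -!primE//; [rewrite prim_scale|cont].
pose y s := w s - kapC al * RLk al g s.
have ck := continuous_RLk al1 cg.
have cy : continuous y by rewrite /y; cont.
have yE t : 0 <= t < T -> RLk (1 - al) y t = 0.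
  move=> /andP[t0 tT].
  have -> : y = (fun s => 1 * w s + - kapC al * RLk al g s).
    by apply/funext => s; rewrite /y mul1r mulNr.
  rewrite RLk_lin// -/H HE ?t0// RLk_semigroup// -primE// /kapC mul1r.
  by field; rewrite gt_eqF.
have py t : 0 <= t < T -> prim y t = 0.
  move=> /andP[t0 tT]; have := RLk_semigroup alc cy t0.
  rewrite (@eq_RLk _ _ (fun=> 0))//; first last.
  - by move=> s /andP[s0 st]; apply: yE; rewrite s0 (le_lt_trans st).
  - by cont.
  - exact: continuous_RLk.
  - by rewrite opprB addrC subrK.
  rewrite RLk_zero; last by rewrite opprB addrC subrK.
  rewrite -primE// => /esym/eqP; rewrite mulf_eq0 gt_eqF/=; last exact: betaB_gt0.
  by move/eqP.
have y0 t : 0 <= t < T -> y t = 0.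
  move=> /andP[]; rewrite le_eqVlt => /predU1P[<- T0|t0 tT].
    by rewrite /y /w ez ?lexx ?(ltW T0)// subrr RLk_le0// mulr0 subr0.
  have Tt : 0 < T - t by rewrite subr_gt0.
  have pt (h : R) : 0 < h < T - t -> prim y (t + h) - prim y t = 0.
    move=> /andP[h0 hT]; rewrite !py ?subr0// ?(ltW t0)//.
    by rewrite addr_ge0 ?(ltW t0) ?(ltW h0)//= -ltrBrDl.
  (* The primitive of y is constant to the right of t, so its derivative y(t) is at most 0; the same
     for -y gives equality. *)
  apply/le_anti/andP; split.
    apply: (is_derive_right_le Tt (is_derive_prim t0 cy)) => h /pt ->.
    by rewrite mul0r.
  rewrite -oppr_le0.
  have cNy : continuous (fun s => -1 * y s) by cont.
  have d := is_derive_prim t0 cNy; rewrite mulN1r in d.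
  apply: (is_derive_right_le Tt d) => h /pt e.
  by rewrite !prim_scale// -mulrBr e mulr0 mul0r.
move=> t tT; have := y0 t tT; rewrite /y /w => e.
by apply/eqP; rewrite -subr_eq0 opprD addrA e.
Qed.
End caputo.

(** * Truncation of the nonlinearity, and a continuity argument *)

Section cutoff.
Context {R : realType} (d : nat).
Implicit Types (v w : 'cV[R]_d) (x y : R -> 'cV[R]_d).

Lemma enormE v : enorm v = Num.sqrt (sqn v).
Proof. by []. Qed.

Lemma sqr_enorm v : enorm v ^+ 2 = sqn v.
Proof. by rewrite enormE sqr_sqrtr// sqn_ge0. Qed.

Lemma enorm_ge0 v : 0 <= enorm v.
Proof. exact: sqrtr_ge0. Qed.

Lemma enorm_le v (r : R) : 0 <= r -> (enorm v <= r) = (sqn v <= r ^+ 2).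
Proof. by move=> r0; rewrite -sqr_enorm ler_pXn2r ?nnegrE ?enorm_ge0. Qed.

Lemma sqn_eq0 v : sqn v <= 0 -> v = 0.
Proof.
move=> v0; have {v0} : sqn v == 0 by rewrite eq_le v0 sqn_ge0.
rewrite psumr_eq0 => [/allP h|i _]; last exact: sqr_ge0.
by apply/colP => i; rewrite mxE; have := h i (mem_index_enum _); rewrite sqrf_eq0 => /eqP.
Qed.

Lemma small_lipschitz (f : 'cV[R]_d -> 'cV[R]_d) (e : R) :
  lip_modulus f r @[r --> 0^'+] --> 0%E -> 0 < e ->
  exists r, 0 < r /\ forall v w, sqn v <= r ^+ 2 -> sqn w <= r ^+ 2 ->
    sqn (f v - f w) <= e * sqn (v - w).
Proof.
move=> hf e0; pose s := Num.sqrt e; have s0 : 0 < s by rewrite sqrtr_gt0.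
have : \forall r \near 0^'+, (lip_modulus f r < s%:E)%E.
  by apply: (hf [set y | (y < s%:E)%E]); apply: open_ereal_lt'; rewrite lte_fin.
move=> /(filterI (nbhs_right_gt 0)) /filter_ex[r [r0 hr]].
exists r; split => // v w hv hw.
have [->|vw] := eqVneq v w; first by rewrite !subrr (_ : sqn 0 = 0) ?mulr0// /sqn big1// => i _; rewrite mxE expr0n.
have nz : 0 < enorm (v - w).
  rewrite lt_neqAle enorm_ge0 andbT eq_sym; apply: contra vw => /eqP h.
  by rewrite -subr_eq0; apply/eqP/sqn_eq0; rewrite -sqr_enorm h expr0n.
have : ((enorm (f v - f w) / enorm (v - w))%:E <= lip_modulus f r)%E.
  by apply: ereal_sup_ubound; exists v, w; split => //; rewrite /eball/= enorm_le// ltW.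
move=> /le_lt_trans/(_ hr); rewrite lte_fin ltr_pdivrMr// => h.
by rewrite -!sqr_enorm -(sqr_sqrtr (ltW e0)) -exprMn lerXn2r ?nnegrE ?enorm_ge0 ?mulr_ge0 ?enorm_ge0 ?sqrtr_ge0 ?ltW.
Qed.

(** Truncation coordinate by coordinate is nonexpansive in the Euclidean norm and fixes the ball of
    radius rho; its image lies in a ball larger by a factor that depends on the dimension. *)
Definition clamp (rho a : R) : R := Num.max (- rho) (Num.min rho a).
Definition clampv rho v : 'cV[R]_d := \col_i clamp rho (v i ord0).

Lemma clamp_id rho a : `|a| <= rho -> clamp rho a = a.
Proof. by rewrite ler_norml => /andP[h1 h2]; rewrite /clamp min_r// max_r. Qed.

Lemma clamp_norm rho a : 0 <= rho -> `|clamp rho a| <= rho.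
Proof.
move=> r0; rewrite ler_norml /clamp; apply/andP; split; first by rewrite le_max lexx.
by rewrite ge_max ge_min lexx andbT; lra.
Qed.

Lemma clamp_lip rho a b : (clamp rho a - clamp rho b) ^+ 2 <= (a - b) ^+ 2.
Proof.
rewrite -[leLHS]real_normK ?num_real// -[leRHS]real_normK ?num_real// lerXn2r ?nnegrE//.
rewrite /clamp /Num.max /Num.min.
by repeat case: ifP; rewrite ?real_ltNge ?num_real//; (do ?move=> /negbT); rewrite -?leNgt => *;
  rewrite ler_norml; (case: (lerP 0 (a - b)) => hab; [rewrite ger0_norm//|rewrite ltr0_norm//]); apply/andP; split; lra.
Qed.

Lemma sqn_clampv rho v w : sqn (clampv rho v - clampv rho w) <= sqn (v - w).
Proof. by apply: ler_sum => i _; rewrite !mxE; exact: clamp_lip. Qed.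

Lemma clampv_id rho v : 0 <= rho -> sqn v <= rho ^+ 2 -> clampv rho v = v.
Proof.
move=> r0 hv; apply/colP => i; rewrite mxE clamp_id//.
rewrite -(@ler_pXn2r _ 2) ?nnegrE// real_normK ?num_real//; apply: le_trans hv.
by rewrite /sqn (bigD1 i)//= lerDl sumr_ge0// => j _; exact: sqr_ge0.
Qed.

Lemma sqn_clampv_le rho v : 0 <= rho -> sqn (clampv rho v) <= d%:R * rho ^+ 2.
Proof.
move=> r0; rewrite mulr_natl -[X in _ *+ X]card_ord -sumr_const; apply: ler_sum => i _.
by rewrite mxE -real_normK ?num_real// lerXn2r ?nnegrE// clamp_norm.
Qed.

(** Passage from the Euclidean norm of the decay estimate to the l1 norm of the Picard iteration.
    The constant L is at least 1, so L <= L^2 and no square root is needed. *)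
Lemma sqn_n1_lipschitz (F : 'cV[R]_d -> 'cV[R]_d) (K : R) : 0 <= K ->
  (forall v w, sqn (F v - F w) <= K * sqn (v - w)) ->
  n1_lipschitz (1 + (1 + d%:R) * K) F.
Proof.
move=> K0 hF v w; set L := 1 + _.
have L0 : 0 <= (1 + d%:R) * K by rewrite mulr_ge0// addr_ge0.
have L1 : 1 <= L by rewrite lerDl.
rewrite -(@ler_pXn2r _ 2) ?nnegrE ?n1_ge0// ?mulr_ge0 ?n1_ge0 ?(le_trans ler01 L1)//.
apply: le_trans (n1_le_sqn _) _.
apply: (@le_trans _ _ ((1 + d%:R) * (K * sqn (v - w)))); first by rewrite ler_wpM2l ?addr_ge0.
rewrite mulrA exprMn; apply: ler_pM; rewrite ?sqn_ge0 ?sqn_le_n1//.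
apply: (@le_trans _ _ L); first by rewrite lerDr.
by rewrite expr2 ler_peMr// (le_trans ler01).
Qed.

Lemma cvec_continuous x : cvec x -> continuous x.
Proof.
move=> cx t; apply/cvgrPdist_le => e e0.
have cc : cvec (fun=> x t) by exact: cvec_cst.
have c1 := continuous_n1 (cvecB cc cx).
have : {for t, continuous (fun s => n1 (x t - x s))} by exact: c1.
rewrite /prop_for/= /continuous_at subrr => /cvgrPdist_le/(_ _ e0).
apply: filterS => s; rewrite n1_0 sub0r normrN (ger0_norm (n1_ge0 _)); apply: le_trans.
rewrite [leLHS]mx_normrE; apply: bigmax_le => [|[i j] _]; first exact: n1_ge0.
by rewrite ord1; exact: ler_n1.
Qed.

Lemma continuous_cvec x : continuous x -> cvec x.
Proof. by move=> cx i t; exact: (continuous_comp (cx t) (@coord_continuous _ _ _ i ord0 (x t))). Qed.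

(** If q reached b, let i be the infimum of the times where it does. Just before i the hypothesis
    gives q <= b/4, while arbitrarily close after i, or at i, there are points with q >= b; this
    contradicts continuity at i. *)
Lemma continuity_trap (q : R -> R) (T b : R) : 0 < b -> continuous q -> q 0 <= b / 4 ->
  (forall t, 0 <= t <= T -> (forall s, 0 <= s <= t -> q s < b) -> q t <= b / 4) ->
  forall s, 0 <= s <= T -> q s < b.
Proof.
move=> b0 cq q0 hq s /andP[s0 sT]; rewrite ltNge; apply/negP => bs.
pose B : set R := [set s | 0 <= s <= T /\ b <= q s].
have Bs : B s by split; [rewrite s0|].
have lB : lbound B 0 by move=> r [/andP[]].
have hB : has_inf B by split; [exists s|exists 0].
pose i := inf B.
have i0 : 0 <= i by apply: lb_le_inf => //; exists s.
have iT : i <= T by apply: le_trans sT; apply: ge_inf => //; exists 0.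
have := cq i; rewrite /continuous_at => /cvgrPdist_lt/(_ (b / 8)).
rewrite divr_gt0// => /(_ isT) /nbhs_ballP[e /= e0 he].
have [r [rT br] rie] := inf_adherent e0 hB.
have ir : i <= r by apply: ge_inf => //; exists 0.
have h1 := he r; rewrite /ball/= ltr_distlC in h1.
have {}h1 : `|q i - q r| < b / 8 by apply: h1; apply/andP; split; lra.
pose t := Num.max 0 (i - e / 2).
have ti : t <= i by rewrite ge_max i0/=; lra.
have h2 := he t; rewrite /ball/= ltr_distlC in h2.
have {}h2 : `|q i - q t| < b / 8.
  by apply: h2; rewrite lt_max; apply/andP; split; [apply/orP; right; lra|lra].
have ht : q t <= b / 4.
  have [i00|i00] := eqVneq i 0.
    by have -> : t = 0 by apply/le_anti; rewrite le_max lexx -{1}i00 ti.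
  have tlt : t < i by rewrite gt_max lt_neqAle i0 eq_sym i00/=; lra.
  apply: hq; first by rewrite le_max lexx (le_trans ti).
  move=> z /andP[z0 zt]; rewrite ltNge; apply/negP => bz.
  have : i <= z.
    apply: ge_inf; first by exists 0.
    by split => //; rewrite z0 (le_trans zt)// (le_trans ti).
  by move=> iz; have := le_lt_trans (le_trans iz zt) tlt; rewrite ltxx.
move: h1 h2; rewrite !ltr_norml => /andP[h1 h1'] /andP[h2 h2']; lra.
Qed.
End cutoff.

(** * Translation of the spectral hypothesis *)

Lemma carg_norm_le (R : realType) (z : R[i]) :
  `|carg z| = acos (complex.Re z / Num.sqrt (complex.Re z ^+ 2 + complex.Im z ^+ 2)).
Proof.
have h : 0 <= acos (complex.Re z / Num.sqrt (complex.Re z ^+ 2 + complex.Im z ^+ 2)).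
  apply: acos_ge0; rewrite -ler_norml normrM normfV [X in _ / X]ger0_norm ?sqrtr_ge0//.
  have [s0|s0] := eqVneq (Num.sqrt (complex.Re z ^+ 2 + complex.Im z ^+ 2)) 0.
    by rewrite s0 invr0 mulr0.
  have s1 : 0 < Num.sqrt (complex.Re z ^+ 2 + complex.Im z ^+ 2) by rewrite lt_def s0 sqrtr_ge0.
  by rewrite ler_pdivrMr// mul1r -sqrtr_sqr ler_sqrt ?lerDl ?sqr_ge0// addr_ge0 ?sqr_ge0.
by rewrite /carg /=; case: ifP => _; rewrite ?normrN ger0_norm.
Qed.

Lemma good_eigenvalue_carg (R : realType) (al : R) (lam : R[i]) : 0 < al < 1 ->
  lam != 0 -> al * pi / 2 < `|carg lam| -> good_eigenvalue al lam.
Proof.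
move=> al01 l0; rewrite carg_norm_le => h; apply: sector_angle => //.
case: lam l0 {h} => a b; rewrite eq_complex/= negb_and => ab.
by rewrite paddr_eq0 ?sqr_ge0// !sqrf_eq0 negb_and.
Qed.

Lemma unitmx_eigenvalue (R : realType) d (A : 'M[R]_d) :
  ~~ eigenvalue (map_mx (real_complex R) A) 0 -> A \in unitmx.
Proof.
rewrite /eigenvalue negbK /eigenspace -(map_unitmx (real_complex R)) -row_free_unit.
by rewrite -kermx_eq0 (_ : 0%:M = 0) ?subr0//; apply/matrixP => i j; rewrite !mxE mul0rn.
Qed.

(** * Solutions of the truncated and of the original equation *)

Section solutions.
Context {R : realType} (d : nat).
Variables (al : R) (A : 'M[R]_d) (f : 'cV[R]_d -> 'cV[R]_d) (rho L : R).
Hypothesis al01 : 0 < al < 1.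
Hypothesis cf : continuous f.
Hypothesis rho0 : 0 < rho.
Hypothesis L0 : 0 < L.
Let ft v := f (clampv rho v).
Let Ft v := A *m v + ft v.
Hypothesis hL : n1_lipschitz L Ft.
Let a0 : 0 < al. Proof. by case/andP: al01. Qed.
Let a1 : al < 1. Proof. by case/andP: al01. Qed.
Let al1 : 0 < al <= 1. Proof. by rewrite a0 ltW. Qed.
Let k0 : 0 < kapC al. Proof. exact: kapC_gt0. Qed.

(** As long as x stays in the ball of radius rho the truncation acts as the identity along it, so
    the truncated and the original right-hand sides coincide. *)
Lemma volterra_solution x (x0 : 'cV[R]_d) : cvec x ->
  (forall t, 0 <= t -> x t = x0 + kapC al *: RLv al (fun s => Ft (x s)) t) ->
  (forall t, 0 <= t -> sqn (x t) <= rho ^+ 2) ->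
  is_solution al (fun v => A *m v + f v) x0 +oo%E x.
Proof.
move=> cx ex hx; have cF := cvec_lip L0 hL cx; split.
- by rewrite ltry.
- by apply: continuous_subspaceT; exact: cvec_continuous.
- rewrite ex//; apply/colP => i; rewrite !mxE RLk_le0//; ring.
- move=> t t0 _ i.
  rewrite -[f (x t)](_ : ft (x t) = _); last by rewrite /ft clampv_id ?(ltW rho0)// hx// ltW.
  apply: (@caputo_of_volterra _ _ al01 _ (fun s => Ft (x s) i ord0) (x0 i ord0)) => //.
  by move=> s s0; rewrite {1}ex// !mxE.
Qed.

Lemma is_solution_volterra (F : 'cV[R]_d -> 'cV[R]_d) (x0 : 'cV[R]_d) S y T :
  (forall y, continuous y -> cvec (fun t => F (y t))) -> is_solution al F x0 S y -> 0 < T -> (T%:E < S)%E ->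
  exists yc, [/\ continuous yc, (forall t, 0 <= t <= T -> yc t = y t) &
    forall t, 0 <= t < T -> yc t = x0 + kapC al *: RLv al (fun s => F (yc s)) t].
Proof.
move=> cF [S0 cy y0 dy] T0 TS.
(* Retraction of the line onto [0, T]: y composed with it is continuous everywhere and agrees with y
   on [0, T]. *)
pose g (t : R) : R := Num.max 0 (Num.min t T).
have cg : continuous g.
  move=> t; apply: (@continuous_max _ _ ((fun=> 0) : R -> R^o) (fun t : R => Num.min t T : R^o) t).
    exact: continuous_for_cst.
  apply: (@continuous_min _ _ (fun t : R => t : R^o) ((fun=> T) : R -> R^o) t).
    exact: continuous_for_id.
  exact: continuous_for_cst.
have gD t : time_domain S (g t).
  split; first by rewrite /g le_max lexx.
  by apply: le_lt_trans TS; rewrite lee_fin /g ge_max (ltW T0)/= ge_min lexx orbT.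
have gE t : 0 <= t <= T -> g t = t by move=> /andP[t0 tT]; rewrite /g min_l// max_r.
pose yc t := y (g t).
have cyc : continuous yc.
  move=> t U hU; have /subspace_continuousP := cy.
  move=> /(_ _ (gD t)) /(_ U hU); rewrite /= /within/= => h.
  have hg : nbhs t (g @^-1` [set r | time_domain S r -> U (y r)]) := cg t _ h.
  change (nbhs t [set s | U (y (g s))]).
  by apply: filterS hg => s /= hs; exact: hs (gD s).
exists yc; split => //; first by move=> t tT; rewrite /yc gE.
have cvy := continuous_cvec cyc.
have cFy := cF _ cyc.
move=> t tT; apply/colP => i; rewrite !mxE -y0.
apply: (@volterra_of_caputo _ _ al01 (fun s => y s i ord0) (fun s => yc s i ord0)
  (fun s => F (yc s) i ord0) T) => //.
  by move=> s sT; rewrite /yc gE.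
move=> s /andP[s0 sT]; rewrite /yc gE ?(ltW s0) ?(ltW sT)//.
by apply: dy => //; apply: lt_trans TS; rewrite lte_fin.
Qed.

(** While another solution stays in the ball of radius rho it solves the truncated equation, hence
    equals x and lies in the ball of radius rho/2. [continuity_trap] turns this gap into a bound at
    all times. *)
Lemma solution_unique x (x0 : 'cV[R]_d) : cvec x ->
  (forall t, 0 <= t -> x t = x0 + kapC al *: RLv al (fun s => Ft (x s)) t) ->
  (forall t, 0 <= t -> sqn (x t) <= rho ^+ 2 / 4) ->
  forall S y, is_solution al (fun v => A *m v + f v) x0 S y ->
  {in time_domain S, y =1 x}.
Proof.
move=> cx ex hx S y sy t; rewrite inE => -[t0 tS].
(* Room is needed on both sides: the Volterra equation is only obtained on [[0, T[], and y is only
   known to be continuous before S. *)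
have [T [tT TS]] : exists T, t < T /\ (T%:E < S)%E.
  case: S tS {sy} => [r|_|]; last by rewrite ltNge leNye.
    by rewrite lte_fin => tr; exists ((t + r) / 2); rewrite lte_fin; split; lra.
  by exists (t + 1); rewrite ltry; split=> //; lra.
have T0 : 0 < T by exact: le_lt_trans tT.
have cF (z : R -> 'cV[R]_d) : continuous z -> cvec (fun s => A *m z s + f (z s)).
  move=> cz; apply: cvecD; first by apply: cvecM; exact: continuous_cvec.
  by apply: continuous_cvec => s; apply: continuous_comp; [exact: cz|exact: cf].
have [yc [cyc yE ey]] := is_solution_volterra cF sy T0 TS.
rewrite -yE ?t0 ?(ltW tT)//.
have cy := continuous_cvec cyc; have cFy := cF _ cyc.
have cFt := cvec_lip L0 hL cy.
have agree s : 0 <= s <= t -> (forall r, 0 <= r <= s -> sqn (yc r) <= rho ^+ 2) ->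
    forall r, 0 <= r <= s -> yc r = x r.
  move=> /andP[s0 st] hy; apply: (volterra_unique al1 k0 L0 hL cy cx (x0 := x0)).
    move=> r /andP[r0 rs].
    have rT : 0 <= r < T by rewrite r0 (le_lt_trans rs) ?(le_lt_trans st).
    rewrite (ey r rT).
    congr (_ + _ *: _); apply/colP => i; rewrite !mxE; apply: eq_RLk => //.
    move=> z /andP[z0 zr]; rewrite /Ft /ft clampv_id ?(ltW rho0)//.
    by apply: hy; rewrite z0 (le_trans zr).
  by move=> r /andP[r0 rs]; exact: ex.
have b0 : 0 < rho ^+ 2 by rewrite exprn_gt0.
have hq : forall s, 0 <= s <= t -> sqn (yc s) < rho ^+ 2.
  apply: (continuity_trap b0 (continuous_sqn cy)).
    have <- : x 0 = yc 0.
      have T00 : 0 <= (0 : R) < T by apply/andP; split.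
      rewrite (ex 0 (lexx 0)) (ey 0 T00); congr (_ + _ *: _).
      by apply/colP => i; rewrite !mxE !RLk_le0.
    exact: hx.
  move=> s sT hs; rewrite (agree s sT) ?hx//; first by case/andP: sT.
    by move=> r rs; apply: ltW; exact: hs.
  by case/andP: sT => ->; rewrite lexx.
apply: (agree t); rewrite ?t0 ?lexx// => r rt.
by apply: ltW; exact: hq.
Qed.
End solutions.

(** * Choice of the radii and assembly of the estimates *)

Theorem theorem12 (R : realType) (alpha : R) (d : nat)
    (A : 'M[R]_d) (f : 'cV[R]_d -> 'cV[R]_d)
    (halpha : 0 < alpha < 1)
    (hfcont : continuous f)
    (hflip : lipschitz_near0 f)
    (hf0 : f 0 = 0)
    (hell : lip_modulus f r @[r --> 0^'+] --> 0%E)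
    (hA : forall lambda : R[i],
        eigenvalue (map_mx (real_complex R) A) lambda ->
        lambda != 0 /\ alpha * pi / 2 < `|carg lambda|) :
  mittag_leffler_stable alpha (fun x => A *m x + f x).
Proof.
have /andP[a0 a1] := halpha.
have al1 : 0 < alpha <= 1 by rewrite a0 ltW.
have k0 := kapC_gt0 halpha.
have gA lam : eigenvalue (map_mx (real_complex R) A) lam -> good_eigenvalue alpha lam.
  by move=> /hA[l0 hl]; exact: good_eigenvalue_carg.
have uA : A \in unitmx.
  by apply: unitmx_eigenvalue; apply/negP => /hA[]; rewrite eqxx.
have [eps [C [eps0 C0 hD]]] := solution_decay halpha k0 gA uA.
have [r [r0 hr]] := small_lipschitz hell eps0.
(* The truncated vectors have squared norm at most d rho^2 <= r^2, so they stay in the ball where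
   [f] has the small Lipschitz constant. *)
pose rho := r / (1 + d%:R).
have d1 : 0 < 1 + d%:R :> R by rewrite ltr_wpDr.
have rho0 : 0 < rho by rewrite divr_gt0.
pose ft v := f (clampv rho v).
have clr (v : 'cV[R]_d) : sqn (clampv rho v) <= r ^+ 2.
  apply: le_trans (sqn_clampv_le v (ltW rho0)) _.
  have -> : r = (1 + d%:R) * rho by rewrite /rho mulrC divfK// gt_eqF.
  rewrite [leRHS]exprMn ler_wpM2r ?sqr_ge0//.
  by have := ler0n R d; have := sqr_ge0 (d%:R : R); lra.
have hft v w : sqn (ft v - ft w) <= eps * sqn (v - w).
  by apply: le_trans (hr _ _ (clr v) (clr w)) _; rewrite ler_pM2l// sqn_clampv.
have ft0 : ft 0 = 0.
  rewrite /ft clampv_id ?(ltW rho0)//.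
  by rewrite (_ : sqn 0 = 0) ?sqr_ge0// /sqn big1// => i _; rewrite mxE expr0n.
have [N [N0 hN]] := sqn_mulmx A.
pose Ft v := A *m v + ft v.
have hL : n1_lipschitz (1 + (1 + d%:R) * (2 * N + 2 * eps)) Ft.
  apply: sqn_n1_lipschitz => [|v w].
    by rewrite addr_ge0// mulr_ge0// ltW.
  have -> : Ft v - Ft w = A *m (v - w) + (ft v - ft w).
    by rewrite /Ft opprD addrACA mulmxBr.
  apply: le_trans (sqnD _ _) _; rewrite [leRHS]mulrDl -!mulrA.
  by apply: lerD; rewrite ler_pM2l.
set L := 1 + _ in hL.
have L0 : 0 < L by rewrite ltr_wpDr// !mulr_ge0 ?addr_ge0 ?mulr_ge0 ?(ltW N0) ?(ltW eps0).
(* Ensures C |x0|^2 <= C del^2 <= (1+C)^2 del^2 = rho^2/4, so the decay bound confines the solution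
   to the ball of radius rho/2. *)
pose del := rho / (2 * (1 + C)).
have C1 : 0 < 1 + C by rewrite addr_gt0.
have del0 : 0 < del by rewrite divr_gt0// mulr_gt0.
(* The exponent is half of the one for the squared norm; rho is an admissible bound m because C
   |x0|^2 <= rho^2/4. *)
exists (alpha * (1 - alpha) / 2), rho, del; split=> //.
  by rewrite divr_gt0// mulr_gt0// subr_gt0.
move=> x0 hx0.
have hx0' : C * sqn x0 <= rho ^+ 2 / 4.
  have h1 : sqn x0 <= del ^+ 2 by rewrite -enorm_le// ltW.
  apply: (@le_trans _ _ (C * del ^+ 2)); first by rewrite ler_pM2l.
  have -> : rho = del * (2 * (1 + C)) by rewrite /del divfK// gt_eqF// mulr_gt0.
  have -> : (del * (2 * (1 + C))) ^+ 2 / 4 = (1 + C) ^+ 2 * del ^+ 2 by field.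
  rewrite ler_wpM2r ?sqr_ge0//; have := C0; have := sqr_ge0 C; lra.
have [Phi [cP eP]] := picard_exists al1 k0 L0 hL x0.
have cfP : cvec (fun t => ft (Phi t)).
  apply: (@cvec_lip _ _ (1 + (1 + d%:R) * eps)) => //.
    by rewrite ltr_wpDr// mulr_ge0 ?(ltW eps0) ?(ltW d1).
  exact: (sqn_n1_lipschitz (ltW eps0)).
have dec := hD ft Phi x0 cP cfP eP ft0 hft.
have hP t : 0 <= t -> sqn (Phi t) <= rho ^+ 2 / 4.
  by move=> /dec[h _]; exact: le_trans h hx0'.
have hP' t : 0 <= t -> sqn (Phi t) <= rho ^+ 2.
  by move=> /hP /le_trans; apply; have := sqr_ge0 rho; lra.
exists Phi; split.
  split; first exact: (volterra_solution halpha rho0 L0 hL cP eP hP').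
  move=> S y sy; split; first by rewrite leey.
  exact: (solution_unique halpha hfcont rho0 L0 hL cP eP hP sy).
apply: ge_ereal_sup => _ [t t0 <-]; rewrite lee_fin.
rewrite -(@ler_pXn2r _ 2) ?nnegrE ?(ltW rho0)//; last first.
  by rewrite mulr_ge0 ?powR_ge0 ?enorm_ge0.
rewrite exprMn sqr_enorm.
have [_ h] := dec t t0.
(* After squaring, the claim is the weighted bound of [solution_decay]. *)
have -> : (t `^ (alpha * (1 - alpha) / 2)) ^+ 2 = t `^ (alpha * (1 - alpha)).
  by rewrite -powR_mulrn ?powR_ge0// -powRrM; congr powR; field.
by apply: le_trans h _; apply: le_trans hx0' _; have := sqr_ge0 rho; lra.
Qed.
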